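(* Let $L$ be a positive definite even lattice with basis $\{\gamma_1,\dots,\gamma_d\}$, and let $(V_L)_{\mathbb{Z}}$ be the $\mathbb{Z}$-span in $V_L$ of the elements $$s_{\alpha_1,n_1}s_{\alpha_2,n_2}\cdots s_{\alpha_k,n_k}e^{\alpha}$$ where $k\ge 0$, $\alpha_i\in\{\gamma_1,\dots,\gamma_d\}$, $n_1\ge n_2\ge\cdots\ge n_k\geq 0$ and $\alpha\in L$. Then $(V_L)_{\mathbb{Z}}$ is an IVOA (in $V_L$), and it is generated (as a vertex algebra over $\mathbb{Z}$) by $e^{\pm\gamma_i}$ for $i=1,\dots,d$. The natural bilinear form on $V_L$ restricted to $(V_L)_{\mathbb{Z}}$ is integral, i.e. $((V_L)_{\mathbb{Z}},(V_L)_{\mathbb{Z}})\subseteq\mathbb{Z}$. Moreover, $M(1)_{\mathbb{Z}}$ is a sub IVOA of $(V_L)_{\mathbb{Z}}$ (that is, an IVOA in $M(1)$ contained in $(V_L)_{\mathbb Z}$).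
   Context: $V_L=M(1)\otimes\mathbb{C}\{L\}$ is the lattice vertex operator algebra over $\mathbb{C}$ attached to $L$ (Frenkel–Lepowsky–Meurman), with $M(1)=S(\bigoplus_{n>0}(\mathbb{C}\otimes_{\mathbb{Z}} L)\otimes t^{-n})$ the Heisenberg vertex operator subalgebra, $\alpha(n)$ the Heisenberg operators, and elements $e^\alpha$, $\alpha\in L$, with product $e^\alpha e^\beta=\epsilon(\alpha,\beta)e^{\alpha+\beta}$, where $\epsilon:L\times L\to\{\pm1\}$ is bimultiplicative with $\epsilon(\alpha,\alpha)=(-1)^{(\alpha,\alpha)/2}$ and hence $\epsilon(\alpha,\beta)\epsilon(\beta,\alpha)=(-1)^{(\alpha,\beta)}$. For $\alpha$ in the dual lattice $L^*$, define $s_{\alpha,n}$ by $$\exp\Big(\sum_{n>0}\frac{\alpha(-n)}{n}z^n\Big)=\sum_{n\ge0}s_{\alpha,n}z^n .$$ $M(1)_{\mathbb{Z}}$ is the $\mathbb{Z}$-span of all $s_{\alpha_1,n_1}\cdots s_{\alpha_k,n_k}$ with $k\ge 0$, $\alpha_i\in L$, $n_i\ge0$. The natural bilinear form on $V_L$ is the unique nondegenerate symmetric invariant bilinear form with $(e^\alpha,e^\beta)=\delta_{\alpha,-\beta}$ for $\alpha,\beta\in L$ and $(\alpha(n)u,v)=-(u,\alpha(-n)v)$ for $\alpha\in L$, $n\in\mathbb{Z}$. An IVOA (integral VOA form) in a VOA $V=\bigoplus_nV_n$ over $\mathbb{C}$ with a nondegenerate symmetric bilinear form $(\cdot,\cdot)$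 is an additive subgroup $R\le V$ such that: $\mathbf 1\in R$ and $u_nv\in R$ for all $u,v\in R$, $n\in\mathbb{Z}$ (i.e. $R$ is a vertex algebra over $\mathbb{Z}$); $s\omega\in R$ for some positive integer $s$ ($\omega$ the Virasoro element); for each $n$, $R\cap V_n$ is the $\mathbb{Z}$-span of a $\mathbb{C}$-basis of $V_n$; and $(R,R)\subseteq\mathbb{Q}$. *)

(* Defs.v *)
From HB Require Import structures.
From mathcomp Require Import all_boot all_order all_algebra finmap.
From mathcomp Require Import boolp classical_sets fsbigop reals complex.
From mathcomp.multinomials Require Import monalg.

Set Implicit Arguments.
Unset Strict Implicit.
Unset Printing Implicit Defensive.

Import Order.TTheory GRing.Theory Num.Theory.

Local Open Scope classical_set_scope.
Local Open Scope ring_scope.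

(* ------------------------------------------------------------------ *)
(* Vertex operator algebras: the structure used by the notions below.  *)

(* Only the data are recorded; the axioms of a VOA are not fields.
   [nprod u n v] is u_n v, where Y(u,z)v = \sum_n (u_n v) z^(-n-1), and
   [grade n] is V_n. *)
Record voa_data (C : fieldType) := VoaData {
  voa_sort :> lmodType C;
  nprod : voa_sort -> int -> voa_sort -> voa_sort;
  vac : voa_sort;
  omega : voa_sort;
  grade : int -> set voa_sort
}.

Arguments nprod {C V} u n v : rename.
Arguments vac {C} V : rename.
Arguments omega {C} V : rename.
Arguments grade {C} V n : rename.

Definition zspan (V : zmodType) (S : set V) : set V :=
  [set v | exists (n : nat) (c : 'I_n -> int) (x : 'I_n -> V),
     (forall i, S (x i)) /\ v = \sum_(i < n) x i *~ c i].

Definition is_basis_of (C : fieldType) (V : lmodType C) (W : set V)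
    (n : nat) (b : 'I_n -> V) : Prop :=
  (forall c : 'I_n -> C, \sum_(i < n) c i *: b i = 0 -> forall i, c i = 0) /\
  W = [set v | exists c : 'I_n -> C, v = \sum_(i < n) c i *: b i].

Section VertexAlgebra.
Variables (C : numFieldType) (V : voa_data C).

Definition is_additive_subgroup (S : set V) : Prop :=
  S 0 /\ forall u v, S u -> S v -> S (u - v).

Definition is_Zvertex_subalgebra (S : set V) : Prop :=
  [/\ is_additive_subgroup S, S (vac V)
    & forall (u v : V) (n : int), S u -> S v -> S (nprod u n v)].

Definition Zva_generated (S : set V) : set V :=
  smallest is_Zvertex_subalgebra S.

(* [is_IVOA B U S]: S is an integral VOA form in U, where U is a vertex
   operator subalgebra of V with the same vacuum and Virasoro element,
   graded by the U `&` V_n and equipped with the restriction of the form B.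
   For U = setT this is the notion of IVOA in V. *)
Definition is_IVOA (B : V -> V -> C) (U S : set V) : Prop :=
  [/\ S `<=` U,
      is_Zvertex_subalgebra S,
      exists2 s : nat, (0 < s)%N & S (omega V *+ s),
      forall n : int, exists (m : nat) (b : 'I_m -> V),
        is_basis_of (U `&` grade V n) b /\
        S `&` grade V n = zspan (range b)
    & forall u v, S u -> S v -> exists q : rat, B u v = ratr q].

Definition is_bilinear_form (B : V -> V -> C) : Prop :=
  (forall c u u' v, B (c *: u + u') v = c * B u v + B u' v) /\
  (forall c u v v', B u (c *: v + v') = c * B u v + B u v').

Definition is_symmetric_form (B : V -> V -> C) : Prop :=
  forall u v, B u v = B v u.

Definition is_nondegenerate_form (B : V -> V -> C) : Prop :=
  forall u, (forall v, B u v = 0) -> u = 0.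

(* The coefficient of z^(-n-1), for u of weight m, in
   (Y(u,z)v, w) = (v, Y(exp(z L(1)) (-z^(-2))^(L(0)) u, z^(-1)) w),
   where L(1) = omega_2.  The sum has finitely many nonzero terms since L(1)
   lowers the weight by one. *)
Definition is_invariant_form (B : V -> V -> C) : Prop :=
  forall (m n : int) (u v w : V), grade V m u ->
    B (nprod u n v) w =
    \sum_(i \in [set: nat])
      (-1) ^ m / i`!%:R *
      B v (nprod (iter i (nprod (omega V) 2) u) (2 * m - n - 2 - i%:Z) w).

End VertexAlgebra.

(* ------------------------------------------------------------------ *)
(* Lattices.                                                           *)

Definition is_posdef_even_form (L : zmodType) (ip : L -> L -> int) : Prop :=
  [/\ forall a b, ip a b = ip b a,
      forall a b c, ip (a + b) c = ip a c + ip b c,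
      forall a, a != 0 -> 0 < ip a a
    & forall a, (2 %| ip a a)%Z].

Definition is_lattice_basis (L : zmodType) (d : nat) (gam : 'I_d -> L) : Prop :=
  forall a : L, exists! c : {ffun 'I_d -> int}, a = \sum_(i < d) gam i *~ c i.

Definition is_cocycle (L : zmodType) (ip eps : L -> L -> int) : Prop :=
  [/\ forall a b, eps a b = 1 \/ eps a b = -1,
      forall a b c, eps (a + b) c = eps a c * eps b c,
      forall a b c, eps a (b + c) = eps a b * eps a c
    & forall a, eps a a = (-1) ^ (ip a a %/ 2)%Z].

Definition coord (L : zmodType) (d : nat) (gam : 'I_d -> L) (a : L) :
    {ffun 'I_d -> int} :=
  xget 0 [set c : {ffun 'I_d -> int} | a = \sum_(i < d) gam i *~ c i].

(* ------------------------------------------------------------------ *)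
(* The spaces M(1) and V_L.                                            *)

(* M(1) is the polynomial algebra in the gamma_i(-n), n > 0, where
   gamma_1,...,gamma_d is a basis of L.  The variable gamma_i(-n-1) is encoded
   by the pair (i, n), so that n ranges over all natural numbers. *)
Notation heis_monom d := {cmonom ('I_d * nat)%type}.
Notation heis_alg R d := {malg R[i][heis_monom d]}.

(* V_L = M(1) (x) C{L}: finitely supported families of elements of M(1)
   indexed by L.  The tensor p (x) e^a is << p *g a >>. *)
Definition lattice_space (R : realType) (L : zmodType) (d : nat) : Type :=
  {malg heis_alg R d[L]}.

Section LatticeSpace.
Variables (R : realType) (L : zmodType) (d : nat).
Notation C := R[i].
Notation VL := (lattice_space R L d).

HB.instance Definition _ := GRing.Zmodule.copy VL {malg heis_alg R d[L]}.

Definition lattice_scale (c : C) (v : VL) : VL :=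
  (c%:MP : heis_alg R d) *: (v : {malg heis_alg R d[L]}).

Fact lattice_scaleA a b v :
  lattice_scale a (lattice_scale b v) = lattice_scale (a * b) v.
Proof. by rewrite /lattice_scale mpolyCM; exact: scalerA. Qed.

Fact lattice_scale1 : left_id 1 lattice_scale.
Proof. by move=> v; rewrite /lattice_scale mpolyC1E; exact: scale1r. Qed.

Fact lattice_scaleDr : right_distributive lattice_scale +%R.
Proof. by move=> c u v; exact: scalerDr. Qed.

Fact lattice_scaleDl v : {morph lattice_scale^~ v : a b / a + b}.
Proof. by move=> a b; rewrite /lattice_scale monalgUD; exact: scalerDl. Qed.

HB.instance Definition _ := GRing.Zmodule_isLmodule.Build C VL
  lattice_scaleA lattice_scale1 lattice_scaleDr lattice_scaleDl.

End LatticeSpace.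

(* ------------------------------------------------------------------ *)
(* The vertex operator algebra V_L.                                    *)

Section LatticeVOA.
Variables (R : realType) (L : zmodType) (d : nat).
Variables (ip : L -> L -> int) (gam : 'I_d -> L) (eps : L -> L -> int).
Notation C := R[i].
Notation M1 := (heis_alg R d).
Notation VL := (lattice_space R L d).

Definition tensor (p : M1) (a : L) : VL := << p *g a >>.

Definition lexp (a : L) : VL := tensor 1 a.

Definition hvar (i : 'I_d) (n : nat) : M1 := << ucm (i, n) >>.

Definition hdiff (i : 'I_d) (n : nat) (p : M1) : M1 :=
  \sum_(m <- msupp p)
    << (m (i, n))%:R * p@_m *g divcm m (ucm (i, n)) >>.

(* a(n) acting on the factor M(1) of M(1) (x) e^b.  Recall that Negz n is
   -(n+1); [a(n), b(-n)] = n (a,b) gives the last case. *)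
Definition heis1 (a b : L) (n : int) (p : M1) : M1 :=
  match n with
  | Negz n => (\sum_(i < d) (coord gam a i)%:~R *: hvar i n) * p
  | Posz 0 => (ip a b)%:~R *: p
  | Posz n.+1 =>
      \sum_(i < d) (n.+1%:R * (ip a (gam i))%:~R) *: hdiff i n p
  end.

Definition heis (a : L) (n : int) (v : VL) : VL :=
  \sum_(b <- msupp v) tensor (heis1 a b n v@_b) b.

(* The coefficient of z^n in exp(\sum_(j > 0) f_j z^j) applied to p. *)
Definition exp_coef (f : nat -> M1 -> M1) (n : nat) (p : M1) : M1 :=
  \sum_(k < n.+1) (k`!%:R^-1 : C) *:
    \sum_(t : k.-tuple 'I_n | (\sum_(j <- t) j.+1 == n)%N)
      foldr (fun j : 'I_n => f j.+1) p t.

Definition schur (a : L) (n : nat) : M1 :=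
  exp_coef (fun j p => (j%:R^-1 : C) *: heis1 a 0 (- j%:Z) p) n 1.

(* The coefficient of z^(-n) in exp(- \sum_(j > 0) a(j)/j z^(-j)). *)
Definition exp_annih (a : L) (n : nat) : M1 -> M1 :=
  exp_coef (fun j p => - (j%:R^-1 : C) *: heis1 a 0 j p) n.

(* A field \sum_n F_n z^(-n-1) is represented by its modes n |-> F_n.
   All the sums below have finitely many nonzero terms on each vector. *)
Definition field_on : Type := int -> VL -> VL.

(* Y(e^a,z) = exp(\sum_(n>0) a(-n)/n z^n) exp(-\sum_(n>0) a(n)/n z^(-n)) e_a z^a,
   where e_a e^b = eps(a,b) e^(a+b) and z^a e^b = z^((a,b)) e^b. *)
Definition Y_exp (a : L) : field_on := fun k v =>
  \sum_(b <- msupp v)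
    tensor
      (\sum_(x \in [set x : nat * nat |
                     ip a b + x.1%:Z - x.2%:Z = - k - 1])
         ((eps a b)%:~R : C) *: (schur a x.1 * exp_annih a x.2 v@_b))
      (a + b).

Definition dfield (F : field_on) : field_on :=
  fun k v => ((- k)%:~R : C) *: F (k - 1) v.

Definition divided_dfield (r : nat) (F : field_on) : field_on :=
  fun k v => (r`!%:R^-1 : C) *: iter r dfield F k v.

(* The normally ordered product :F(z)G(z):. *)
Definition normal_prod (F G : field_on) : field_on := fun k v =>
  \sum_(j \in [set j : int | j < 0]) F j (G (k - j - 1) v) +
  \sum_(j \in [set j : int | 0 <= j]) G (k - j - 1) (F j v).

(* For u = a_1(-n_1)...a_k(-n_k) e^a,
   Y(u,z) = :\prod_i (1/(n_i-1)! (d/dz)^(n_i-1) a_i(z)) Y(e^a,z):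
   with a_i(z) = \sum_n a_i(n) z^(-n-1). *)
Definition Y_monom (m : heis_monom d) (a : L) : field_on :=
  foldr (fun x : 'I_d * nat =>
           normal_prod (divided_dfield x.2 (heis (gam x.1))))
        (Y_exp a)
        (flatten [seq nseq (m x) x | x <- finsupp m]).

Definition lattice_nprod (u : VL) (k : int) (v : VL) : VL :=
  \sum_(a <- msupp u) \sum_(m <- msupp u@_a) u@_a@_m *: Y_monom m a k v.

Definition gram : 'M[C]_d := \matrix_(i, j) (ip (gam i) (gam j))%:~R.

(* 1/2 \sum_i h_i(-1)^2 for an orthonormal basis (h_i) of C (x) L. *)
Definition lattice_omega : VL :=
  tensor ((2^-1 : C) *:
    \sum_(i < d) \sum_(j < d) invmx gram i j *: (hvar i 0 * hvar j 0)) 0.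

Definition monom_weight (m : heis_monom d) : nat :=
  (\sum_(x <- finsupp m) m x * x.2.+1)%N.

(* The monomial m (x) e^a has weight wt(m) + (a,a)/2. *)
Definition lattice_grade (n : int) : set VL :=
  [set v | forall a m, v@_a@_m != 0 ->
     2 * n = 2 * (monom_weight m)%:Z + ip a a].

Definition lattice_voa : voa_data C :=
  VoaData lattice_nprod (lexp 0) lattice_omega lattice_grade.

Definition is_natural_form (B : VL -> VL -> C) : Prop :=
  [/\ [/\ is_bilinear_form (V := lattice_voa) B,
          is_symmetric_form (V := lattice_voa) B,
          is_nondegenerate_form (V := lattice_voa) B
        & is_invariant_form (V := lattice_voa) B],
      forall a b : L, B (lexp a) (lexp b) = (a == - b)%:R
    & forall (a : L) (n : int) (u v : VL),
        B (heis a n u) v = - B u (heis a (- n) v)].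

Definition heis_subVOA : set VL := range (tensor^~ 0).

Definition VL_Z : set VL :=
  zspan [set v | exists (s : seq ('I_d * nat)) (a : L),
    sorted geq (map snd s) /\
    v = tensor (\prod_(x <- s) schur (gam x.1) x.2) a].

Definition M1_Z : set VL :=
  zspan [set v | exists s : seq (L * nat),
    v = tensor (\prod_(x <- s) schur x.1 x.2) 0].

End LatticeVOA.

(* Main.v *)
Require Import Defs.
From HB Require Import structures.
From mathcomp Require Import all_boot all_order all_algebra finmap.
From mathcomp Require Import boolp classical_sets functions cardinality fsbigop reals complex.
From mathcomp.multinomials Require Import monalg.
From mathcomp Require Import zify ring.

(** The proof replaces (V_L)_Z by something that can be tested coordinatewise.
Write s_(a,n) for the Schur polynomials and let S be the subring of M(1)
generated over the integers by the s_(gamma_i,n).  Since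
exp(a(z) + b(z)) = exp(a(z)) exp(b(z)) and the inverse of a power series with
constant term 1 and coefficients in S again has coefficients in S, all s_(a,n)
with a in L lie in S.  Hence (V_L)_Z consists of the families, indexed by L,
of elements of S ([gVL_ZP]), M(1)_Z is its part of lattice degree 0
([gM1_Z_supported]), and the four claims become statements about S.

Closure under the products.  On q (x) e^b, the field of p (x) e^a is
determined by a power series K in two independent variables, z for the creation
operators and y = z^(-1) for the annihilation operators, whose coefficients are
operators on M(1).  Taking the normally ordered product with a derivative of
gamma_i(z) adds to K its product on the left with the creation part and on the
right with the annihilation part of that field ([normal_prod_kfield]), and
every sum that occurs is finite because z and y have been separated.  Left and
right multiplications commute, so the generating series in w of the series K
attached to the s_(gamma,n) p solves a linear differential equation with
solution E(z+w) E(z)^(-1) K F(z+w) F(z)^(-1), where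
E(z) = exp(sum_n gamma(-n) z^n / n) and
F(z) = z^gamma(0) exp(- sum_n gamma(n) z^(-n) / n).  Its coefficients in w are
binomial coefficients times Schur polynomials on the left, and generalized
binomial coefficients times the coefficients of exp(- sum_n gamma(n) z^(-n) / n)
on the right.  The latter preserve S, because they act on exponentials by
exp(- sum_n a(n) z^(-n) / n) E_b(w) = (1 - w/z)^(a,b) E_b(w) ([annih_schur]).
By induction on the number of factors, every product of Schur polynomials has a
vertex operator preserving S ([kint_schur_ring]).

Generation.  A suitable mode of e^gamma maps p (x) e^(b-gamma) to
s_(gamma,N) p (x) e^b, up to sign, plus terms s_(gamma,N+l) p' (x) e^b with p'
of smaller weight than p; induct on the weight ([gen_schur_prod]).

Integrality of the form.  The adjoint of multiplication by s_(gamma,n) is the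
coefficient of z^(-n) in exp(- sum_n gamma(n) z^(-n) / n), which preserves S;
moving all Schur polynomials to the other side leaves values on exponentials
([schur_adjoint], [form_int]).

Integral bases.  Sending gamma_i(-n) to s_(gamma_i,n) extends to an automorphism
of the algebra M(1), whose inverse is given by Newton's identities.  So the
monomials in the s_(gamma_i,n), n > 0, form a basis of M(1) adapted to S and to
the weights ([graded_basis]).  The weight spaces are finite dimensional since
a positive definite lattice has finitely many vectors of bounded norm
([finite_norm]).

All identities between exponentials are derived from the recursion
(n+1) x_(n+1) = sum_(k+m=n) T_k x_m satisfied by the coefficients of the
solution of x' = T x; in characteristic zero it has at most one solution with
given x_0 ([csum_unique]). *)

Set Implicit Arguments.
Unset Strict Implicit.
Unset Printing Implicit Defensive.

Import Order.TTheory GRing.Theory Num.Theory.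

Local Open Scope classical_set_scope.
Local Open Scope ring_scope.

(** * Cauchy products of power series *)

(** The coefficient of the Cauchy product of two power series has this form. *)
Definition csum (V : nmodType) (n : nat) (F : nat -> nat -> V) : V :=
  \sum_(i < n.+1) F i (n - i)%N.

Section Csum.
Variable V : nmodType.
Implicit Types F G : nat -> nat -> V.

Lemma eq_csum n F G : (forall i j, (i + j)%N = n -> F i j = G i j) ->
  csum n F = csum n G.
Proof.
by move=> FG; apply: eq_bigr => i _; rewrite FG// subnKC// -ltnS.
Qed.

Lemma csum0 F : csum 0 F = F 0%N 0%N.
Proof. by rewrite /csum big_ord1. Qed.

Lemma csumD n F G : csum n (fun i j => F i j + G i j) = csum n F + csum n G.
Proof. exact: big_split. Qed.

Lemma csumMn n F m : csum n (fun i j => F i j *+ m) = csum n F *+ m.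
Proof. by rewrite /csum sumrMnl. Qed.

Lemma csum_eq0 n F : (forall i j, (i + j)%N = n -> F i j = 0) -> csum n F = 0.
Proof. by move=> F0; apply: big1 => i _; rewrite F0// subnKC// -ltnS. Qed.

Lemma csumC n F : csum n F = csum n (fun i j => F j i).
Proof.
rewrite /csum (reindex_inj rev_ord_inj); apply: eq_bigr => i _ /=.
by rewrite subSS subKn// -ltnS.
Qed.

Lemma csumSl n F : csum n.+1 F = F 0%N n.+1 + csum n (fun i j => F i.+1 j).
Proof. by rewrite /csum big_ord_recl subn0. Qed.

Lemma csumSr n F : csum n.+1 F = csum n (fun i j => F i j.+1) + F n.+1 0%N.
Proof. by rewrite csumC csumSl addrC (csumC n). Qed.

Lemma csumA n (F : nat -> nat -> nat -> V) :
  csum n (fun i k => csum i (fun a b => F a b k)) =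
  csum n (fun a j => csum j (fun b k => F a b k)).
Proof.
elim: n F => [|n IHn] F; first by rewrite !csum0.
rewrite csumSl [RHS]csumSl csumSl csum0 -addrA; congr (_ + _).
rewrite -IHn -csumD; apply: eq_csum => i j _.
by rewrite csumSl.
Qed.

Lemma csumCA n (F : nat -> nat -> nat -> V) :
  csum n (fun a j => csum j (fun b k => F a b k)) =
  csum n (fun b j => csum j (fun a k => F a b k)).
Proof.
rewrite -!csumA; apply: eq_csum => i j _; exact: csumC.
Qed.

Lemma csumAC n (F : nat -> nat -> nat -> V) :
  csum n (fun i k => csum i (fun a b => F a b k)) =
  csum n (fun j b => csum j (fun a k => F a b k)).
Proof.
by rewrite !csumA; apply: eq_csum => i j _; rewrite csumC.
Qed.

Lemma csum_pick n k F : (forall i j, (i + j)%N = n -> i != k -> F i j = 0) ->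
  csum n F = if (k <= n)%N then F k (n - k)%N else 0.
Proof.
move=> F0; case: leqP => kn.
  rewrite /csum (bigD1 (Ordinal (kn : (k < n.+1)%N)))//= big1 ?addr0// => i ik.
  by rewrite F0// subnKC// -ltnS.
rewrite csum_eq0// => i j ij; apply: F0 => //; lia.
Qed.

Lemma csum_shift n m F G :
  (forall i j, (i + j)%N = (n + m)%N -> (n < i)%N -> F i j = 0) ->
  (forall i j, (i + j)%N = n -> F i (j + m)%N = G i j) ->
  csum (n + m) F = csum n G.
Proof.
move=> F0 FG; rewrite /csum -(big_mkord xpredT (fun i => F i (n + m - i)%N)).
rewrite (@big_cat_nat _ _ _ n.+1)//=; last by lia.
rewrite [X in _ + X]big_nat_cond [X in _ + X]big1 ?addr0; last first.
  by move=> i /andP[/andP[? ?] _]; apply: F0; lia.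
rewrite big_mkord; apply: eq_bigr => i _; rewrite -FG.
  by congr F; have := ltn_ord i; lia.
by have := ltn_ord i; lia.
Qed.

Lemma csumMS n F : csum n.+1 F *+ n.+1 =
  csum n (fun i j => F i.+1 j *+ i.+1) + csum n (fun i j => F i j.+1 *+ j.+1).
Proof.
have -> : csum n.+1 F *+ n.+1 = csum n.+1 (fun i j => F i j *+ i) +
                               csum n.+1 (fun i j => F i j *+ j).
  by rewrite -csumD -csumMn; apply: eq_csum => i j <-; rewrite mulrnDr.
by rewrite csumSl mulr0n add0r csumSr mulr0n addr0.
Qed.

(** The derivative of a product of two power series, when both factors satisfy a
differential equation whose coefficients are indexed by [k]. *)
Lemma csum_rec n F (F1 F2 : nat -> nat -> nat -> V) :
  (forall i j, F i.+1 j *+ i.+1 = csum i (fun k i' => F1 k i' j)) ->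
  (forall i j, F i j.+1 *+ j.+1 = csum j (fun k j' => F2 k i j')) ->
  csum n.+1 F *+ n.+1 =
  csum n (fun k m => csum m (fun i j => F1 k i j + F2 k i j)).
Proof.
move=> H1 H2.
rewrite csumMS.
under eq_csum do rewrite H1.
under [X in _ + X]eq_csum do rewrite H2.
rewrite csumA [X in _ + X]csumCA -csumD.
by apply: eq_csum => i j _; rewrite csumD.
Qed.

End Csum.

Lemma morphD_sum (V W : zmodType) (f : V -> W) (I : Type) (r : seq I)
    (P : pred I) (F : I -> V) : {morph f : x y / x + y} ->
  f (\sum_(i <- r | P i) F i) = \sum_(i <- r | P i) f (F i).
Proof.
move=> fD; have f0 : f 0 = 0 by apply: (addrI (f 0)); rewrite -fD !addr0.
exact: (big_morph f fD f0).
Qed.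

Lemma morphD0 (V W : zmodType) (f : V -> W) : {morph f : x y / x + y} -> f 0 = 0.
Proof. by move=> fD; apply: (addrI (f 0)); rewrite -fD !addr0. Qed.

Lemma morphDN (V W : zmodType) (f : V -> W) x : {morph f : x y / x + y} ->
  f (- x) = - f x.
Proof. by move=> fD; apply: (addrI (f x)); rewrite -fD !subrr morphD0. Qed.

Lemma morphDMn (V W : zmodType) (f : V -> W) x n : {morph f : x y / x + y} ->
  f (x *+ n) = f x *+ n.
Proof.
move=> fD; elim: n => [|n IHn]; first by rewrite !mulr0n morphD0.
by rewrite !mulrS fD IHn.
Qed.

Lemma morphD_csum (V W : zmodType) (f : V -> W) n (F : nat -> nat -> V) :
  {morph f : x y / x + y} -> f (csum n F) = csum n (fun i j => f (F i j)).
Proof. by move=> fD; rewrite /csum (morphD_sum _ _ _ fD). Qed.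

Lemma mulrnI_lmod (C : numFieldType) (V : lmodType C) n (x y : V) :
  x *+ n.+1 = y *+ n.+1 -> x = y.
Proof.
rewrite -!scaler_nat => /(congr1 (fun z => n.+1%:R^-1 *: z)).
by rewrite !scalerA mulVf ?scale1r// pnatr_eq0.
Qed.

Lemma mulrnI_num (C : numFieldType) n (x y : C) :
  x *+ n.+1 = y *+ n.+1 -> x = y.
Proof. exact: (@mulrnI_lmod C C^o). Qed.

(** A linear differential equation x' = T x has at most one power series
solution with given constant term, as n+1 can be cancelled. *)
Lemma csum_unique (C : numFieldType) (V : lmodType C) (T : nat -> V -> V)
    (X Y : nat -> V) :
  X 0%N = Y 0%N ->
  (forall n, X n.+1 *+ n.+1 = csum n (fun k m => T k (X m))) ->
  (forall n, Y n.+1 *+ n.+1 = csum n (fun k m => T k (Y m))) ->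
  forall n, X n = Y n.
Proof.
move=> XY0 HX HY n; elim/ltn_ind: n => -[//|n] IHn.
apply: (@mulrnI_lmod C _ n); rewrite HX HY; apply: eq_csum => i j ij.
by rewrite IHn//; lia.
Qed.

(** * Generalized binomial coefficients *)

Section Gbin.
Variable C : numFieldType.

(** The coefficient of t^n in (1 + t)^x. *)
Definition gbin (x : C) (n : nat) : C := (\prod_(i < n) (x - i%:R)) / n`!%:R.

Lemma gbin0 x : gbin x 0 = 1.
Proof. by rewrite /gbin big_ord0 fact0 divr1. Qed.

Lemma gbinS x n : gbin x n.+1 *+ n.+1 = (x - n%:R) * gbin x n.
Proof.
rewrite /gbin big_ord_recr /= factS natrM -[LHS]mulr_natr.
have n0 : n.+1%:R != 0 :> C by rewrite pnatr_eq0.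
have f0 : n`!%:R != 0 :> C by rewrite pnatr_eq0 -lt0n fact_gt0.
move: n0 f0 (\prod_(i < n) _) => + + p; move: n.+1%:R n`!%:R => a b a0 b0.
by field; rewrite a0 b0.
Qed.

Lemma gbin_succ x n : gbin (x + 1) n.+1 *+ n.+1 = (x + 1) * gbin x n.
Proof.
rewrite /gbin big_ord_recl /= subr0 factS natrM -[LHS]mulr_natr.
have n0 : n.+1%:R != 0 :> C by rewrite pnatr_eq0.
have f0 : n`!%:R != 0 :> C by rewrite pnatr_eq0 -lt0n fact_gt0.
have -> : \prod_(i < n) (x + 1 - (bump 0 i)%:R) = \prod_(i < n) (x - i%:R) :> C.
  by apply: eq_bigr => i _; rewrite /bump /= natrD; ring.
move: n0 f0 (\prod_(i < n) _) => + + p; move: n.+1%:R n`!%:R => a b a0 b0.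
by field; rewrite a0 b0.
Qed.

(** Vandermonde's identity: both sides satisfy the recursion of [gbinS]. *)
Lemma gbinD x y n :
  csum n (fun k j => gbin x k * gbin y j) = gbin (x + y) n.
Proof.
elim: n => [|n IHn]; first by rewrite csum0 !gbin0 mulr1.
apply: (@mulrnI_num C n); rewrite gbinS -IHn.
rewrite csumMS -csumD /csum mulr_sumr; apply: eq_bigr => i _ /=.
rewrite -[X in X + _ = _]mulrnAl -[X in _ + X = _]mulrnAr !gbinS.
have -> : n%:R = i%:R + (n - i)%:R :> C by rewrite -natrD subnKC// -ltnS.
ring.
Qed.

Lemma gbin_nat (m n : nat) : gbin m%:R n = ('C(m, n))%:R.
Proof.
elim: n => [|n IHn]; first by rewrite gbin0 bin0.
apply: (@mulrnI_num C n); rewrite gbinS IHn -[RHS]mulrnA.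
rewrite [('C(_, _) * _)%N]mulnC mul_bin_left natrM.
have [nm|mn] := leqP n m; first by rewrite natrB.
by rewrite bin_small// !mulr0.
Qed.

Lemma gbinN x n : gbin (- x) n = (-1) ^+ n * gbin (x + n%:R - 1) n.
Proof.
rewrite /gbin mulrA; congr (_ / _).
rewrite [in RHS](reindex_inj rev_ord_inj) /= -[X in _ ^+ X]card_ord.
rewrite -prodrN; apply: eq_bigr => i _; rewrite natrB//.
rewrite -(natr1 i); ring.
Qed.

Lemma gbin_int (c : int) n : exists z : int, gbin c%:~R n = z%:~R.
Proof.
case: c => m; first by exists ('C(m, n)); rewrite -!pmulrn; exact: gbin_nat.
exists ((-1) ^+ n * 'C(m + n, n)%:Z).
rewrite NegzE mulrNz -pmulrn gbinN intrM rmorphXn /= rmorphN1; congr (_ * _).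
rewrite -[in RHS]pmulrn -gbin_nat; congr gbin.
by rewrite natrD -(natr1 m); ring.
Qed.

End Gbin.

(** * The polynomial algebra M(1) *)

Section Malg.
Variables (C : zmodType) (K : monomType).

Lemma malg_ind (P : {malg C[K]} -> Prop) :
  (forall c m, P << c *g m >>) -> (forall p q, P p -> P q -> P (p + q)) ->
  forall p, P p.
Proof.
move=> PU PD p; have P0 : P 0 by rewrite -(monalgU0 (@mone K)); exact: PU.
rewrite (monalgE p).
by elim/big_ind: _ => // m _; exact: PU.
Qed.
End Malg.

Lemma morphD_mulr (S : pzRingType) (V : nmodType) (f : S -> V) (u : S) :
  {morph f : p q / p + q} -> {morph (fun p => f (u * p)) : p q / p + q}.
Proof. by move=> fD p q; rewrite mulrDr fD. Qed.

Lemma morphD_mull (S : pzRingType) (V : nmodType) (f : S -> V) (u : S) :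
  {morph f : p q / p + q} -> {morph (fun p => f (p * u)) : p q / p + q}.
Proof. by move=> fD p q; rewrite mulrDl fD. Qed.

Lemma leibnizDl (S : pzRingType) (f : S -> S) (p p' q : S) :
  {morph f : x y / x + y} ->
  f (p * q) = f p * q + p * f q -> f (p' * q) = f p' * q + p' * f q ->
  f ((p + p') * q) = f (p + p') * q + (p + p') * f q.
Proof. by move=> fD Hp Hp'; rewrite mulrDl !fD Hp Hp' !mulrDl addrACA. Qed.

Lemma leibnizDr (S : pzRingType) (f : S -> S) (p q q' : S) :
  {morph f : x y / x + y} ->
  f (p * q) = f p * q + p * f q -> f (p * q') = f p * q' + p * f q' ->
  f (p * (q + q')) = f p * (q + q') + p * f (q + q').
Proof. by move=> fD Hq Hq'; rewrite mulrDr !fD Hq Hq' !mulrDr addrACA. Qed.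

Section Monomials.
Variables (C : comNzRingType) (I : choiceType).
Local Notation M := {malg C[{cmonom I}]}.

Lemma malgUM (c c' : C) (m m' : {cmonom I}) :
  << c *g m >> * << c' *g m' >> = << c * c' *g mmul m m' >> :> M.
Proof. by rewrite malgM_def fgmulUU. Qed.

(** The variables of a monomial, listed with multiplicity. *)
Definition mlist (m : {cmonom I}) : seq I :=
  flatten [seq nseq (m x) x | x <- finsupp m].

Lemma count_mlist (m : {cmonom I}) y : count_mem y (mlist m) = m y.
Proof.
rewrite /mlist count_flatten -!map_comp sumnE big_map.
rewrite (eq_bigr (fun x => (m x * (x == y))%N)); last first.
  by move=> x _ /=; rewrite count_nseq mulnC.
have [ym|ym] := boolP (y \in finsupp m).
  rewrite (big_rem y)//= eqxx muln1 big_seq big1 ?addn0// => x.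
  rewrite mem_rem_uniq ?fset_uniq// inE => /andP[/negPf xy _].
  by rewrite xy muln0.
rewrite big_seq big1; first by apply/esym/eqP; rewrite cmE_eq0.
move=> x xm; case: eqP => [xy|]; last by rewrite muln0.
by rewrite -xy xm in ym.
Qed.

Lemma mlistE (m : {cmonom I}) :
  << m >> = \prod_(x <- mlist m) << ucm x >> :> M.
Proof.
have H (s : seq I) : exists2 m', \prod_(x <- s) << ucm x >> = << m' >> :> M
    & forall y, m' y = count_mem y s.
  elim: s => [|x s [m' IHs Em']].
    by exists (@mone {cmonom I}); [rewrite big_nil|move=> y; rewrite cm1].
  exists (mmul (ucm x) m'); first by rewrite big_cons IHs malgUM; congr << _ *g _ >>; exact: mulr1.
  by move=> y; rewrite cmM cmU Em' /=.
have [m' -> Em'] := H (mlist m); congr << _ >>.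
by apply/eqP/cmP => y; rewrite Em' count_mlist.
Qed.

Lemma mlist_mmul (m m' : {cmonom I}) :
  perm_eq (mlist (mmul m m')) (mlist m ++ mlist m').
Proof.
by apply/allP => y _ /=; rewrite count_cat !count_mlist cmM.
Qed.

Lemma mlistU (x : I) : perm_eq (mlist (ucm x)) [:: x].
Proof. by apply/allP => y _ /=; rewrite count_mlist cmU addn0. Qed.

Lemma mlist1 : mlist (@mone {cmonom I}) = [::].
Proof. by rewrite /mlist mdom1. Qed.

Lemma mpoly_ind (P : M -> Prop) :
  (forall c, P c%:MP) -> (forall x, P << ucm x >>) ->
  (forall p q, P p -> P q -> P (p + q)) ->
  (forall p q, P p -> P q -> P (p * q)) -> forall p, P p.
Proof.
move=> PC PU PD PM; apply: malg_ind => // c m.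
have -> : << c *g m >> = c%:MP * << m >> :> M.
  by rewrite malgUM mul1m; congr << _ *g _ >>; rewrite mulr1.
apply: (PM _ _ (PC c)).
rewrite mlistE; apply: big_ind => [|p q|x _]; [exact: (PC 1)|exact: PM|exact: PU].
Qed.

Lemma malgC_alg (c : C) : c%:MP = c%:A :> M.
Proof. by rewrite -mul_malgC mulr1. Qed.

Definition mdiff (x : I) (p : M) : M :=
  \sum_(m <- msupp p) << (m x)%:R * p@_m *g divcm m (ucm x) >>.

Lemma mdiffEw x (p : M) (D : {fset {cmonom I}}) : (msupp p `<=` D)%fset ->
  mdiff x p = \sum_(m <- D) << (m x)%:R * p@_m *g divcm m (ucm x) >>.
Proof.
move=> pD; rewrite /mdiff (big_fset_incl _ pD)// => m _ mp.
by rewrite mcoeff_outdom// mulr0 monalgU0.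
Qed.

Lemma mdiffD x : {morph mdiff x : p q / p + q}.
Proof.
move=> p q; pose D := (msupp p `|` msupp q `|` msupp (p + q))%fset.
rewrite !(@mdiffEw _ _ D); try by
  apply/fsubsetP => m; rewrite !in_fsetU => ->; rewrite ?orbT.
rewrite -big_split; apply: eq_bigr => m _ /=.
by rewrite mcoeffD mulrDr monalgUD.
Qed.

Lemma mdiffZ x c (p : M) : mdiff x (c *: p) = c *: mdiff x p.
Proof.
pose D := (msupp p `|` msupp (c *: p))%fset.
rewrite !(@mdiffEw _ _ D); try by
  apply/fsubsetP => m; rewrite !in_fsetU => ->; rewrite ?orbT.
rewrite scaler_sumr; apply: eq_bigr => m _ /=.
rewrite mcoeffZ; apply/malgP => k.
rewrite mcoeffZ [LHS]mcoeffU [X in _ = _ * X]mcoeffU.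
by rewrite mulrnAr (mulrCA c).
Qed.

Lemma mdiffU x (c : C) (m : {cmonom I}) :
  mdiff x << c *g m >> = << (m x)%:R * c *g divcm m (ucm x) >> :> M.
Proof.
rewrite (@mdiffEw _ _ [fset m]%fset) ?msuppU_le// big_seq_fset1.
by rewrite mcoeffUU.
Qed.

Lemma div_mmul x (k k' : {cmonom I}) : (0 < k x)%N ->
  divcm (mmul k k') (ucm x) = mmul (divcm k (ucm x)) k'.
Proof.
move=> k0; apply/eqP/cmP => y; rewrite divcmE !cmM divcmE ucmE.
by case: eqP => [<-|] /=; lia.
Qed.

Lemma mdiffM x (p q : M) : mdiff x (p * q) = mdiff x p * q + p * mdiff x q.
Proof.
suff H (c c' : C) (m m' : {cmonom I}) : mdiff x (<< c *g m >> * << c' *g m' >>) =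
    mdiff x << c *g m >> * << c' *g m' >> + << c *g m >> * mdiff x << c' *g m' >>.
  elim/malg_ind: p => [c m|p p' IH IH'].
    elim/malg_ind: q => [c' m'|q q' IH IH']; first exact: H.
    exact: leibnizDr (mdiffD x) IH IH'.
  exact: leibnizDl (mdiffD x) IH IH'.
have E1 : mdiff x << c *g m >> * << c' *g m' >> =
    << (m x)%:R * c * c' *g mmul (divcm m (ucm x)) m' >> :> M.
  by rewrite mdiffU; exact: malgUM.
have E2 : << c *g m >> * mdiff x << c' *g m' >> =
    << c * ((m' x)%:R * c') *g mmul m (divcm m' (ucm x)) >> :> M.
  by rewrite mdiffU; exact: malgUM.
have mk0 (a b : C) (k k' : {cmonom I}) : a = 0 -> b = 0 ->
    << a *g k >> = << b *g k' >> :> M.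
  by move=> -> ->; rewrite (monalgU0 k) (monalgU0 k').
have E3 : << (m x)%:R * (c * c') *g divcm (mmul m m') (ucm x) >> =
    << (m x)%:R * c * c' *g mmul (divcm m (ucm x)) m' >> :> M.
  have [m0|m0] := posnP (m x); first by apply: mk0; rewrite m0 !mul0r.
  by rewrite (div_mmul _ m0); apply: (congr1 (mkmalgU _)); rewrite mulrA.
have E4 : << (m' x)%:R * (c * c') *g divcm (mmul m m') (ucm x) >> =
    << c * ((m' x)%:R * c') *g mmul m (divcm m' (ucm x)) >> :> M.
  have [m0|m0] := posnP (m' x); first by apply: mk0; rewrite m0 mul0r ?mulr0.
  by rewrite (mulmC m) (div_mmul _ m0) (mulmC _ m); apply: (congr1 (mkmalgU _)); rewrite mulrCA.
rewrite E1 E2 -E3 -E4 malgUM mdiffU cmM natrD [X in << X *g _ >>]mulrDl.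
exact: monalgUD.
Qed.

Lemma mdiff_var x y : mdiff x << ucm y >> = (x == y)%:R :> M.
Proof.
rewrite mdiffU cmU mulr1 eq_sym.
have [->|_] := eqVneq x y; last exact: monalgU0.
have -> : divcm (ucm y) (ucm y) = mone.
  by apply/eqP/cmP => z; rewrite divcmE subnn cm1.
exact: mpolyC1E.
Qed.

End Monomials.

Section LinearExtension.
Variables (C : comNzRingType) (I : choiceType).
Local Notation M := {malg C[{cmonom I}]}.

Definition mlin (V : lmodType C) (F : {cmonom I} -> V) (p : M) : V :=
  \sum_(m <- msupp p) p@_m *: F m.

Section MlinTheory.
Variables (V : lmodType C) (F : {cmonom I} -> V).

Lemma mlinEw (p : M) (D : {fset {cmonom I}}) : (msupp p `<=` D)%fset ->
  mlin F p = \sum_(m <- D) p@_m *: F m.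
Proof.
move=> pD; rewrite /mlin (big_fset_incl _ pD)// => m _ mp.
by rewrite mcoeff_outdom// scale0r.
Qed.

Lemma mlinD : {morph mlin F : p q / p + q}.
Proof.
move=> p q; pose D := (msupp p `|` msupp q `|` msupp (p + q))%fset.
rewrite !(@mlinEw _ D); try by
  apply/fsubsetP => m; rewrite !in_fsetU => ->; rewrite ?orbT.
rewrite -big_split; apply: eq_bigr => m _ /=.
by rewrite mcoeffD scalerDl.
Qed.

Lemma mlinU c m : mlin F << c *g m >> = c *: F m.
Proof.
by rewrite (@mlinEw _ [fset m]%fset) ?msuppU_le// big_seq_fset1 mcoeffUU.
Qed.

Lemma mlinZ c p : mlin F (c *: p) = c *: mlin F p.
Proof.
pose D := (msupp p `|` msupp (c *: p))%fset.
rewrite !(@mlinEw _ D); try by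
  apply/fsubsetP => m; rewrite !in_fsetU => ->; rewrite ?orbT.
by rewrite scaler_sumr; apply: eq_bigr => m _; rewrite mcoeffZ scalerA.
Qed.

End MlinTheory.

Lemma mlin_varM (V : lmodType C) (F : {cmonom I} -> V) x (p : M) :
  mlin F (<< ucm x >> * p) = mlin (fun m => F (mmul (ucm x) m)) p.
Proof.
elim/malg_ind: p => [c m|p q IHp IHq].
  by rewrite malgUM !mlinU mul1r.
apply: etrans (morphD_mulr _ (@mlinD V F) p q) _.
exact: etrans (congr2 +%R IHp IHq) (esym (mlinD _ p q)).
Qed.

Definition msubst (A : comAlgType C) (S : I -> A) : M -> A :=
  mlin (fun m => \prod_(x <- mlist m) S x).

Section MsubstTheory.
Variables (A : comAlgType C) (S : I -> A).
Local Notation phi := (msubst S).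

Lemma msubstD : {morph phi : p q / p + q}. Proof. exact: mlinD. Qed.

Lemma msubstZ c p : phi (c *: p) = c *: phi p. Proof. exact: mlinZ. Qed.

Lemma msubstU c m : phi << c *g m >> = c *: \prod_(x <- mlist m) S x.
Proof. exact: mlinU. Qed.

Lemma msubst_monom m : phi << m >> = \prod_(x <- mlist m) S x.
Proof. by rewrite msubstU scale1r. Qed.

Lemma msubst_var x : phi << ucm x >> = S x.
Proof. by rewrite msubst_monom (perm_big _ (mlistU x)) big_seq1. Qed.

Lemma msubst1 : phi 1 = 1.
Proof. by rewrite (msubst_monom mone) mlist1 big_nil. Qed.

Lemma msubstM : {morph phi : p q / p * q}.
Proof.
have H (c c' : C) (m m' : {cmonom I}) :
    phi (<< c *g m >> * << c' *g m' >>) = phi << c *g m >> * phi << c' *g m' >>.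
  apply: etrans (congr1 phi (malgUM c c' m m')) _.
  apply: etrans (msubstU _ _) _; apply: esym.
  apply: etrans (congr2 *%R (msubstU c m) (msubstU c' m')) _.
  rewrite [in RHS](perm_big _ (mlist_mmul m m')) big_cat /=.
  by rewrite -scalerAl -scalerAr scalerA.
move=> p q; elim/malg_ind: p => [c m|p p' IH IH'].
  elim/malg_ind: q => [c' m'|q q' IH IH']; first exact: H.
  apply: etrans (morphD_mulr _ msubstD q q') _.
  apply: etrans (congr2 +%R IH IH') _; rewrite -mulrDr.
  exact: congr1 (esym (msubstD q q')).
apply: etrans (morphD_mull _ msubstD p p') _.
apply: etrans (congr2 +%R IH IH') _; rewrite -mulrDl.
exact: (congr1 (fun x => x * _)) (esym (msubstD p p')).
Qed.

End MsubstTheory.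

Section Weight.
Variable wt : I -> nat.

Definition wdeg (m : {cmonom I}) : nat := (\sum_(x <- finsupp m) m x * wt x)%N.

Lemma wdegE m : wdeg m = (\sum_(x <- mlist m) wt x)%N.
Proof.
rewrite /mlist big_flatten big_map; apply: eq_bigr => x _.
by rewrite big_nseq iter_addn_0 mulnC.
Qed.

Lemma wdegM m m' : wdeg (mmul m m') = (wdeg m + wdeg m')%N.
Proof. by rewrite !wdegE (perm_big _ (mlist_mmul m m')) big_cat. Qed.

Lemma wdeg1 : wdeg mone = 0%N.
Proof. by rewrite wdegE mlist1 big_nil. Qed.

Lemma wdegU x : wdeg (ucm x) = wt x.
Proof. by rewrite wdegE (perm_big _ (mlistU x)) big_seq1. Qed.

Definition mhomog (n : nat) (p : M) := forall m, p@_m != 0 -> wdeg m = n.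

Lemma mhomog0 n : mhomog n 0.
Proof. by move=> m; rewrite mcoeff0 eqxx. Qed.

Lemma mhomogD n p q : mhomog n p -> mhomog n q -> mhomog n (p + q).
Proof.
move=> hp hq m; rewrite mcoeffD; have [p0|/hp//] := eqVneq p@_m 0.
by rewrite p0 add0r; exact: hq.
Qed.

Lemma mhomogZ n c p : mhomog n p -> mhomog n (c *: p).
Proof.
move=> hp m; rewrite mcoeffZ; have [->|/hp//] := eqVneq p@_m 0.
by rewrite mulr0 eqxx.
Qed.

Lemma mhomogU n c m : wdeg m = n -> mhomog n << c *g m >>.
Proof.
move=> mn m'; rewrite mcoeffU; have [<-//|_] := eqVneq m m'.
by rewrite mulr0n eqxx.
Qed.

Lemma mhomog_sum n (T : Type) (r : seq T) (P : pred T) (F : T -> M) :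
  (forall i, P i -> mhomog n (F i)) -> mhomog n (\sum_(i <- r | P i) F i).
Proof. by move=> hF; apply: big_ind => //; [exact: mhomog0|exact: mhomogD]. Qed.

Lemma mhomogM n n' p q : mhomog n p -> mhomog n' q -> mhomog (n + n') (p * q).
Proof.
move=> hp hq; rewrite malgME big_seq; apply: mhomog_sum => m.
rewrite -mcoeff_neq0 => /hp pm; rewrite big_seq; apply: mhomog_sum => m'.
by rewrite -mcoeff_neq0 => /hq qm; apply: mhomogU; rewrite wdegM pm qm.
Qed.

Lemma mhomog1 : mhomog 0 1.
Proof. by apply: mhomogU; exact: wdeg1. Qed.

End Weight.

End LinearExtension.

(** * The lattice vertex algebra over a field of characteristic zero *)

(** What the proof uses of M(1): it is a commutative algebra generated by
variables, with derivations dual to the variables.  Working over this interface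
keeps the concrete polynomials out of the computations; the prefix [g] marks
the notions of lattice vertex algebras built over it, which for the model
[mfock] are those of the complex case. *)
Record fock (C : numFieldType) (d : nat) := Fock {
  fock_alg :> comAlgType C;
  fock_cst : C -> fock_alg;
  ghvar : 'I_d -> nat -> fock_alg;
  ghdiff : 'I_d -> nat -> fock_alg -> fock_alg;
  fock_cstE : forall c, fock_cst c = c%:A;
  ghdiffD : forall i n, {morph ghdiff i n : p q / p + q};
  ghdiffZ : forall i n c p, ghdiff i n (c *: p) = c *: ghdiff i n p;
  ghdiffM : forall i n p q,
    ghdiff i n (p * q) = ghdiff i n p * q + p * ghdiff i n q;
  ghdiff_hvar : forall i n j m,
    ghdiff i n (ghvar j m) = ((i, n) == (j, m))%:R;
  fock_ind : forall P : fock_alg -> Prop,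
    (forall c, P (fock_cst c)) -> (forall i n, P (ghvar i n)) ->
    (forall p q, P p -> P q -> P (p + q)) ->
    (forall p q, P p -> P q -> P (p * q)) -> forall p, P p }.

Arguments ghvar {C d} f i n : rename.

Section FockDefinitions.
Variables (C : numFieldType) (L : zmodType) (d : nat).
Variable M1 : fock C d.
Variables (ip : L -> L -> int) (gam : 'I_d -> L) (eps : L -> L -> int).
Notation VL := {malg M1[L]}.

Definition gheis1 (a b : L) (n : int) (p : M1) : M1 :=
  match n with
  | Negz n => (\sum_(i < d) (Defs.coord gam a i)%:~R *: ghvar M1 i n) * p
  | Posz 0 => (ip a b)%:~R *: p
  | Posz n.+1 =>
      \sum_(i < d) (n.+1%:R * (ip a (gam i))%:~R) *: ghdiff i n p
  end.

Definition gexp_coef (f : nat -> M1 -> M1) (n : nat) (p : M1) : M1 :=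
  \sum_(k < n.+1) (k`!%:R^-1 : C) *:
    \sum_(t : k.-tuple 'I_n | (\sum_(j <- t) j.+1 == n)%N)
      foldr (fun j : 'I_n => f j.+1) p t.

Definition gschur (a : L) (n : nat) : M1 :=
  gexp_coef (fun j p => (j%:R^-1 : C) *: gheis1 a 0 (- j%:Z) p) n 1.

Definition gexp_annih (a : L) (n : nat) : M1 -> M1 :=
  gexp_coef (fun j p => - (j%:R^-1 : C) *: gheis1 a 0 j p) n.

Definition gtensor (p : M1) (a : L) : VL := << p *g a >>.

(** Scalars act through constants of the algebra. *)
Definition gscale (c : C) (v : VL) : VL := (fock_cst M1 c) *: v.

Definition gheis (a : L) (n : int) (v : VL) : VL :=
  \sum_(b <- msupp v) gtensor (gheis1 a b n v@_b) b.

Definition gY_exp (a : L) (k : int) (v : VL) : VL :=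
  \sum_(b <- msupp v)
    gtensor
      (\sum_(x \in [set x : nat * nat |
                     ip a b + x.1%:Z - x.2%:Z = - k - 1])
         ((eps a b)%:~R : C) *: (gschur a x.1 * gexp_annih a x.2 v@_b))
      (a + b).

Definition gdfield (F : int -> VL -> VL) (k : int) (v : VL) : VL :=
  gscale (- k)%:~R (F (k - 1) v).

Definition gdivided_dfield (r : nat) (F : int -> VL -> VL) (k : int) (v : VL) :
    VL := gscale r`!%:R^-1 (iter r gdfield F k v).

Definition gnormal_prod (F G : int -> VL -> VL) (k : int) (v : VL) : VL :=
  \sum_(j \in [set j : int | j < 0]) F j (G (k - j - 1) v) +
  \sum_(j \in [set j : int | 0 <= j]) G (k - j - 1) (F j v).

Definition gY_word (a : L) (s : seq ('I_d * nat)) : int -> VL -> VL :=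
  foldr (fun x : 'I_d * nat =>
           gnormal_prod (gdivided_dfield x.2 (gheis (gam x.1))))
        (gY_exp a) s.

Definition gVL_Z : set VL :=
  zspan [set v | exists (s : seq ('I_d * nat)) (a : L),
    sorted geq (map snd s) /\
    v = gtensor (\prod_(x <- s) gschur (gam x.1) x.2) a].

Definition gM1_Z : set VL :=
  zspan [set v | exists s : seq (L * nat),
    v = gtensor (\prod_(x <- s) gschur x.1 x.2) 0].

End FockDefinitions.

Definition mfock (C : numFieldType) (d : nat) : fock C d :=
  @Fock C d {malg C[{cmonom ('I_d * nat)%type}]} malgC
  (fun i n => << ucm (i, n) >>) (fun i n => mdiff (i, n))
  (@malgC_alg _ _) (fun i n => @mdiffD _ _ (i, n))
  (fun i n => @mdiffZ _ _ (i, n)) (fun i n => @mdiffM _ _ (i, n))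
  (fun i n j m => @mdiff_var _ _ (i, n) (j, m))
  (fun P PC PV => mpoly_ind PC (fun x : 'I_d * nat =>
     let: (i, n) as y := x return P << ucm y >> in PV i n)).

Section Bridge.
Variables (R : realType) (L : zmodType) (d : nat).
Variables (ip : L -> L -> int) (gam : 'I_d -> L) (eps : L -> L -> int).
Local Notation cfock := (mfock R[i] d).

Lemma gheisE : @heis R L d ip gam = @gheis R[i] L d cfock ip gam.
Proof. exact: erefl. Qed.

Lemma gY_expE : @Y_exp R L d ip gam eps = @gY_exp R[i] L d cfock ip gam eps.
Proof. exact: erefl. Qed.

Lemma gnormal_prodE : @normal_prod R L d = @gnormal_prod R[i] L d cfock.
Proof. exact: erefl. Qed.

Lemma gdivided_dfieldE : @divided_dfield R L d = @gdivided_dfield R[i] L d cfock.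
Proof. exact: erefl. Qed.

Lemma gY_monomE m a :
  Y_monom ip gam eps m a = @gY_word R[i] L d cfock ip gam eps a (mlist m).
Proof.
rewrite /Y_monom /gY_word.
by rewrite gY_expE gnormal_prodE gdivided_dfieldE gheisE.
Qed.

Lemma gVL_ZE : @VL_Z R L d ip gam = @gVL_Z R[i] L d cfock ip gam.
Proof. exact: erefl. Qed.

Lemma gM1_ZE : @M1_Z R L d ip gam = @gM1_Z R[i] L d cfock ip gam.
Proof. exact: erefl. Qed.

End Bridge.

(** * Exponentials of commuting operators *)

Section ExpCoef.
Variables (C : numFieldType) (d : nat) (M1 : fock C d).
Variable f : nat -> M1 -> M1.
Hypothesis fD : forall j, {morph f j : p q / p + q}.

Let fh (j : nat) (p : M1) : M1 := if j is 0 then 0 else f j p.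
Let fhD j : {morph fh j : p q / p + q}.
Proof. by case: j => [|j] p q; rewrite /fh /= ?addr0 ?fD. Qed.

(** The coefficient of z^n in the k-th power of sum_(j > 0) f_j z^j. *)
Fixpoint exp_pow (k n : nat) (p : M1) : M1 :=
  if k is k'.+1 then csum n (fun j m => fh j (exp_pow k' m p))
  else if n is 0 then p else 0.

(** Splitting off the first index turns the sum over tuples into a recursion; the
bound [N] on the indices is free, as indices beyond n cannot contribute. *)
Lemma exp_powE k n N p : (n <= N)%N ->
  \sum_(t : k.-tuple 'I_N | (\sum_(j <- t) j.+1 == n)%N)
      foldr (fun j : 'I_N => f j.+1) p t = exp_pow k n p.
Proof.
elim: k n => [|k IHk] n nN.
  rewrite big_mkcond (big_pred1 [tuple]) /=; last first.
    by move=> t; apply/esym/eqP; rewrite (tuple0 t).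
  by rewrite big_nil; case: (n) nN.
rewrite (reindex (fun x : 'I_N * k.-tuple 'I_N => [tuple of x.1 :: x.2])) /=;
  last first.
  apply: onW_bij; exists (fun t => (thead t, behead_tuple t)).
    by move=> [x t] /=; congr pair; apply/val_inj.
  by move=> t; rewrite [RHS]tuple_eta; apply/val_inj.
rewrite -(pair_big_dep xpredT
  (fun (i : 'I_N) (t : k.-tuple 'I_N) => (\sum_(j <- i :: t) j.+1 == n)%N)
  (fun i t => f i.+1 (foldr (fun j : 'I_N => f j.+1) p t))) /=.
rewrite {1}/csum big_ord_recl add0r.
rewrite (big_ord_widen N (fun i => f i.+1 (exp_pow k (n - bump 0 i) p)))//.
rewrite [RHS]big_mkcond; apply: eq_bigr => i _; rewrite /bump add1n.
case: ltnP => iN.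
  rewrite -IHk ?(leq_trans (leq_subr _ _))// (morphD_sum _ _ _ (@fD _)).
  apply: eq_bigl => t; rewrite big_cons.
  by move: (\sum_(j <- t) _)%N => u; apply/eqP/eqP => H; lia.
rewrite big_pred0// => t; rewrite big_cons; apply/negP => /eqP; lia.
Qed.

Lemma exp_pow_small k n p : (n < k)%N -> exp_pow k n p = 0.
Proof.
elim: k n => // k IHk n nk /=; apply: csum_eq0 => -[|j] m jm //=.
by rewrite IHk ?(morphD0 (@fD _))//; lia.
Qed.

Lemma exp_coefE N n p : (n <= N)%N ->
  gexp_coef f n p = \sum_(k < N.+1) (k`!%:R^-1 : C) *: exp_pow k n p.
Proof.
move=> nN; rewrite /gexp_coef.
rewrite (big_ord_widen N.+1 (fun k => (k`!%:R^-1 : C) *: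
  \sum_(t : k.-tuple 'I_n | (\sum_(j <- t) j.+1 == n)%N)
      foldr (fun j : 'I_n => f j.+1) p t))//.
rewrite big_mkcond; apply: eq_bigr => k _; case: ltnP => nk.
  by rewrite exp_powE.
by rewrite exp_pow_small ?scaler0.
Qed.

Lemma exp_coef0 p : gexp_coef f 0 p = p.
Proof. by rewrite (@exp_coefE 0)// big_ord1 /= fact0 invr1 scale1r. Qed.

Hypothesis fZ : forall j c p, f j (c *: p) = c *: f j p.
Hypothesis fC : forall i j p, f i (f j p) = f j (f i p).

Let fhC i j p : fh i (fh j p) = fh j (fh i p).
Proof.
case: i j => [|i] [|j] //=; first by rewrite (morphD0 (@fD _)).
by rewrite (morphD0 (@fD _)).
Qed.

(** z d/dz f^(k+1) = (k+1) (z f') f^k, by induction on k; this is where the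
operators have to commute. *)
Lemma exp_powS k n p : exp_pow k.+1 n p *+ n =
  csum n (fun j m => fh j (exp_pow k m p) *+ j) *+ k.+1.
Proof.
have split k' n' : exp_pow k'.+1 n' p *+ n' =
    csum n' (fun j m => fh j (exp_pow k' m p) *+ j) +
    csum n' (fun j m => fh j (exp_pow k' m p *+ m)).
  rewrite -csumD /= -csumMn; apply: eq_csum => j m <-.
  by rewrite mulrnDr (morphDMn _ _ (@fhD _)).
elim: k n => [|k IHk] n; rewrite split.
  rewrite [X in _ + X]csum_eq0 ?addr0 ?mulr1n// => j [|m] _ /=.
    by rewrite mulr0n (morphD0 (@fhD _)).
  by rewrite mul0rn (morphD0 (@fhD _)).
rewrite [RHS]mulrSr addrC; congr (_ + _).
under eq_csum => j m _.
  rewrite IHk (morphDMn _ _ (@fhD _)) (morphD_csum _ _ (@fhD _)).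
  under eq_csum => i m' _ do rewrite (morphDMn _ _ (@fhD _)) fhC.
  over.
rewrite csumMn csumCA; congr (_ *+ _); apply: eq_csum => i m _ /=.
by rewrite (morphD_csum _ _ (@fhD _)) csumMn.
Qed.

(** The differential equation E' = f' E of the exponential. *)
Lemma exp_coefS n p : gexp_coef f n.+1 p *+ n.+1 =
  csum n (fun j m => f j.+1 (gexp_coef f m p) *+ j.+1).
Proof.
have fZ' j : linear (fh j).
  by case: j => [|j] c x y /=; rewrite ?scaler0 ?addr0// fD fZ.
have fhZ j c x : fh j (c *: x) = c *: fh j x.
  by case: j => [|j] /=; rewrite ?scaler0.
rewrite (@exp_coefE n.+1)// -sumrMnl big_ord_recl.
rewrite [exp_pow _ _ _](_ : _ = 0)// scaler0 mul0rn add0r.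
transitivity (\sum_(k < n.+1) ((k`!)%:R^-1 : C) *:
    csum n.+1 (fun j m => fh j (exp_pow k m p) *+ j)).
  apply: eq_bigr => k _; rewrite scalerMnr lift0 exp_powS.
  rewrite factS natrM -scaler_nat scalerA; congr (_ *: _).
  have n0 : k.+1%:R != 0 :> C by rewrite pnatr_eq0.
  have f0 : k`!%:R != 0 :> C by rewrite pnatr_eq0 -lt0n fact_gt0.
  by rewrite invfM mulrAC mulVf// mul1r.
under eq_bigr do rewrite csumSl mulr0n add0r.
transitivity (csum n (fun j m =>
    \sum_(k < n.+1) f j.+1 ((k`!)%:R^-1 *: exp_pow k m p) *+ j.+1)); last first.
  apply: eq_csum => j m jm; rewrite (@exp_coefE n); last by lia.
  by rewrite (morphD_sum _ _ _ (@fD _)) -sumrMnl.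
rewrite /csum exchange_big; apply: eq_bigr => k _ /=.
by rewrite scaler_sumr; apply: eq_bigr => j _ /=; rewrite fZ scalerMnr.
Qed.

Lemma exp_coef_comm (g : M1 -> M1) n p : linear g ->
  (forall j q, g (f j q) = f j (g q)) ->
  g (gexp_coef f n p) = gexp_coef f n (g p).
Proof.
move=> gl gf.
have gD : {morph g : p q / p + q} by move=> x y; have := gl 1 x y; rewrite !scale1r.
have gZ c x : g (c *: x) = c *: g x.
  by have := gl c x 0; rewrite (morphD0 gD) !addr0.
rewrite /gexp_coef (morphD_sum _ _ _ gD); apply: eq_bigr => k _.
rewrite gZ (morphD_sum _ _ _ gD); congr (_ *: _); apply: eq_bigr => t _.
by elim: (tval t) => //= j s IHs; rewrite gf IHs.
Qed.

Lemma exp_coef_linear n : linear (gexp_coef f n).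
Proof.
move=> c p q.
have fold_lin (t : seq 'I_n) : foldr (fun j : 'I_n => f j.+1) (c *: p + q) t =
    c *: foldr (fun j : 'I_n => f j.+1) p t + foldr (fun j : 'I_n => f j.+1) q t.
  by elim: t => //= j s ->; rewrite fD fZ.
rewrite /gexp_coef scaler_sumr -big_split; apply: eq_bigr => k _ /=.
under eq_bigr do rewrite fold_lin.
by rewrite big_split /= -scaler_sumr scalerDr !scalerA mulrC.
Qed.

End ExpCoef.

(** * Lattice coordinates *)

Section Lattice.
Variables (L : zmodType) (d : nat) (ip : L -> L -> int) (gam : 'I_d -> L).
Hypothesis hip : is_posdef_even_form ip.
Hypothesis hgam : is_lattice_basis gam.
Implicit Types a b : L.

Lemma lcoordP a : a = \sum_(i < d) gam i *~ Defs.coord gam a i.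
Proof.
have [c [ac _]] := hgam a.
exact: (@xgetPex _ 0 [set c : {ffun 'I_d -> int} | a = \sum_(i < d) gam i *~ c i]
  (ex_intro _ c ac)).
Qed.

Lemma lcoord_uniq a (c : {ffun 'I_d -> int}) :
  a = \sum_(i < d) gam i *~ c i -> Defs.coord gam a = c.
Proof.
move=> ac; have [c' [_ uc]] := hgam a.
by rewrite -(uc _ ac) -(uc _ (lcoordP a)).
Qed.

Lemma lcoordD a b : Defs.coord gam (a + b) =
  [ffun i => Defs.coord gam a i + Defs.coord gam b i].
Proof.
apply: lcoord_uniq; rewrite {1}(lcoordP a) {1}(lcoordP b) -big_split /=.
by apply: eq_bigr => i _; rewrite ffunE mulrzDr.
Qed.

Lemma lcoord0 i : Defs.coord gam 0 i = 0.
Proof.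
rewrite (@lcoord_uniq 0 [ffun=> 0]) ?ffunE//.
by rewrite big1// => j _; rewrite ffunE mulr0z.
Qed.

Lemma lcoord_gam i j : Defs.coord gam (gam i) j = (i == j)%:R.
Proof.
rewrite (@lcoord_uniq (gam i) [ffun j => (i == j)%:R]) ?ffunE//.
rewrite (bigD1 i)//= ffunE eqxx big1 ?addr0// => k ki.
by rewrite ffunE eq_sym (negPf ki).
Qed.

Lemma ipC a b : ip a b = ip b a.
Proof. by case: hip. Qed.

Lemma ipDl a b c : ip (a + b) c = ip a c + ip b c.
Proof. by case: hip. Qed.

Lemma ipDr a b c : ip a (b + c) = ip a b + ip a c.
Proof. by rewrite ![ip a _]ipC ipDl. Qed.

Lemma ip0r a : ip a 0 = 0.
Proof. by apply: (addrI (ip a 0)); rewrite -ipDr !addr0. Qed.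

Lemma ip0l a : ip 0 a = 0.
Proof. by rewrite ipC ip0r. Qed.

Lemma ipNr a b : ip a (- b) = - ip a b.
Proof. by apply/eqP; rewrite -addr_eq0 -ipDr addNr ip0r. Qed.

Lemma ipMzr a b z : ip a (b *~ z) = ip a b * z.
Proof.
have H n : ip a (b *+ n) = ip a b * n%:Z.
  elim: n => [|n IHn]; first by rewrite mulr0n ip0r mulr0.
  by rewrite mulrS ipDr IHn intS mulrDr mulr1.
by case: z => n; rewrite ?H// NegzE mulrNz ipNr H mulrN.
Qed.

Lemma ip_sumr a (I : Type) (r : seq I) (P : pred I) (F : I -> L) :
  ip a (\sum_(i <- r | P i) F i) = \sum_(i <- r | P i) ip a (F i).
Proof. exact: (big_morph (ip a) (ipDr a) (ip0r a)). Qed.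

Lemma ip_coord a b : ip a b = \sum_(i < d) ip a (gam i) * Defs.coord gam b i.
Proof.
by rewrite {1}(lcoordP b) ip_sumr; apply: eq_bigr => i _; rewrite ipMzr.
Qed.

End Lattice.

(** * Heisenberg operators on M(1) *)

Section Heisenberg.
Variables (C : numFieldType) (L : zmodType) (d : nat) (M1 : fock C d).
Variables (ip : L -> L -> int) (gam : 'I_d -> L).
Hypothesis hip : is_posdef_even_form ip.
Hypothesis hgam : is_lattice_basis gam.
Implicit Types (a b : L) (p q : M1).

(** The creation operator a(-k-1) is multiplication by [acre a k], and [dann a k]
is the annihilation operator a(k+1). *)
Definition acre a k : M1 := \sum_(i < d) (Defs.coord gam a i)%:~R *: ghvar M1 i k.

Definition dann a k p : M1 :=
  \sum_(i < d) (k.+1%:R * (ip a (gam i))%:~R) *: ghdiff i k p.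

Lemma heis1_cre a b k p : gheis1 ip gam a b (Negz k) p = acre a k * p.
Proof. by []. Qed.

Lemma heis1_ann a b k p : gheis1 ip gam a b k.+1 p = dann a k p.
Proof. by []. Qed.

Lemma acreD a b k : acre (a + b) k = acre a k + acre b k.
Proof.
rewrite /acre -big_split; apply: eq_bigr => i _ /=.
by rewrite lcoordD// ffunE rmorphD scalerDl.
Qed.

Lemma acre0 k : acre 0 k = 0.
Proof. by rewrite /acre big1// => i _; rewrite lcoord0// scale0r. Qed.

Lemma acre_gam i k : acre (gam i) k = ghvar M1 i k.
Proof.
rewrite /acre (bigD1 i)//= lcoord_gam// eqxx scale1r big1 ?addr0// => j ji.
by rewrite lcoord_gam// eq_sym (negPf ji) scale0r.
Qed.

Lemma dannD a k : {morph dann a k : p q / p + q}.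
Proof.
move=> p q; rewrite /dann -big_split; apply: eq_bigr => i _ /=.
by rewrite ghdiffD scalerDr.
Qed.

Lemma dannZ a k c p : dann a k (c *: p) = c *: dann a k p.
Proof.
rewrite /dann scaler_sumr; apply: eq_bigr => i _ /=.
by rewrite ghdiffZ !scalerA mulrC.
Qed.

Lemma dannM a k p q : dann a k (p * q) = dann a k p * q + p * dann a k q.
Proof.
rewrite /dann mulr_suml mulr_sumr -big_split; apply: eq_bigr => i _ /=.
by rewrite ghdiffM scalerDr scalerAl scalerAr.
Qed.

Lemma dann1 a k : dann a k 1 = 0.
Proof.
apply: (addrI (dann a k 1)); rewrite -{1}(mulr1 (dann a k 1)).
by rewrite -{2}(mul1r (dann a k 1)) -dannM mulr1 addr0. Qed.

Lemma dann_cst a k c : dann a k (fock_cst M1 c) = 0.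
Proof. by rewrite fock_cstE dannZ dann1 scaler0. Qed.

Lemma dannDl a b k p : dann (a + b) k p = dann a k p + dann b k p.
Proof.
rewrite /dann -big_split; apply: eq_bigr => i _ /=.
by rewrite ipDl// rmorphD mulrDr scalerDl.
Qed.

Lemma dann0l k p : dann 0 k p = 0.
Proof. by rewrite /dann big1// => i _; rewrite ip0l// mulr0 scale0r. Qed.

Lemma dann_hvar a k j m :
  dann a k (ghvar M1 j m) = (k == m)%:R * (k.+1%:R * (ip a (gam j))%:~R) *: 1.
Proof.
rewrite /dann (bigD1 j)//= ghdiff_hvar xpair_eqE eqxx big1 ?addr0.
  by case: (k == m); rewrite /= ?scaler0 ?mul0r ?scale0r ?mul1r.
by move=> i /negPf ij; rewrite ghdiff_hvar xpair_eqE ij scaler0.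
Qed.

(** The Heisenberg commutation relation. *)
Lemma dann_acre a k b m :
  dann a k (acre b m) = (k == m)%:R * (k.+1%:R * (ip a b)%:~R) *: 1.
Proof.
rewrite /acre (morphD_sum _ _ _ (@dannD _ _)) (ip_coord hip hgam a b).
rewrite (rmorph_sum (intmul (1 : C))) mulr_sumr mulr_sumr scaler_suml; apply: eq_bigr => i _ /=.
by rewrite dannZ dann_hvar scalerA rmorphM /=; congr (_ *: _); ring.
Qed.

(** The commutator of two derivations is a derivation, and it kills the
variables. *)
Lemma dannC a k b m p : dann a k (dann b m p) = dann b m (dann a k p).
Proof.
have dann_scal a' k' (c : C) : dann a' k' (c *: 1) = 0.
  by rewrite dannZ dann1 scaler0.
have dann0 a' k' : dann a' k' 0 = 0 by exact: (morphD0 (@dannD a' k')).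
elim/fock_ind: p => [c|i n|p q IHp IHq|p q IHp IHq].
- by rewrite !dann_cst !dann0.
- by rewrite !dann_hvar !dann_scal.
- by rewrite !dannD IHp IHq.
by rewrite !(dannM, dannD) IHp IHq; ring.
Qed.

Lemma ghdiff_small p : exists N, forall i k, (N <= k)%N -> ghdiff i k p = 0.
Proof.
have D0 i k : ghdiff i k (0 : M1) = 0 by exact: (morphD0 (@ghdiffD _ _ _ i k)).
have D1 i k : ghdiff i k (1 : M1) = 0.
  have := ghdiffM i k (1 : M1) 1; rewrite mulr1 mulr1 mul1r => H.
  by apply: (addrI (ghdiff i k (1 : M1))); rewrite -H addr0.
elim/fock_ind: p => [c|i n|p q [N HN] [N' HN']|p q [N HN] [N' HN']].
- by exists 0%N => i k _; rewrite fock_cstE ghdiffZ D1 scaler0.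
- exists n.+1 => j k nk; rewrite ghdiff_hvar xpair_eqE.
  by rewrite (gtn_eqF nk) andbF.
- exists (maxn N N') => i k; rewrite geq_max => /andP[? ?].
  by rewrite ghdiffD HN// HN'// addr0.
exists (maxn N N') => i k; rewrite geq_max => /andP[? ?].
by rewrite ghdiffM HN// HN'// mul0r mulr0 addr0.
Qed.

Lemma dann_small a p : exists N, forall k, (N <= k)%N -> dann a k p = 0.
Proof.
have [N HN] := ghdiff_small p; exists N => k Nk.
by rewrite /dann big1// => i _; rewrite HN// scaler0.
Qed.

(** * Schur polynomials and their adjoints *)

Local Notation s := (gschur M1 ip gam).
Local Notation e := (@gexp_annih C L d M1 ip gam).

Lemma schur_rec a n : s a n.+1 *+ n.+1 = csum n (fun k m => acre a k * s a m).
Proof.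
rewrite /gschur exp_coefS.
- apply: eq_csum => k m _.
  have -> : - (k.+1)%:Z = Negz k by rewrite NegzE.
  by rewrite heis1_cre -scaler_nat scalerA divff ?scale1r// pnatr_eq0.
- case=> [|j] p q; first by rewrite invr0 !scale0r addr0.
  by rewrite -[- (j.+1)%:Z]NegzE !heis1_cre mulrDr scalerDr.
- case=> [|j] c p; first by rewrite invr0 !scale0r scaler0.
  by rewrite -[- (j.+1)%:Z]NegzE !heis1_cre -scalerAr !scalerA mulrC.
case=> [|i] [|j] p; rewrite ?invr0 ?scale0r ?oppr0.
- by [].
- by rewrite -[- (j.+1)%:Z]NegzE heis1_cre mulr0 scaler0.
- by rewrite -[- (i.+1)%:Z]NegzE heis1_cre mulr0 scaler0.
rewrite -[- (i.+1)%:Z]NegzE -[- (j.+1)%:Z]NegzE !heis1_cre -!scalerAr !scalerA.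
by rewrite mulrC mulrCA.
Qed.

Lemma schur0n a : s a 0 = 1.
Proof.
rewrite /gschur exp_coef0// => -[|j] p q; first by rewrite invr0 !scale0r addr0.
by rewrite -[- (j.+1)%:Z]NegzE !heis1_cre mulrDr scalerDr.
Qed.

Definition ann_mode a (j : nat) p : M1 := - (j%:R^-1) *: gheis1 ip gam a 0 j p.

Lemma ann_modeD a j : {morph ann_mode a j : p q / p + q}.
Proof.
case: j => [|j] p q; first by rewrite /ann_mode invr0 oppr0 !scale0r addr0.
by rewrite /ann_mode !heis1_ann dannD scalerDr.
Qed.

Lemma ann_modeZ a j c p : ann_mode a j (c *: p) = c *: ann_mode a j p.
Proof.
case: j => [|j]; first by rewrite /ann_mode invr0 oppr0 !scale0r scaler0.
by rewrite /ann_mode !heis1_ann dannZ !scalerA mulrC.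
Qed.

Lemma ann_modeC a b i j p :
  ann_mode a i (ann_mode b j p) = ann_mode b j (ann_mode a i p).
Proof.
case: i j => [|i] [|j]; rewrite /ann_mode ?invr0 ?oppr0 ?scale0r //.
- by rewrite heis1_ann (morphD0 (@dannD _ _)) scaler0.
- by rewrite heis1_ann (morphD0 (@dannD _ _)) scaler0.
by rewrite !heis1_ann !dannZ dannC !scalerA mulrC.
Qed.

Lemma annih_rec a n p :
  e a n.+1 p *+ n.+1 = csum n (fun k m => - dann a k (e a m p)).
Proof.
rewrite /gexp_annih exp_coefS.
- apply: eq_csum => k m _; rewrite heis1_ann -scaler_nat scalerA mulrN divff.
    by rewrite scaleN1r.
  by rewrite pnatr_eq0.
- exact: ann_modeD.
- exact: ann_modeZ.
exact: ann_modeC.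
Qed.

Lemma annih0n a p : e a 0 p = p.
Proof. exact/exp_coef0/ann_modeD. Qed.

Lemma annihZD a n : linear (e a n).
Proof. exact: (exp_coef_linear (@ann_modeD a) (@ann_modeZ a)). Qed.

Lemma annihD a n : {morph e a n : p q / p + q}.
Proof. by move=> p q; have := annihZD a n 1 p q; rewrite !scale1r. Qed.

Lemma annihZ a n c p : e a n (c *: p) = c *: e a n p.
Proof. by have := annihZD a n c p 0; rewrite (morphD0 (@annihD a n)) !addr0. Qed.

Lemma annihN a n p : e a n (- p) = - e a n p.
Proof. by rewrite -scaleN1r annihZ scaleN1r. Qed.

Lemma annih_dannC a b n k p : dann b k (e a n p) = e a n (dann b k p).
Proof.
apply: (exp_coef_comm (f := ann_mode a)) => [c x y|j q].
  by rewrite dannD dannZ.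
case: j => [|j]; rewrite /ann_mode ?invr0 ?oppr0 ?scale0r.
  exact: (morphD0 (@dannD _ _)).
by rewrite !heis1_ann dannZ dannC.
Qed.

(** exp((a + b)(z)) = exp(a(z)) exp(b(z)). *)
Lemma schurD a b n : s (a + b) n = csum n (fun i j => s a i * s b j).
Proof.
apply: (csum_unique (C := C) (V := M1) (X := s (a + b))
  (Y := fun n => csum n (fun i j => s a i * s b j))
  (T := fun k x => acre (a + b) k * x)) => [||{}n].
- by rewrite csum0 !schur0n mulr1.
- exact: schur_rec.
rewrite (@csum_rec _ _ _ (fun k i j => acre a k * (s a i * s b j))
    (fun k i j => acre b k * (s a i * s b j))).
- apply: eq_csum => k m _; rewrite csumD acreD mulrDl /csum.
  by rewrite -!mulr_sumr.
- move=> i j; rewrite -mulrnAl schur_rec /csum mulr_suml.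
  by apply: eq_bigr => k _; rewrite mulrA.
move=> i j; rewrite -mulrnAr schur_rec /csum mulr_sumr.
by apply: eq_bigr => k _; rewrite mulrCA.
Qed.

Lemma schur_0 n : s 0 n = (n == 0%N)%:R.
Proof.
apply: (csum_unique (C := C) (V := M1) (X := s 0) (Y := fun n => (n == 0%N)%:R)
  (T := fun k x => acre 0 k * x)) => [|{}n|{}n].
- by rewrite schur0n.
- exact: schur_rec.
by rewrite mul0rn csum_eq0// => i j _; rewrite acre0 mul0r.
Qed.

Lemma annih_1 a n : e a n 1 = (n == 0%N)%:R.
Proof.
apply: (csum_unique (C := C) (V := M1) (X := fun n => e a n 1)
  (Y := fun n => (n == 0%N)%:R) (T := fun k x => - dann a k x)) => [|{}n|{}n].
- by rewrite annih0n.
- exact: annih_rec.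
rewrite mul0rn csum_eq0// => i j _.
by case: eqP => _; rewrite ?dann1 ?(morphD0 (@dannD _ _)) oppr0.
Qed.

(** The exponential of a derivation is multiplicative. *)
Lemma annihM a n p q : e a n (p * q) = csum n (fun i j => e a i p * e a j q).
Proof.
apply: (csum_unique (C := C) (V := M1) (X := fun n => e a n (p * q))
  (Y := fun n => csum n (fun i j => e a i p * e a j q))
  (T := fun k x => - dann a k x)) => [|{}n|{}n].
- by rewrite csum0 !annih0n.
- exact: annih_rec.
 rewrite (@csum_rec _ _ _ (fun k i j => - dann a k (e a i p) * e a j q)
    (fun k i j => - (e a i p * dann a k (e a j q)))).
- apply: eq_csum => k m _; rewrite (morphD_csum _ _ (@dannD _ _)).
  rewrite -[RHS]sumrN; apply: eq_bigr => i _.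
  by rewrite dannM mulNr opprD.
- move=> i j; rewrite -mulrnAl annih_rec /csum mulr_suml.
  by apply: eq_bigr.
move=> i j; rewrite -mulrnAr annih_rec /csum mulr_sumr.
by apply: eq_bigr => k _; rewrite mulrN.
Qed.

Lemma annihDl a b n p : e (a + b) n p = csum n (fun i j => e a i (e b j p)).
Proof.
apply: (csum_unique (C := C) (V := M1) (X := fun n => e (a + b) n p)
  (Y := fun n => csum n (fun i j => e a i (e b j p)))
  (T := fun k x => - dann (a + b) k x)) => [|{}n|{}n].
- by rewrite csum0 !annih0n.
- exact: annih_rec.
 rewrite (@csum_rec _ _ _ (fun k i j => - dann a k (e a i (e b j p)))
    (fun k i j => - dann b k (e a i (e b j p)))).
- apply: eq_csum => k m _; rewrite (morphD_csum _ _ (@dannD _ _)).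
  rewrite -[RHS]sumrN; apply: eq_bigr => i _.
  by rewrite dannDl opprD.
- by move=> i j; rewrite annih_rec.
move=> i j; rewrite -(morphDMn _ _ (@annihD _ _)) annih_rec.
rewrite (morphD_csum _ _ (@annihD _ _)); apply: eq_csum => k m _.
by rewrite annihN (annih_dannC a b i).
Qed.

Lemma annih_0 n p : e 0 n p = if n is 0 then p else 0.
Proof.
apply: (csum_unique (C := C) (V := M1) (X := fun n => e 0 n p)
   (Y := fun n => if n is 0 then p else 0)
   (T := fun k x => - dann 0 k x)) => [|{}n|{}n].
- by rewrite annih0n.
- exact: annih_rec.
by rewrite mul0rn csum_eq0// => i j _; rewrite dann0l oppr0.
Qed.

(** a(k+1) E_b(w) = (a,b) w^(k+1) E_b(w), where E_b(w) is the generating series of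
the Schur polynomials: induct with the recursion of E_b. *)
Lemma dann_schur a b k n :
  dann a k (s b n) = if (k < n)%N then (ip a b)%:~R *: s b (n - k.+1) else 0.
Proof.
elim/ltn_ind: n => -[|n] IHn; first by rewrite schur0n dann1.
apply: (@mulrnI_lmod C _ n).
rewrite -(morphDMn _ _ (@dannD _ _)) schur_rec (morphD_csum _ _ (@dannD _ _)).
under eq_csum do rewrite dannM dann_acre.
rewrite csumD (@csum_pick _ n k) => [|i j _ ik]; last first.
  by rewrite eq_sym (negPf ik) mul0r scale0r mul0r.
rewrite eqxx mul1r ltnS.
transitivity ((if (k <= n)%N then (k.+1%:R * (ip a b)%:~R) *: s b (n - k) else 0) +
  if (k < n)%N then (ip a b)%:~R *: (s b (n - k) *+ (n - k)) else 0).
  congr (_ + _); first by case: ifP => // _; rewrite -scalerAl mul1r.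
  case: ltnP => kn.
    have -> : (n - k = (n - k.+1).+1)%N by lia.
    rewrite schur_rec.
    rewrite (morphD_csum _ _ (@scalerDr _ _ _)).
    rewrite -{1}(subnK kn); apply: csum_shift => i j ij.
      by move=> ni; rewrite IHn ?ifF ?mulr0//; lia.
    rewrite IHn ?ifT; [|lia..].
    by rewrite -scalerAr addnK.
  apply: csum_eq0 => i j ij; rewrite IHn; last by lia.
  by rewrite ifF ?mulr0//; lia.
have [kn|nk] := leqP k n; last by rewrite ltnNge ltnW//= addr0 mul0rn.
rewrite subSS scalerMnr; case: ltnP => kn'.
  rewrite -!scaler_nat !scalerA -scalerDl; congr (_ *: _).
  by rewrite (natrB _ kn) -!natr1; ring.
have -> : k = n by lia.
by rewrite addr0 -scaler_nat scalerA mulrC.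
Qed.

(** exp(- sum_n a(n) z^(-n) / n) E_b(w) = (1 - w/z)^(a,b) E_b(w): the coefficients
solve the recursion of the binomial series. *)
Lemma annih_schur a b m n :
  e a m (s b n) = if (m <= n)%N
    then ((-1) ^+ m * gbin ((ip a b)%:~R) m) *: s b (n - m) else 0.
Proof.
pose Y m := if (m <= n)%N
    then ((-1) ^+ m * gbin ((ip a b)%:~R : C) m) *: s b (n - m) else 0.
apply: (csum_unique (C := C) (V := M1) (X := fun m => e a m (s b n)) (Y := Y)
  (T := fun k x => - dann a k x)) => [|{}m|{}m].
- by rewrite annih0n /Y /= expr0 gbin0 mulr1 scale1r subn0.
- exact: annih_rec.
pose c : C := (ip a b)%:~R.
(* The coefficient of x^m in (1 - x)^c. *)
pose kap m : C := (-1) ^+ m * gbin c m.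
have kapE j : kap j.+1 *+ j.+1 = (j%:R - c) * kap j.
  rewrite /kap -mulrnAr gbinS exprS; ring.
have kapS j : kap j.+1 *+ j.+1 = \sum_(i < j.+1) - c * kap i.
  elim: j => [|j IHj]; first by rewrite big_ord1 kapE sub0r.
  by rewrite big_ord_recr /= -IHj kapE -mulr_natl; ring.
rewrite /Y; cbv beta; case: ltnP => mn; last first.
  rewrite mul0rn csum_eq0// => i j ij; case: leqP => jn.
    by rewrite dannZ dann_schur ifF ?scaler0 ?oppr0//; lia.
  by rewrite (morphD0 (@dannD _ _)) oppr0.
rewrite scalerMnl -/c -/(kap _) kapS scaler_suml csumC; apply: eq_bigr => i _.
have im : (i <= m)%N by rewrite -ltnS.
rewrite ifT; last by lia.
rewrite dannZ dann_schur ifT; last by lia.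
rewrite scalerA -scaleNr; congr (_ *: s b _); last by lia.
rewrite -/c /kap; ring.
Qed.

(** The property passes to products by [annihM], so the variables suffice. *)
Lemma annih_small a p : exists N, forall n, (N <= n)%N -> e a n p = 0.
Proof.
have E1 c n : (1 <= n)%N -> e a n (fock_cst M1 c) = 0.
  by case: n => // n _; rewrite fock_cstE annihZ annih_1 scaler0.
elim/fock_ind: p => [c|i n|p q [N HN] [N' HN']|p q [N HN] [N' HN']].
- by exists 1%N => n; exact: E1.
- exists n.+2 => -[|m]// nm; apply: (@mulrnI_lmod C _ m).
  rewrite annih_rec mul0rn csum_eq0// => k j kj.
  rewrite annih_dannC dann_hvar; case: eqP => [kn|_]; last first.
    by rewrite mul0r scale0r (morphD0 (@annihD _ _)) oppr0.
  rewrite mul1r annihZ annih_1.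
  have -> : (j == 0)%N = false by lia.
  by rewrite scaler0 oppr0.
- exists (maxn N N') => n; rewrite geq_max => /andP[? ?].
  by rewrite annihD HN// HN'// addr0.
exists (N + N')%N => n NN; rewrite annihM csum_eq0// => i j ij.
have [Ni|iN] := leqP N i; first by rewrite HN// mul0r.
by rewrite [X in _ * X]HN' ?mulr0//; lia.
Qed.

End Heisenberg.

(** * Integral spans *)

Section Zspan.
Variables (V : zmodType).
Implicit Types (S : set V).

Lemma zspan_ind S (P : V -> Prop) :
  P 0 -> (forall u v, P u -> P v -> P (u - v)) -> (forall v, S v -> P v) ->
  forall v, zspan S v -> P v.
Proof.
move=> P0 PB PS v [n [c [x [Sx ->]]]].
have PN u : P u -> P (- u) by move=> Pu; rewrite -sub0r; exact: PB.
have PD u w : P u -> P w -> P (u + w).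
  by move=> Pu Pw; rewrite -[w]opprK; apply: PB => //; exact: PN.
have PMn u m : P u -> P (u *+ m).
  by move=> Pu; elim: m => [|m IHm]; rewrite ?mulr0n// mulrS; exact: PD.
apply: big_ind => // i _; case: (c i) => m; first by apply/PMn/PS.
by rewrite NegzE mulrNz; apply/PN/PMn/PS.
Qed.

Lemma zspan_gen S v : S v -> zspan S v.
Proof.
move=> Sv; exists 1%N, (fun=> 1), (fun=> v); split=> //.
by rewrite big_ord1 mulr1z.
Qed.

Lemma zspan0 S : zspan S 0.
Proof.
by exists 0%N, (fun=> 0), (fun=> 0); split=> [[]//|]; rewrite big_ord0.
Qed.

Lemma zspanB S u v : zspan S u -> zspan S v -> zspan S (u - v).
Proof.
move=> [n [c [x [Sx ->]]]] [m [c' [x' [Sx' ->]]]].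
exists (n + m)%N, (fun i => match fintype.split i with inl i => c i | inr i => - c' i end),
  (fun i => match fintype.split i with inl i => x i | inr i => x' i end).
split=> [i|]; first by case: (fintype.split i).
rewrite big_split_ord /= -sumrN; congr (_ + _); apply: eq_bigr => i _.
  by rewrite (unsplitK (inl i)).
by rewrite (unsplitK (inr i)) mulrNz.
Qed.

Lemma zspanN S v : zspan S v -> zspan S (- v).
Proof. by move=> Sv; rewrite -sub0r; apply: zspanB => //; exact: zspan0. Qed.

Lemma zspanD S u v : zspan S u -> zspan S v -> zspan S (u + v).
Proof. by move=> Su Sv; rewrite -[v]opprK; apply: zspanB => //; exact: zspanN. Qed.

Lemma zspanMz S v z : zspan S v -> zspan S (v *~ z).
Proof.
have H n u : zspan S u -> zspan S (u *+ n).
  by move=> Su; elim: n => [|n IHn]; rewrite ?mulr0n ?mulrS; [exact: zspan0|exact: zspanD].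
by move=> Sv; case: z => n; [exact: H|rewrite NegzE mulrNz; exact/zspanN/H].
Qed.

Lemma zspan_sum S (I : Type) (r : seq I) (P : pred I) (F : I -> V) :
  (forall i, P i -> zspan S (F i)) -> zspan S (\sum_(i <- r | P i) F i).
Proof. by move=> SF; apply: big_ind => //; [exact: zspan0|exact: zspanD]. Qed.

Lemma zspan_csum S n (F : nat -> nat -> V) :
  (forall i j, zspan S (F i j)) -> zspan S (csum n F).
Proof. by move=> SF; exact: zspan_sum. Qed.

End Zspan.

(** * The ring of integral Schur polynomials *)

Section SchurRing.
Variables (C : numFieldType) (L : zmodType) (d : nat) (M1 : fock C d).
Variables (ip : L -> L -> int) (gam : 'I_d -> L).
Hypothesis hip : is_posdef_even_form ip.
Hypothesis hgam : is_lattice_basis gam.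
Implicit Types (a b : L) (p q : M1).
Local Notation s := (gschur M1 ip gam).
Local Notation e := (@gexp_annih C L d M1 ip gam).

Definition schur_prod (w : seq ('I_d * nat)) : M1 :=
  \prod_(x <- w) s (gam x.1) x.2.

(** The ring S of the opening comment. *)
Definition schur_ring : set M1 := zspan (range schur_prod).
Local Notation Sc := schur_ring.

Lemma schur_ring_ind (P : M1 -> Prop) :
  P 0 -> (forall p q, P p -> P q -> P (p - q)) -> P 1 ->
  (forall i n p, Sc p -> P p -> P (s (gam i) n * p)) ->
  forall p, Sc p -> P p.
Proof.
move=> P0 PB P1 PM; apply: zspan_ind => // _ [w _ <-].
elim: w => [|x w IHw]; first by rewrite /schur_prod big_nil.
rewrite /schur_prod big_cons; apply: PM IHw.
by apply: zspan_gen; exists w.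
Qed.

Lemma schur_ring0 : Sc 0. Proof. exact: zspan0. Qed.
Lemma schur_ringB p q : Sc p -> Sc q -> Sc (p - q). Proof. exact: zspanB. Qed.
Lemma schur_ring1 : Sc 1.
Proof. by apply: zspan_gen; exists [::] => //; rewrite /schur_prod big_nil. Qed.

Lemma schur_ring_gam i n p : Sc p -> Sc (s (gam i) n * p).
Proof.
move: p; apply: zspan_ind => [|x y Sx Sy|_ [w _ <-]].
- by rewrite mulr0; exact: zspan0.
- by rewrite mulrBr; exact: zspanB.
by apply: zspan_gen; exists ((i, n) :: w) => //; rewrite /schur_prod big_cons.
Qed.

Lemma schur_ringM p q : Sc p -> Sc q -> Sc (p * q).
Proof.
move=> Sp Sq; move: p Sp; apply: schur_ring_ind.
- by rewrite mul0r; exact: zspan0.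
- by move=> p p' Sp Sp'; rewrite mulrBl; exact: zspanB.
- by rewrite mul1r.
by move=> i n p _ Sp; rewrite -mulrA; exact: schur_ring_gam.
Qed.

Lemma schur_ringZ (c : C) p : (exists z : int, c = z%:~R) -> Sc p -> Sc (c *: p).
Proof. by move=> [z ->] Sp; rewrite scaler_int; exact: zspanMz. Qed.

(** The set of [a] with all s_(a,n) in S is a subgroup of L: it is closed under
negation because a power series with constant term 1 is inverted within S. *)
Lemma schur_ring_schur a n : Sc (s a n).
Proof.
pose P a := forall n, Sc (s a n).
have P0 : P 0.
  move=> m; rewrite schur_0//; case: eqP => _; first exact: schur_ring1.
  exact: schur_ring0.
have PD x y : P x -> P y -> P (x + y).
  by move=> Px Py m; rewrite schurD//; apply: zspan_csum => i j; exact: schur_ringM.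
have PN x : P x -> P (- x).
  move=> Px m; elim/ltn_ind: m => -[|m] IHm.
    by rewrite schur0n; exact: schur_ring1.
  have := schurD M1 ip hgam x (- x) m.+1; rewrite addrN schur_0// csumSl schur0n mul1r.
  move/eqP; rewrite eq_sym addrC addr_eq0 => /eqP /(congr1 (@GRing.opp M1)).
  rewrite opprK => <-; apply: zspanN; apply: zspan_sum => i _.
  by apply: schur_ringM; [exact: Px|apply: IHm; lia].
have PMn x k : P x -> P (x *+ k).
  by move=> Px; elim: k => [|k IHk]; rewrite ?mulr0n// mulrS; exact: PD.
move: n; rewrite (lcoordP hgam a) -/(P _); apply: (big_ind P) => // i _.
have Pg : P (gam i).
  by move=> m; rewrite -[s _ _]mulr1; apply/schur_ring_gam/schur_ring1.
by case: (Defs.coord gam a i) => k; [exact: PMn|rewrite NegzE mulrNz; exact/PN/PMn].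
Qed.

(** By multiplicativity, it suffices to look at the generators, where
[annih_schur] gives integral binomial coefficients. *)
Lemma schur_ring_annih a n p : Sc p -> Sc (e a n p).
Proof.
move=> Sp; move: p Sp n; apply: schur_ring_ind.
- by move=> n; rewrite (morphD0 (@annihD _ _ _ _ _ _ _ _)); exact: schur_ring0.
- by move=> p q Sp Sq n; rewrite annihD annihN; exact: schur_ringB.
- move=> n; rewrite annih_1; case: eqP => _; [exact: schur_ring1|exact: schur_ring0].
move=> i n p _ Sp m; rewrite annihM//; apply: zspan_csum => j k.
apply: schur_ringM; last exact: Sp.
rewrite annih_schur//; case: ifP => _; last exact: schur_ring0.
apply: schur_ringZ; last exact: schur_ring_schur.
have [z ->] := gbin_int C (ip a (gam i)) j.
by exists ((-1) ^+ j * z); rewrite intrM rmorphXn /= rmorphN1.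
Qed.

(** * Integral forms of lattice and Heisenberg type *)

Local Notation VL := {malg M1[L]}.

Lemma gtensorD a : {morph (fun p : M1 => gtensor p a) : p q / p + q}.
Proof. by move=> p q; rewrite /gtensor monalgUD. Qed.

Lemma gtensorN a p : gtensor (- p) a = - gtensor p a.
Proof. by rewrite /gtensor monalgUN. Qed.

Lemma gtensorE (v : VL) : v = \sum_(a <- msupp v) gtensor v@_a a.
Proof. exact: monalgE. Qed.

Lemma mcoeff_gtensor p a c : (gtensor p a)@_c = if a == c then p else 0.
Proof. by rewrite /gtensor mcoeffU; case: eqP; rewrite ?mulr1n ?mulr0n. Qed.

(** Sorting the factors by their index is harmless, S being commutative. *)
Lemma gVL_ZP (v : VL) : gVL_Z ip gam v <-> forall a, Sc v@_a.
Proof.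
split=> [|Sv].
  move: v; apply: zspan_ind => [a|u v Su Sv a|_ [w [a [_ ->]]] c].
  - by rewrite mcoeff0; exact: schur_ring0.
  - by rewrite mcoeffB; exact: schur_ringB.
  rewrite mcoeff_gtensor; case: eqP => _; last exact: schur_ring0.
  by apply: zspan_gen; exists w.
rewrite (gtensorE v); apply: zspan_sum => a _.
move: (v@_a) (Sv a); apply: zspan_ind => [|p q Sp Sq|_ [w _ <-]].
- by rewrite (morphD0 (gtensorD a)); exact: zspan0.
- by rewrite gtensorD gtensorN; exact: zspanB.
pose w' := sort (fun x y : 'I_d * nat => geq x.2 y.2) w.
apply: zspan_gen; exists w', a; split; last first.
  by congr gtensor; apply: perm_big; rewrite perm_sym perm_sort.
rewrite sorted_map; apply: sort_sorted => x y; exact: leq_total.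
Qed.

Lemma gM1_ZP (v : VL) : gM1_Z ip gam v <-> exists2 p, Sc p & v = gtensor p 0.
Proof.
split=> [|[p Sp ->]].
  move: v; apply: zspan_ind => [|_ _ [p Sp ->] [q Sq ->]|_ [w ->]].
  - by exists 0; [exact: schur_ring0|rewrite (morphD0 (gtensorD 0))].
  - by exists (p - q); [exact: schur_ringB|rewrite gtensorD gtensorN].
  exists (\prod_(x <- w) s x.1 x.2) => //.
  apply: (big_ind Sc) => [|p q|x _]; first exact: schur_ring1.
    exact: schur_ringM.
  exact: schur_ring_schur.
move: p Sp; apply: zspan_ind => [|p q Sp Sq|_ [w _ <-]].
- by rewrite (morphD0 (gtensorD 0)); exact: zspan0.
- by rewrite gtensorD gtensorN; exact: zspanB.
apply: zspan_gen; exists [seq (gam x.1, x.2) | x <- w].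
by rewrite big_map.
Qed.

End SchurRing.

(** * Finite and finitely supported sums *)

Lemma sum_ord_widen (V : nmodType) (N N' : nat) (F : nat -> V) :
  (N <= N')%N -> (forall i, (N <= i)%N -> F i = 0) ->
  \sum_(i < N') F i = \sum_(i < N) F i.
Proof.
move=> NN F0; rewrite [RHS](big_ord_widen _ F NN).
rewrite [RHS]big_mkcond; apply: eq_bigr => i _.
by case: ltnP => // iN; rewrite F0.
Qed.

Lemma csum_tri (V : nmodType) N (F : nat -> nat -> V) :
  \sum_(l < N) csum l F = \sum_(i < N) \sum_(j < N - i) F i j.
Proof.
elim: N => [|N IHN]; first by rewrite !big_ord0.
rewrite [LHS]big_ord_recr /= IHN [RHS]big_ord_recr /= subSn// subnn big_ord1.
rewrite [csum N F]big_ord_recr /= subnn addrA; congr (_ + _).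
rewrite -big_split; apply: eq_bigr => i _ /=.
by rewrite subSn ?[in RHS]big_ord_recr//; exact: ltnW.
Qed.

(** A double sum over a box, grouped by the value of i + j. *)
Lemma csum_box (V : nmodType) N A B (F : nat -> nat -> V) :
  (forall i j, (B <= i)%N -> F i j = 0) -> (forall i j, (A <= j)%N -> F i j = 0) ->
  (A + B <= N)%N ->
  \sum_(l < N) csum l F = \sum_(j < A) \sum_(i < B) F i j.
Proof.
move=> FB FA ABN; rewrite csum_tri exchange_big /=.
rewrite (@sum_ord_widen _ B N (fun i => \sum_(j < N - i) F i j)); last 2 first.
- by lia.
- by move=> i Bi; rewrite big1// => j _; exact: FB.
apply: eq_bigr => i _; apply: sum_ord_widen; last exact: FA.
by have := ltn_ord i; lia.
Qed.

(** A product of two series divisible by z^m and by z^k. *)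
Lemma csum_shift2 (V : nmodType) M m k (F G : nat -> nat -> V) :
  (forall i j, (i < m)%N -> F i j = 0) -> (forall i j, (j < k)%N -> F i j = 0) ->
  (forall i j, F (i + m)%N (j + k)%N = G i j) ->
  csum (M + m + k) F = csum M G.
Proof.
move=> Fm Fk FG.
have -> : csum (M + m + k) F = csum (M + m) (fun i j => F i (j + k)%N).
  by apply: csum_shift => // i j ij ni; apply: Fk; lia.
rewrite csumC [RHS]csumC; apply: csum_shift => i j ij; last by rewrite FG.
by move=> ni; apply: Fm; lia.
Qed.

Lemma csum_small2 (V : nmodType) n m k (F : nat -> nat -> V) :
  (forall i j, (i < m)%N -> F i j = 0) -> (forall i j, (j < k)%N -> F i j = 0) ->
  (n < m + k)%N -> csum n F = 0.
Proof.
move=> Fm Fk nmk; apply: csum_eq0 => i j ij.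
have [im|mi] := ltnP i m; first exact: Fm.
by apply: Fk; lia.
Qed.

Lemma csum_exchange (V : nmodType) n m (F : nat -> nat -> nat -> nat -> V) :
  csum n (fun i j => csum m (fun k l => F i j k l)) =
  csum m (fun k l => csum n (fun i j => F i j k l)).
Proof. exact: exchange_big. Qed.

(** Taylor coefficients of a product: d^n/n! applied to a series G(z)H(z) equals
the sum of d^k/k! G times d^(n-k)/(n-k)! H; here on the level of the coefficients
of z^i, for a general bilinear pairing [G]. *)
Lemma csum_Vandermonde (R : pzSemiRingType) n i (G : nat -> nat -> R) :
  csum n (fun k m => csum i (fun j j' =>
     ('C(j + k, k) * 'C(m + j', m))%:R * G (j + k)%N (m + j')%N)) =
  'C(n + i, n)%:R * csum (n + i) G.
Proof.
have -> : 'C(n + i, n)%:R * csum (n + i) G = csum (n + i) (fun h u =>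
    csum n (fun k m => ('C(h, k) * 'C(u, m))%:R * G h u)).
  rewrite /csum mulr_sumr; apply: eq_bigr => h _.
  have hni : (h <= n + i)%N by rewrite -ltnS.
  by rewrite -mulr_suml -natr_sum binomial.Vandermonde subnKC.
rewrite [RHS]csum_exchange; apply: eq_csum => k m km; apply/esym.
have -> : (n + i = i + k + m)%N by lia.
apply: csum_shift2 => [h u hk|h u um|j j'].
- by rewrite bin_small// mul0n mul0r.
- by rewrite (@bin_small u)// muln0 mul0r.
by rewrite (addnC m).
Qed.

Lemma fsum_neg (V : nmodType) N (f : int -> V) :
  (forall n, (N <= n)%N -> f (Negz n) = 0) ->
  \sum_(j \in [set j : int | j < 0]) f j = \sum_(i < N) f (Negz i).
Proof.
move=> f0; rewrite (@fsbigE _ _ _ _ _ [seq Negz i | i <- iota 0 N]).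
- rewrite big_map -/(index_iota 0 N).
  rewrite big_mkcond /= -(big_mkord xpredT (fun i => f (Negz i))).
  rewrite /index_iota subn0; apply: eq_bigr => i _.
  by rewrite ifT// inE.
- by rewrite map_inj_uniq ?iota_uniq// => i j [].
- by move=> j /= /mapP[i _ ->].
case=> // n _ nN; apply: f0; rewrite leqNgt; apply: contra nN => nN.
by rewrite map_f// mem_iota.
Qed.

Lemma fsum_pos (V : nmodType) N (f : int -> V) :
  (forall n : nat, (N <= n)%N -> f n = 0) ->
  \sum_(j \in [set j : int | 0 <= j]) f j = \sum_(i < N) f i.
Proof.
move=> f0; rewrite (@fsbigE _ _ _ _ _ [seq Posz i | i <- iota 0 N]).
- rewrite big_map -/(index_iota 0 N).
  rewrite big_mkcond /= -(big_mkord xpredT (fun i => f (Posz i))).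
  rewrite /index_iota subn0; apply: eq_bigr => i _.
  by rewrite ifT// inE.
- by rewrite map_inj_uniq ?iota_uniq// => i j [].
- by move=> j /= /mapP[i _ ->].
case=> // n _ nN; apply: f0; rewrite leqNgt; apply: contra nN => nN.
by rewrite map_f// mem_iota.
Qed.

Lemma unif_bound (T : eqType) (r : seq T) (P : T -> nat -> Prop) :
  (forall x N N', (N <= N')%N -> P x N -> P x N') ->
  (forall x, exists N, P x N) -> exists N, forall x, x \in r -> P x N.
Proof.
move=> Pmono Pex; elim: r => [|x r [N IHr]]; first by exists 0%N.
have [N' PN'] := Pex x; exists (maxn N N') => y; rewrite inE => /orP[/eqP->|yr].
  by apply: Pmono PN'; exact: leq_maxr.
by apply: Pmono (IHr _ yr); exact: leq_maxl.
Qed.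

(** * Vertex operators as two-sided power series *)

Section Kernels.
Variables (C : numFieldType) (L : zmodType) (d : nat) (M1 : fock C d).
Variables (ip : L -> L -> int) (gam : 'I_d -> L) (eps : L -> L -> int).
Hypothesis hip : is_posdef_even_form ip.
Hypothesis hgam : is_lattice_basis gam.
Implicit Types (a b : L) (p q : M1).
Local Notation s := (gschur M1 ip gam).
Local Notation e := (@gexp_annih C L d M1 ip gam).
Local Notation Sc := (@schur_ring C L d M1 ip gam).
Local Notation VL := {malg M1[L]}.

(** A kernel [K] is a series sum_(i,l) K_(i,l) z^i y^l of operators on M(1); it
stands for the field obtained by y = z^(-1). *)
Definition kernel := nat -> nat -> M1 -> M1.
Implicit Types (K : kernel) (v : VL).

Definition kadd K := forall i l, {morph K i l : p q / p + q}.
Definition kbnd K := forall q, exists N, forall i l, (N <= l)%N -> K i l q = 0.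
Definition kint K := forall i l q, Sc q -> Sc (K i l q).

(** Multiplication on the left by the series sum_i c_i z^i. *)
Definition lconv (c : nat -> M1) K : kernel := fun i l q =>
  csum i (fun i1 i2 => c i1 * K i2 l q).

(** Composition on the right with the series sum_l f_l y^l. *)
Definition rconv (f : nat -> M1 -> M1) K : kernel := fun i l q =>
  csum l (fun l1 l2 => K i l1 (f l2 q)).

(** For x = (i,r), the coefficient of z^n in the part of d^r/r! gamma_i(z) with
nonnegative powers of z. *)
Definition kcre (x : 'I_d * nat) (i : nat) : M1 :=
  'C(i + x.2, x.2)%:R * ghvar M1 x.1 (i + x.2).

(** For x = (i,r), the coefficient of z^(-l) in the part of d^r/r! gamma_i(z) with
negative powers of z, acting on M(1) (x) e^b; the lattice degree [b] enters through
the zero mode. *)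
Definition kann (b : L) (x : 'I_d * nat) (l : nat) (q : M1) : M1 :=
  if l is l'.+1 then
    ((-1) ^+ x.2 * 'C(l', x.2)%:R) *: gheis1 ip gam (gam x.1) b (l' - x.2)%N q
  else 0.

(** The effect on kernels of the normally ordered product with d^r/r! gamma_i(z),
x = (i,r). *)
Definition kstep (b : L) (x : 'I_d * nat) (K : kernel) : kernel := fun i l q =>
  lconv (kcre x) K i l q + rconv (kann b x) K i l q.

(** The kernel of Y(e^a,z) on M(1) (x) e^b, without the factor z^(a,b). *)
Definition kexp (a b : L) : kernel := fun i l q =>
  ((eps a b)%:~R : C) *: (s a i * e a l q).

(** The coefficient of z^t after the substitution y = z^(-1). *)
Definition kdiag K (t : int) q : M1 :=
  \sum_(x \in [set x : nat * nat | x.1%:Z - x.2%:Z = t]) K x.1 x.2 q.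

Definition kfield (a : L) (K : L -> kernel) (k : int) (v : VL) : VL :=
  \sum_(b <- msupp v) gtensor (kdiag (K b) (- k - 1 - ip a b) v@_b) (a + b).

Definition kext K (i : int) l q : M1 := if i is Posz n then K n l q else 0.

(** On a fixed vector a kernel has finitely many powers of y, so the diagonal sum
is finite. *)
Lemma kdiagE K N t q : (forall i l, (N <= l)%N -> K i l q = 0) ->
  kdiag K t q = \sum_(l < N) kext K (t + l%:Z) l q.
Proof.
move=> K0; rewrite /kdiag.
pose r := [seq (absz (t + l%:Z), l) | l <- iota 0 N & 0 <= t + l%:Z].
rewrite (@fsbigE _ _ _ _ _ r).
- rewrite /r big_map big_filter_cond -(big_mkord xpredT (fun l => kext K (t + l%:Z) l q)).
  rewrite /index_iota subn0 big_mkcond; apply: eq_bigr => l _.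
  case E : (t + l%:Z) => [n|n] //=; rewrite ifT// inE /=.
  by move: E; lia.
- by rewrite map_inj_uniq ?filter_uniq ?iota_uniq// => l l' [].
- by move=> x /= /mapP[l]; rewrite mem_filter => /andP[tl _] ->/=; lia.
move=> [i l] /= il nr; apply: K0; rewrite leqNgt; apply: contra nr => lN.
apply/mapP; exists l; first by rewrite mem_filter mem_iota; lia.
by congr pair; lia.
Qed.

Lemma kadd0 K i l : kadd K -> K i l 0 = 0.
Proof. by move=> KD; exact: (morphD0 (KD i l)). Qed.

Lemma kdiag0 K t : kadd K -> kdiag K t 0 = 0.
Proof.
by move=> KD; rewrite (@kdiagE _ 0%N) ?big_ord0// => i l _; exact: kadd0.
Qed.

Lemma gheis1D a b n : {morph (gheis1 ip gam a b n : M1 -> M1) : p q / p + q}.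
Proof.
case: n => [[|n]|n] p q; first by rewrite /gheis1 scalerDr.
  by rewrite !heis1_ann dannD.
by rewrite !heis1_cre mulrDr.
Qed.

Lemma gheis1Z a b n c p : gheis1 ip gam a b n (c *: p) = c *: gheis1 ip gam a b n p.
Proof.
case: n => [[|n]|n]; first by rewrite /gheis1 !scalerA mulrC.
  by rewrite !heis1_ann dannZ.
by rewrite !heis1_cre scalerAr.
Qed.

Lemma gheis1_0 a b n : gheis1 ip gam a b n (0 : M1) = 0.
Proof. exact: (morphD0 (@gheis1D a b n)). Qed.

Lemma mcoeff_kfield a (K : L -> kernel) k v c : (forall b, kadd (K b)) ->
  (kfield a K k v)@_c = kdiag (K (c - a)) (- k - 1 - ip a (c - a)) v@_(c - a).
Proof.
move=> KD; rewrite /kfield raddf_sum /=.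
have [cv|cv] := boolP (c - a \in msupp v); last first.
  rewrite mcoeff_outdom// kdiag0// big_seq big1// => b bv.
  rewrite mcoeff_gtensor; case: eqP => // ab; case/negP: cv.
  by rewrite -ab addrAC subrr add0r.
rewrite (big_rem _ cv)/= mcoeff_gtensor (addrC a) subrK eqxx.
rewrite big_seq big1 ?addr0// => b.
rewrite mem_rem_uniq ?fset_uniq// inE => /andP[bc _].
rewrite mcoeff_gtensor ifF//; apply: contraNF bc => /eqP <-.
by rewrite addrAC subrr add0r.
Qed.

Lemma mcoeff_gheis a n v c : (gheis ip gam a n v)@_c = gheis1 ip gam a c n v@_c.
Proof.
rewrite /gheis raddf_sum /=.
have [cv|cv] := boolP (c \in msupp v); last first.
  rewrite mcoeff_outdom// gheis1_0 big_seq big1// => b bv.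
  rewrite mcoeff_gtensor; case: eqP => // ab; case/negP: cv.
  by rewrite -ab.
rewrite (big_rem _ cv)/= mcoeff_gtensor eqxx.
rewrite big_seq big1 ?addr0// => b.
rewrite mem_rem_uniq ?fset_uniq// inE => /andP[bc _].
by rewrite mcoeff_gtensor ifF//; apply/negbTE.
Qed.

Lemma mcoeff_gscale (c : C) v b : (gscale c v : VL)@_b = c *: v@_b.
Proof. by rewrite /gscale mcoeffZ fock_cstE -scalerAl mul1r. Qed.

Lemma iter_gdfield r (F : int -> VL -> VL) k v b :
  (iter r (@gdfield _ _ _ M1) F k v)@_b =
  (\prod_(i < r) ((i%:Z - k)%:~R : C)) *: (F (k - r%:Z) v)@_b.
Proof.
elim: r k => [|r IHr] k; first by rewrite big_ord0 scale1r subr0.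
rewrite iterS /gdfield mcoeff_gscale IHr scalerA big_ord_recl sub0r.
congr (_ * _ *: (F _ v)@_b); last by lia.
by apply: eq_bigr => i _; congr (_%:~R); rewrite lift0; lia.
Qed.

Lemma dheis_coeff (x : 'I_d * nat) k v b :
  (gdivided_dfield x.2 (gheis ip gam (gam x.1)) k v : VL)@_b =
  ((-1) ^+ x.2 * gbin (k%:~R : C) x.2) *: gheis1 ip gam (gam x.1) b (k - x.2%:Z) v@_b.
Proof.
rewrite /gdivided_dfield mcoeff_gscale iter_gdfield scalerA mcoeff_gheis.
congr (_ *: _); rewrite mulrC /gbin mulrA; congr (_ / _).
rewrite -[in (-1) ^+ _](card_ord x.2) -prodrN; apply: eq_bigr => i _.
by rewrite rmorphB /= opprB.
Qed.

Lemma dheis_cre (x : 'I_d * nat) i v b :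
  (gdivided_dfield x.2 (gheis ip gam (gam x.1)) (Negz i) v : VL)@_b =
  kcre x i * v@_b.
Proof.
rewrite dheis_coeff.
have -> : Negz i - x.2%:Z = Negz (i + x.2)%N by lia.
rewrite heis1_cre acre_gam// /kcre -mulrA mulr_natl -[RHS]scaler_nat.
congr (_ *: _).
rewrite NegzE mulrNz -pmulrn gbinN mulrA -expr2 sqrr_sign mul1r -gbin_nat.
by congr gbin; rewrite -natr1 natrD; ring.
Qed.

Lemma dheis_ann (x : 'I_d * nat) (j : nat) v b :
  (gdivided_dfield x.2 (gheis ip gam (gam x.1)) j v : VL)@_b =
  kann b x j.+1 v@_b.
Proof.
rewrite dheis_coeff /kann -pmulrn gbin_nat.
have [jx|xj] := ltnP j x.2; first by rewrite bin_small// mulr0 !scale0r.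
by congr (_ *: gheis1 _ _ _ _ _ _); lia.
Qed.

Lemma kannD b x l : {morph kann b x l : p q / p + q}.
Proof.
by case: l => [|l] p q; rewrite /kann ?addr0// gheis1D scalerDr.
Qed.

Lemma kann_small b x q : exists N, forall l, (N <= l)%N -> kann b x l q = 0.
Proof.
have [N HN] := dann_small ip gam (gam x.1) q.
exists (N + x.2).+2 => -[|l]// Nl; rewrite /kann.
have -> : (l - x.2 = (l - x.2).-1.+1)%N by lia.
by rewrite heis1_ann HN ?scaler0//; lia.
Qed.

Lemma lconv_add c K : kadd K -> kadd (lconv c K).
Proof.
move=> KD i l p q; rewrite /lconv -csumD; apply: eq_csum => i1 i2 _.
by rewrite KD mulrDr.
Qed.

Lemma rconv_add f K : (forall l, {morph f l : p q / p + q}) -> kadd K ->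
  kadd (rconv f K).
Proof.
move=> fD KD i l p q; rewrite /rconv -csumD; apply: eq_csum => l1 l2 _.
by rewrite fD KD.
Qed.

Lemma kstep_add b x K : kadd K -> kadd (kstep b x K).
Proof.
move=> KD i l p q; rewrite /kstep (lconv_add (kcre x) KD i l p q).
by rewrite (rconv_add (@kannD b x) KD i l p q) addrACA.
Qed.

Lemma rconv_small b x K q : kadd K -> kbnd K -> exists N N',
  (forall l, (N <= l)%N -> kann b x l q = 0) /\
  (forall i l l', (N' <= l)%N -> K i l (kann b x l' q) = 0).
Proof.
move=> KD KB; have [N HN] := kann_small b x q.
have [N' HN'] : exists N', forall l', l' \in iota 0 N ->
    forall i l, (N' <= l)%N -> K i l (kann b x l' q) = 0.
  apply: unif_bound => [l' M M' MM H i l Ml|l']; first by apply: H; lia.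
  exact: KB.
exists N, N'; split=> // i l l' Nl; have [lN|Nl'] := ltnP l' N.
  by apply: HN' => //; rewrite mem_iota.
by rewrite HN ?kadd0.
Qed.

Lemma kstep_bnd b x K : kadd K -> kbnd K -> kbnd (kstep b x K).
Proof.
move=> KD KB q; have [N0 H0] := KB q.
have [N [N' [HN HN']]] := rconv_small b x q KD KB.
exists (N0 + N + N')%N => i l Nl; rewrite /kstep /lconv /rconv.
rewrite csum_eq0 => [|i1 i2 _]; last by rewrite H0 ?mulr0//; lia.
rewrite csum_eq0 ?addr0// => l1 l2 l12.
have [lN|lN] := leqP N' l1; first by rewrite HN'.
by rewrite HN ?kadd0//; lia.
Qed.

(** Large modes kill a vector: they would need a negative power of z, the powers
of y being bounded on it. *)
Lemma kfield_trunc a (K : L -> kernel) v : (forall b, kadd (K b)) -> (forall b, kbnd (K b)) ->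
  exists M : nat, forall k : int, M%:Z <= k -> kfield a K k v = 0.
Proof.
move=> KD KB.
have [N HN] : exists N, forall b, b \in msupp v ->
    forall k : int, N%:Z <= k -> kdiag (K b) (- k - 1 - ip a b) v@_b = 0.
  apply: unif_bound => [b N N' NN' H k Nk|b].
    by apply: H; lia.
  have [N HN] := KB b v@_b; exists (N + absz (ip a b))%N => k Nk.
  rewrite (kdiagE _ HN) big1// => l _.
  case E : (_ + _) => [m|m] //; have := ltn_ord l; lia.
exists N => k Nk; rewrite /kfield big_seq big1// => b bv.
by rewrite HN// (morphD0 (@gtensorD _ _ _ _ _)).
Qed.

(** Both infinite sums of the normally ordered product become finite on a vector,
the first by [kfield_trunc] and the second because large modes annihilate it;
collecting the coefficients of z^i y^l gives the two summands of [kstep]. *)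
Lemma normal_prod_kfield a (x : 'I_d * nat) (K : L -> kernel) k v :
  (forall b, kadd (K b)) -> (forall b, kbnd (K b)) ->
  gnormal_prod (gdivided_dfield x.2 (gheis ip gam (gam x.1))) (kfield a K) k v =
  kfield a (fun b => kstep b x (K b)) k v.
Proof.
move=> KD KB; pose D := gdivided_dfield x.2 (gheis ip gam (gam x.1)) : int -> VL -> VL.
have D0 n : D n 0 = 0.
  by apply/malgP => c; rewrite /D dheis_coeff mcoeff0 gheis1_0 scaler0.
have F0 n : kfield a K n 0 = 0 by rewrite /kfield msupp0 big_seq_fset0.
have [M HM] := kfield_trunc a v KD KB.
have [N HN] : exists N, forall j : nat, (N <= j)%N -> D j v = 0.
  have [N HN] : exists N, forall b, b \in msupp v ->
      forall l, (N <= l)%N -> kann b x l v@_b = 0.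
    apply: unif_bound => [b N N' NN' H l Nl|b]; first by apply: H; lia.
    exact: kann_small.
  exists N => j Nj; apply/malgP => b; rewrite mcoeff0 dheis_ann.
  have [bv|bv] := boolP (b \in msupp v); first by rewrite HN//; lia.
  by rewrite mcoeff_outdom// (morphD0 (@kannD _ _ _)).
pose M' := (M + absz k)%N.
rewrite /gnormal_prod -/D (@fsum_neg _ M') => [|n Mn]; last first.
  by rewrite HM ?D0//; lia.
rewrite (@fsum_pos _ N) => [|n Nn]; last by rewrite HN.
apply/malgP => c; rewrite mcoeffD.
rewrite [X in X + _ = _]raddf_sum [X in _ + X = _]raddf_sum.
rewrite mcoeff_kfield => [|b]; last exact: kstep_add.
set b := c - a; set q := v@_b; set t := - k - 1 - ip a b.
have [N0 H0] := KB b q.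
have [A [B [HA HB]]] := rconv_small b x q (KD b) (KB b).
have [N1 H1] := kstep_bnd b x (KD b) (KB b) q.
pose N2 := (N0 + N1 + A + B + N).+1.
rewrite (@kdiagE _ N2); last by move=> i l Nl; apply: H1; lia.
have -> : \sum_(l < N2) kext (kstep b x (K b)) (t + l%:Z) l q =
  \sum_(l < N2) kext (lconv (kcre x) (K b)) (t + l%:Z) l q +
  \sum_(l < N2) kext (rconv (kann b x) (K b)) (t + l%:Z) l q.
  rewrite -big_split; apply: eq_bigr => l _ /=.
  by case: (_ + _) => n //=; rewrite addr0.
congr (_ + _).
  pose g i := kcre x i * kdiag (K b) (t - i%:Z) q.
  have gE i : (D (Negz i) (kfield a K (k - Negz i - 1) v))@_c = g i.
    rewrite dheis_cre mcoeff_kfield// /g -/b -/q; congr (_ * kdiag _ _ _).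
    by rewrite /t NegzE; lia.
  (* The new bound exceeds all powers of z that occur, and the terms added are
     zero as whole diagonal sums, though not summand by summand. *)
  transitivity (\sum_(i < M' + absz t + N2) g i).
    rewrite (@sum_ord_widen _ M' _ g) => [||i Mi]; last 2 first.
    - by lia.
    - by rewrite -gE HM ?D0 ?mcoeff0//; lia.
    by apply: eq_bigr => i _; exact: gE.
  rewrite (eq_bigr (fun i : 'I_(M' + absz t + N2) => \sum_(l < N2)
    kcre x i * kext (K b) (t - i%:Z + l%:Z) l q)); last first.
    move=> i _; rewrite /g (@kdiagE _ N2) ?mulr_sumr// => i' l Nl.
    by apply: H0; lia.
  rewrite exchange_big; apply: eq_bigr => l _ /=.
  have lN := ltn_ord l.
  case E : (t + l%:Z) => [m|m] /=; last first.
    rewrite big1// => i _.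
    case E' : (_ + _) => [m'|m'] /=; last by rewrite mulr0.
    by move: E E'; lia.
  rewrite /lconv /csum.
  rewrite (@sum_ord_widen _ m.+1 _
    (fun i => kcre x i * kext (K b) (t - i%:Z + l%:Z) l q)); last 2 first.
  - by move: E; lia.
  - move=> i mi; case E' : (_ + _) => [m'|m'] /=; last by rewrite mulr0.
    by move: E E'; lia.
  apply: eq_bigr => i _; have im := ltn_ord i; congr (_ * _).
  have -> : t - i%:Z + l%:Z = (m - i)%N%:Z by move: E; lia.
  by [].
(* l1 counts the powers of y in K and l2 those of the annihilation part. *)
pose F l1 l2 := kext (K b) (t + (l1 + l2)%N%:Z) l1 (kann b x l2 q).
transitivity (\sum_(l < N2) csum l F); last first.
  apply: eq_bigr => l _; rewrite /rconv /F.
  case E : (t + l%:Z) => [m|m] /=.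
    by apply: eq_csum => l1 l2 l12; rewrite l12 E.
  by apply: csum_eq0 => l1 l2 l12; rewrite l12 E.
rewrite (@csum_box _ _ (maxn A N).+1 B) => [|l1 l2 Bl|l1 l2 Al|]; last 3 first.
- by rewrite /F; case: (_ + _) => //= m; apply: HB.
- rewrite /F HA; last by lia.
  by case: (_ + _) => //= m; exact: kadd0.
- by lia.
rewrite big_ord_recl [X in X + _]big1 ?add0r => [|i _]; last first.
  by rewrite /F /kann; case: (_ + _) => //= m; exact: kadd0.
have E (j : nat) : (kfield a K (k - j%:Z - 1) (D j v))@_c =
    \sum_(l < B) F l j.+1.
  rewrite mcoeff_kfield// -/b dheis_ann -/q (@kdiagE _ B) => [|i l Bl]; last first.
    exact: HB.
  apply: eq_bigr => l _; rewrite /F; congr (kext _ _ _ _).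
  by rewrite /t; lia.
transitivity (\sum_(i < maxn A N) \sum_(l < B) F l i.+1); last first.
  by apply: eq_bigr => i _; apply: eq_bigr => l _; rewrite lift0.
rewrite (@sum_ord_widen _ N _ (fun j => \sum_(l < B) F l j.+1)); last 2 first.
- exact: leq_maxr.
- by move=> j Nj; rewrite -E HN// F0 mcoeff0.
by apply: eq_bigr => i _; exact: E.
Qed.

End Kernels.

Section KernelAlgebra.
Variables (C : numFieldType) (L : zmodType) (d : nat) (M1 : fock C d).
Variables (ip : L -> L -> int) (gam : 'I_d -> L) (eps : L -> L -> int).
Hypothesis hip : is_posdef_even_form ip.
Hypothesis hgam : is_lattice_basis gam.
Local Notation VL := {malg M1[L]}.
Local Notation kernel := (nat -> nat -> M1 -> M1).
Implicit Types (a b : L) (p q : M1) (K : kernel) (v : VL).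
Implicit Types (c : nat -> M1) (f : nat -> M1 -> M1).
Local Notation s := (gschur M1 ip gam).
Local Notation e := (@gexp_annih C L d M1 ip gam).
Local Notation Sc := (@schur_ring C L d M1 ip gam).
Local Notation kint := (@kint C L d M1 ip gam).
Local Notation kann := (@kann C L d M1 ip gam).
Local Notation kstep := (@kstep C L d M1 ip gam).
Local Notation kexp := (@kexp C L d M1 ip gam eps).

Lemma kernelP K K' : (forall i l q, K i l q = K' i l q) -> K = K'.
Proof. by move=> H; do 3!apply/funext => ?; exact: H. Qed.

Lemma kcsumE n (F : nat -> nat -> kernel) i l q :
  csum n F i l q = csum n (fun k m => F k m i l q).
Proof.
elim: n F => [|n IHn] F; first by rewrite !csum0.
by rewrite csumSl [RHS]csumSl -(IHn (fun k m => F k.+1 m)).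
Qed.

Lemma kMnE K n i l q : (K *+ n) i l q = K i l q *+ n.
Proof. by elim: n => [|n IHn]; rewrite ?mulr0n// !mulrS -IHn. Qed.

Lemma lconvD c : {morph (lconv c : kernel -> kernel) : K K' / K + K'}.
Proof.
move=> K K'; apply: kernelP => i l q.
transitivity (lconv c K i l q + lconv c K' i l q); last by [].
rewrite /lconv -csumD; apply: eq_csum => i1 i2 _.
by rewrite -mulrDr.
Qed.

Lemma rconvD f : {morph (rconv f : kernel -> kernel) : K K' / K + K'}.
Proof.
move=> K K'; apply: kernelP => i l q.
transitivity (rconv f K i l q + rconv f K' i l q); last by [].
by rewrite /rconv -csumD; apply: eq_csum => l1 l2 _.
Qed.

Lemma kstepE b x K : kstep b x K = lconv (kcre M1 x) K + rconv (kann b x) K.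
Proof. by []. Qed.

Lemma kstepD b x : {morph kstep b x : K K' / K + K'}.
Proof. by move=> K K'; rewrite !kstepE lconvD rconvD addrACA. Qed.

Lemma lconvMn c K n : lconv c K *+ n = lconv (fun i => c i *+ n) K.
Proof.
apply: kernelP => i l q; rewrite kMnE /lconv -csumMn; apply: eq_csum => i1 i2 _.
by rewrite mulrnAl.
Qed.

Lemma rconvMn f K n : kadd K -> rconv f K *+ n = rconv (fun l q => f l q *+ n) K.
Proof.
move=> KD; apply: kernelP => i l q; rewrite kMnE /rconv -csumMn.
by apply: eq_csum => l1 l2 _; rewrite (morphDMn _ _ (KD _ _)).
Qed.

Lemma lconv_csum n (cc : nat -> nat -> nat -> M1) K :
  lconv (fun i => csum n (fun k m => cc k m i)) K =
  csum n (fun k m => lconv (cc k m) K).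
Proof.
apply: kernelP => i l q; rewrite kcsumE /lconv csum_exchange.
by apply: eq_csum => i1 i2 _; rewrite /csum mulr_suml.
Qed.

Lemma rconv_csum n (ff : nat -> nat -> nat -> M1 -> M1) K : kadd K ->
  rconv (fun l q => csum n (fun k m => ff k m l q)) K =
  csum n (fun k m => rconv (ff k m) K).
Proof.
move=> KD; apply: kernelP => i l q; rewrite kcsumE /rconv csum_exchange.
by apply: eq_csum => l1 l2 _; rewrite (morphD_csum _ _ (KD _ _)).
Qed.

Lemma lconvA c c' K :
  lconv c (lconv c' K) = lconv (fun i => csum i (fun j k => c j * c' k)) K.
Proof.
apply: kernelP => i l q; rewrite /lconv.
under [RHS]eq_csum do rewrite /csum mulr_suml.
rewrite -/(csum _ _) [RHS](csumA i (fun j k m => c j * c' k * K m l q)).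
apply: eq_csum => j k _; rewrite /csum mulr_sumr.
by apply: eq_bigr => m _; rewrite mulrA.
Qed.

Lemma rconvA f f' K : kadd K ->
  rconv f (rconv f' K) = rconv (fun l q => csum l (fun j k => f' j (f k q))) K.
Proof.
move=> KD; apply: kernelP => i l q; rewrite /rconv.
rewrite (csumA l (fun l1 l2 l3 => K i l1 (f' l2 (f l3 q)))).
by apply: eq_csum => l1 l2 _; rewrite (morphD_csum _ _ (KD _ _)).
Qed.

Lemma lrconvC c f K : lconv c (rconv f K) = rconv f (lconv c K).
Proof.
apply: kernelP => i l q; rewrite /lconv /rconv.
under eq_csum do rewrite /csum mulr_sumr.
exact: csum_exchange.
Qed.

Lemma lconvC c c' K : lconv c (lconv c' K) = lconv c' (lconv c K).
Proof.
rewrite !lconvA; congr lconv; apply/funext => i; rewrite csumC.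
by apply: eq_csum => j k _; rewrite mulrC.
Qed.

Lemma gheis1C a a' b (m n : nat) q :
  gheis1 ip gam a b m (gheis1 ip gam a' b n q) =
  gheis1 ip gam a' b n (gheis1 ip gam a b m q).
Proof.
case: m n => [|m] [|n]; rewrite ?heis1_ann /gheis1.
- by rewrite !scalerA mulrC.
- by rewrite -/(dann _ _ _ _ _) dannZ.
- by rewrite -!/(dann _ _ _ _ _) dannZ.
by rewrite dannC.
Qed.

Lemma kannC b x y l m q : kann b x l (kann b y m q) = kann b y m (kann b x l q).
Proof.
case: l m => [|l] [|m]; rewrite /kann ?gheis1_0 ?scaler0//.
by rewrite !gheis1Z gheis1C !scalerA mulrC.
Qed.

Lemma rconvC b x y K :
  rconv (kann b x) (rconv (kann b y) K) = rconv (kann b y) (rconv (kann b x) K).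
Proof.
apply: kernelP => i l q; rewrite /rconv csumAC.
by apply: eq_csum => l1 l2 _; apply: eq_csum => l3 l4 _; rewrite kannC.
Qed.

Lemma kstepC b x y K : kstep b x (kstep b y K) = kstep b y (kstep b x K).
Proof.
rewrite !kstepE !lconvD !rconvD lconvC rconvC !lrconvC !addrA.
by congr (_ + _); rewrite -!addrA [X in _ + X]addrC.
Qed.

(** * Kernels of the vertex operators *)

Lemma gY_exp_kfield a k v : gY_exp ip gam eps a k v = kfield ip a (kexp a) k v.
Proof.
apply: eq_bigr => b _; congr gtensor; apply: eq_fsbigl.
by apply/seteqP; split => x /= H; lia.
Qed.

Lemma kexp_add a b : kadd (kexp a b).
Proof. by move=> i l p q; rewrite /kexp annihD mulrDr scalerDr. Qed.

Lemma kexp_bnd a b : kbnd (kexp a b).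
Proof.
move=> q; have [N HN] := annih_small ip gam a q.
by exists N => i l Nl; rewrite /kexp HN// mulr0 scaler0.
Qed.

Definition kword a b (w : seq ('I_d * nat)) : kernel :=
  foldr (kstep b) (kexp a b) w.

Lemma kword_add a b w : kadd (kword a b w).
Proof. by elim: w => [|x w IHw]; [exact: kexp_add|exact: kstep_add]. Qed.

Lemma kword_bnd a b w : kbnd (kword a b w).
Proof.
elim: w => [|x w IHw]; first exact: kexp_bnd.
by apply: kstep_bnd => //; exact: kword_add.
Qed.

Lemma gY_word_kfield a w k v :
  gY_word ip gam eps a w k v = kfield ip a (fun b => kword a b w) k v.
Proof.
elim: w k v => [|x w IHw] k v; first exact: gY_exp_kfield.
rewrite /gY_word /= -/(gY_word _ _ _ _ _).
have -> : gY_word ip gam eps a w = kfield ip a (fun b => kword a b w).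
  by do 2!apply/funext => ?; exact: IHw.
by apply: normal_prod_kfield => // b; [exact: kword_add|exact: kword_bnd].
Qed.

Lemma kword_perm a b w w' : perm_eq w w' -> kword a b w = kword a b w'.
Proof.
have cat_cons x u u' : kword a b (u ++ x :: u') = kword a b (x :: u ++ u').
  elim: u => [//|y u IHu].
  have -> : kword a b ((y :: u) ++ x :: u') = kstep b y (kword a b (u ++ x :: u')).
    by [].
  by rewrite IHu /= kstepC.
elim: w w' => [|x w IHw] w' ww'.
  by move: ww'; rewrite perm_sym => /perm_nilP ->.
have xw' : x \in w' by rewrite -(perm_mem ww') mem_head.
case/splitPr: xw' ww' => u u' ww'; rewrite cat_cons /= (IHw (u ++ u'))//.
by rewrite -(perm_cons x) (perm_trans ww')// perm_catC /= perm_cons perm_catC.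
Qed.

(** * The translated exponentials *)

(** [divided_cre] and [divided_ann] are the coefficients of w^n in E(z+w) and in
z^(-c) F(z+w), where F(z) = z^c exp(- sum_n gamma(n) z^(-n) / n), c = (gamma,b). *)
Definition divided_cre (t : 'I_d) n i : M1 := 'C(n + i, n)%:R * s (gam t) (n + i).

Definition divided_ann (t : 'I_d) b n l q : M1 :=
  if (l < n)%N then 0 else
  gbin ((ip (gam t) b)%:~R - (l - n)%:R) n *: e (gam t) (l - n) q.

(** d/dw E(z+w) = g(z+w) E(z+w) with g = E'/E the creation part of gamma(z). *)
Lemma divided_cre_rec t n i : divided_cre t n.+1 i *+ n.+1 =
  csum n (fun k m => csum i (fun j j' => kcre M1 (t, k) j * divided_cre t m j')).
Proof.
pose G h u := acre M1 gam (gam t) h * s (gam t) u.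
transitivity (csum n (fun k m => csum i (fun j j' =>
     ('C(j + k, k) * 'C(m + j', m))%:R * G (j + k)%N (m + j')%N))).
  rewrite csum_Vandermonde -/G -schur_rec// /divided_cre addSn.
  rewrite -[LHS]mulr_natl mulrA -natrM -[X in _ = _ * X]mulr_natl mulrA -natrM.
  by rewrite -mul_bin_diag /= mulnC.
apply: eq_csum => k m _; apply: eq_csum => j j' _.
by rewrite /kcre /divided_cre /G acre_gam//= natrM mulrACA.
Qed.

(** z F'(z) = (z times the annihilation part of gamma(z)) F(z). *)
Lemma annih_modes a b M q :
  csum M (fun m h => e a m (gheis1 ip gam a b h q)) =
  ((ip a b)%:~R - M%:R) *: e a M q.
Proof.
case: M => [|M]; first by rewrite csum0 !annih0n subr0.
rewrite csumSr scalerBl scaler_nat annih_rec// addrC annihZ; congr (_ + _).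
rewrite csumC -[RHS]sumrN; apply: eq_bigr => k _.
by rewrite opprK heis1_ann annih_dannC.
Qed.

(** d/dw F(z+w) = h(z+w) F(z+w) with h the annihilation part of gamma(z): Taylor
coefficients multiply by Vandermonde's identity for integers of either sign. *)
Lemma divided_ann_rec t b n l q : divided_ann t b n.+1 l q *+ n.+1 =
  csum n (fun k m => csum l (fun l1 l2 => divided_ann t b m l1 (kann b (t, k) l2 q))).
Proof.
set g := gam t; pose c : C := (ip g b)%:~R.
pose F k m l1 l2 := divided_ann t b m l1 (kann b (t, k) l2 q).
have Fm k m l1 l2 : (l1 < m)%N -> F k m l1 l2 = 0.
  by move=> lm; rewrite /F /divided_ann lm.
have Fk k m l1 l2 : (l2 < k.+1)%N -> F k m l1 l2 = 0.
  move=> lk; rewrite /F; suff -> : kann b (t, k) l2 q = 0.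
    rewrite /divided_ann (morphD0 (@annihD _ _ _ _ _ _ _ _)) scaler0.
    by case: ifP.
  by case: l2 lk => // l2 lk; rewrite /kann /= bin_small ?mulr0 ?scale0r.
rewrite {1}/divided_ann; case: ltnP => ln.
  rewrite mul0rn csum_eq0// => k m km.
  by apply: (@csum_small2 _ l m k.+1 (F k m)); [exact: Fm|exact: Fk|lia].
set M := (l - n.+1)%N.
transitivity (csum M (fun u h => gbin (c - M%:R - 1) n *:
    e g u (gheis1 ip gam g b h q))).
  rewrite -(morphD_csum _ _ (@scalerDr _ _ _)) annih_modes scalerA.
  rewrite scalerMnl; congr (_ *: _).
  by rewrite -{1}(subrK 1 (c - M%:R)) gbin_succ subrK mulrC.
transitivity (csum n (fun k m => csum M (fun u h =>
    (gbin (- (h%:R + 1)) k * gbin (c - u%:R) m) *: e g u (gheis1 ip gam g b h q)))).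
  rewrite csum_exchange; apply: eq_csum => u h uh.
  rewrite /csum -scaler_suml; congr (_ *: _).
  rewrite -/(csum n (fun k m => gbin (- (h%:R + 1)) k * gbin (c - u%:R) m)).
  by rewrite gbinD; congr gbin; rewrite -uh natrD; ring.
apply: eq_csum => k m km.
have -> : l = (M + m + k.+1)%N by rewrite /M; lia.
apply/esym; apply: csum_shift2 => [||u h]; [exact: Fm|exact: Fk|].
rewrite /F /divided_ann ifF; last by lia.
rewrite addnK addnS /kann /= addnK annihZ scalerA -/g -/c; congr (_ *: _).
rewrite mulrC gbinN -gbin_nat; congr (_ * gbin _ _ * _).
by rewrite natrD; ring.
Qed.

(** The coefficient of w^n in E(z+w) K F(z+w). *)
Definition translate (t : 'I_d) b K n : kernel :=
  csum n (fun i j => lconv (divided_cre t i) (rconv (divided_ann t b j) K)).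

Lemma translate0 t b K : kadd K ->
  translate t b (lconv (s (- gam t)) (rconv (e (- gam t)) K)) 0 = K.
Proof.
move=> KD; rewrite /translate csum0 -(lrconvC (s (- gam t))).
have -> : divided_cre t 0 = s (gam t).
  by apply/funext => i; rewrite /divided_cre add0n bin0 mul1r.
have -> : divided_ann t b 0 = e (gam t).
  by do 2!apply/funext => ?; rewrite /divided_ann ltn0 subn0 gbin0 scale1r.
rewrite lconvA rconvA//; apply: kernelP => i l q.
rewrite /lconv (@csum_pick _ i 0%N) => [|i1 i2 _ i10]; last first.
  by rewrite -schurD// addrN schur_0// (negPf i10) mul0r.
rewrite leq0n -schurD// addrN schur_0// mul1r subn0 /rconv csumC.
rewrite (@csum_pick _ l 0%N) => [|l1 l2 _ l10]; last first.
  by rewrite -annihDl// addNr annih_0//; case: l1 l10 => // l1 _; exact: kadd0.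
by rewrite leq0n subn0 -annihDl// addNr annih_0.
Qed.

(** Left and right multiplications commute, so the two differential equations
add up. *)
Lemma translate_rec t b K n : kadd K ->
  translate t b K n.+1 *+ n.+1 =
  csum n (fun k m => kstep b (t, k) (translate t b K m)).
Proof.
move=> KD; rewrite /translate (@csum_rec _ _ _
  (fun k i j => lconv (kcre M1 (t, k)) (lconv (divided_cre t i) (rconv (divided_ann t b j) K)))
  (fun k i j => rconv (kann b (t, k)) (lconv (divided_cre t i) (rconv (divided_ann t b j) K)))).
- apply: eq_csum => k m _; rewrite (morphD_csum _ _ (@kstepD _ _)).
  by apply: eq_csum.
- move=> i j; rewrite lconvMn.
  transitivity (lconv (fun l => csum i (fun k m => csum l (fun j j' =>
      kcre M1 (t, k) j * divided_cre t m j'))) (rconv (divided_ann t b j) K)).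
    by congr lconv; apply/funext => l; exact: divided_cre_rec.
  by rewrite lconv_csum; apply: eq_csum => k m _; rewrite lconvA.
move=> i j; rewrite -(morphDMn _ _ (@lconvD _)) rconvMn//.
transitivity (lconv (divided_cre t i) (rconv (fun l q => csum j (fun k m =>
    csum l (fun l1 l2 => divided_ann t b m l1 (kann b (t, k) l2 q)))) K)).
  apply: (congr1 (fun f => lconv (divided_cre t i) (rconv f K))).
  apply/funext => l; apply/funext => q.
  exact: divided_ann_rec.
rewrite rconv_csum// (morphD_csum _ _ (@lconvD _)); apply: eq_csum => k m _.
by rewrite -lrconvC rconvA.
Qed.

Lemma lconv_int c K : (forall i, Sc (c i)) -> kint K -> kint (lconv c K).
Proof.
move=> Scc KI i l q Sq; apply: zspan_csum => i1 i2.
by apply: schur_ringM => //; exact: KI.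
Qed.

Lemma rconv_int f K : (forall l q, Sc q -> Sc (f l q)) -> kint K ->
  kint (rconv f K).
Proof.
by move=> Scf KI i l q Sq; apply: zspan_csum => l1 l2; apply/KI/Scf.
Qed.

Lemma translate_int t b K n : kint K -> kint (translate t b K n).
Proof.
move=> KI i l q Sq; rewrite /translate kcsumE; apply: zspan_csum => k m.
apply: lconv_int Sq => [j|].
  rewrite /divided_cre mulr_natl -scaler_nat; apply: schur_ringZ.
    by exists 'C(k + j, k)%:Z; rewrite pmulrn.
  exact: schur_ring_schur.
apply: rconv_int KI => j p Sp; rewrite /divided_ann; case: ifP => _.
  exact: schur_ring0.
apply: schur_ringZ; last exact: schur_ring_annih.
have [z zE] := gbin_int C (ip (gam t) b - (j - m)%:Z) m.
by exists z; rewrite -zE rmorphB.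
Qed.

Lemma kexp_int a b : kint (kexp a b).
Proof.
move=> i l q Sq; apply: schur_ringZ; first by exists (eps a b).
by apply: schur_ringM; [exact: schur_ring_schur|exact: schur_ring_annih].
Qed.

(** The map [KK] sends a polynomial to its vertex operator.  The kernels attached to
the s_(gamma,n) p satisfy the recursion of [translate_rec], so they are obtained
from that of [p] by multiplication with integral series on both sides. *)
Lemma kint_schur_ring a b (KK : M1 -> kernel) :
  {morph KK : p q / p + q} -> (forall p, kadd (KK p)) ->
  KK 1 = kexp a b ->
  (forall i n p, KK (ghvar M1 i n * p) = kstep b (i, n) (KK p)) ->
  forall p, Sc p -> kint (KK p).
Proof.
move=> KKD KKadd KK1 KKvar; apply: schur_ring_ind.
- by rewrite (morphD0 KKD) => i l q _; exact: schur_ring0.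
- move=> p q Ip Iq i l u Su.
  have -> : KK (p - q) = KK p - KK q.
    by apply: (addIr (KK q)); rewrite -KKD !subrK.
  by apply: schur_ringB; [exact: Ip|exact: Iq].
- by rewrite KK1; exact: kexp_int.
move=> t n p _ Ip.
(* E(z)^(-1) is the series attached to -gamma. *)
pose W := lconv (s (- gam t)) (rconv (e (- gam t)) (KK p)).
suff -> : KK (s (gam t) n * p) = translate t b W n.
  apply: translate_int; apply: lconv_int => [i|]; first exact: schur_ring_schur.
  by apply: rconv_int => // l q; exact: schur_ring_annih.
apply: (csum_unique (C := C) (V := kernel) (X := fun n => KK (s (gam t) n * p))
  (Y := translate t b W) (T := fun k => kstep b (t, k))) => [|{}n|{}n].
- by rewrite schur0n mul1r /W translate0.
- rewrite -(morphDMn _ _ KKD) -mulrnAl schur_rec// /csum mulr_suml.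
  rewrite (morphD_sum _ _ _ KKD); apply: eq_bigr => k _.
  by rewrite acre_gam// -mulrA KKvar.
apply: translate_rec; apply: lconv_add; apply: rconv_add => //.
by move=> l; exact: annihD.
Qed.

Lemma kdiag_int K t q : kint K -> kbnd K -> Sc q -> Sc (kdiag K t q).
Proof.
move=> KI KB Sq; have [N HN] := KB q; rewrite (kdiagE _ HN).
apply: zspan_sum => l _; case: (_ + _) => n /=; last exact: schur_ring0.
exact: KI.
Qed.

End KernelAlgebra.

(** * Integrality of the form *)

Section Form.
Variables (C : numFieldType) (L : zmodType) (d : nat) (M1 : fock C d).
Variables (ip : L -> L -> int) (gam : 'I_d -> L).
Hypothesis hip : is_posdef_even_form ip.
Hypothesis hgam : is_lattice_basis gam.
Local Notation VL := {malg M1[L]}.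
Implicit Types (a b : L) (p q : M1) (u v : VL).
Local Notation s := (gschur M1 ip gam).
Local Notation e := (@gexp_annih C L d M1 ip gam).
Local Notation Sc := (@schur_ring C L d M1 ip gam).

Lemma gheis_gtensor a b n p :
  gheis ip gam a n (gtensor p b) = gtensor (gheis1 ip gam a b n p) b.
Proof.
apply/malgP => c; rewrite mcoeff_gheis !mcoeff_gtensor.
by case: eqP => [->//|_]; exact: gheis1_0.
Qed.

Variable B : VL -> VL -> C.
Hypothesis BDl : forall v, {morph (B^~ v) : u u' / u + u'}.
Hypothesis Bsym : forall u v, B u v = B v u.
Hypothesis Bexp : forall a b, B (gtensor 1 a) (gtensor 1 b) = (a == - b)%:R.
Hypothesis Bheis : forall a n u v,
  B (gheis ip gam a n u) v = - B u (gheis ip gam a (- n) v).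

Let BDr u : {morph (B u) : v v' / v + v'}.
Proof. by move=> v v'; rewrite ![B u _]Bsym BDl. Qed.

Let BtDl a v : {morph (fun p => B (gtensor p a) v) : p q / p + q}.
Proof. by move=> p q; rewrite gtensorD BDl. Qed.

Let BtDr u b : {morph (fun q => B u (gtensor q b)) : p q / p + q}.
Proof. by move=> p q; rewrite gtensorD BDr. Qed.

(** The adjoint of gamma(-k-1) is -gamma(k+1), so both sides satisfy the same
recursion in n. *)
Lemma schur_adjoint g n p q a b :
  B (gtensor (s g n * p) a) (gtensor q b) =
  B (gtensor p a) (gtensor (e g n q) b).
Proof.
elim/ltn_ind: n p q => -[|n] IHn p q; first by rewrite schur0n mul1r annih0n.
apply: (@mulrnI_num C n).
rewrite -(morphDMn _ _ (@BtDl a _)) -(morphDMn _ _ (@BtDr _ b)).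
rewrite -mulrnAl schur_rec// annih_rec// csumC [in RHS]csumC /csum mulr_suml.
rewrite (morphD_sum _ _ _ (@BtDl a _)) (morphD_sum _ _ _ (@BtDr _ b)).
apply: eq_bigr => i _; have im := ltn_ord i.
rewrite -mulrA -(heis1_cre ip gam g a) -gheis_gtensor Bheis NegzE opprK.
rewrite gheis_gtensor heis1_ann IHn// -annih_dannC//.
by rewrite gtensorN (morphDN _ (@BDr _)).
Qed.

Definition is_int (c : C) := exists z : int, c = z%:~R.

Lemma is_intB x y : is_int x -> is_int y -> is_int (x - y).
Proof. by move=> [m ->] [n ->]; exists (m - n); rewrite rmorphB. Qed.

(** Moving the Schur polynomials of [p] to the right and then those of the right
entry to the left leaves a value of the form on two exponentials. *)
Lemma form_int_gtensor a b p q : Sc p -> Sc q ->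
  is_int (B (gtensor p a) (gtensor q b)).
Proof.
have B0l b' v : B (gtensor 0 b') v = 0 by exact: (morphD0 (@BtDl b' v)).
have B0r b' u : B u (gtensor 0 b') = 0 by exact: (morphD0 (@BtDr u b')).
have is_int0 : is_int 0 by exists 0.
have base a' b' q' : Sc q' -> is_int (B (gtensor q' b') (gtensor 1 a')).
  move: q'; apply: schur_ring_ind.
  - by rewrite B0l.
  - move=> x y Ix Iy; rewrite gtensorD BDl gtensorN (morphDN _ (@BDl _)).
    exact: is_intB.
  - by rewrite Bexp; exists (b' == - a')%:R; case: eqP.
  move=> i n x _ Ix; rewrite schur_adjoint annih_1.
  by case: eqP => _ //=; rewrite B0r.
move=> Sp; move: p Sp q; apply: schur_ring_ind.
- by move=> q _; rewrite B0l.
- move=> x y Ix Iy q Sq; rewrite gtensorD BDl gtensorN (morphDN _ (@BDl _)).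
  by apply: is_intB; [exact: Ix|exact: Iy].
- by move=> q Sq; rewrite Bsym; exact: base.
move=> i n x _ Ix q Sq; rewrite schur_adjoint; apply: Ix.
exact: schur_ring_annih.
Qed.

Lemma form_int u v : gVL_Z ip gam u -> gVL_Z ip gam v -> is_int (B u v).
Proof.
move=> /(gVL_ZP ip gam _) Su /(gVL_ZP ip gam _) Sv.
have is_intD x y : is_int x -> is_int y -> is_int (x + y).
  by move=> [m ->] [n ->]; exists (m + n); rewrite rmorphD.
rewrite (gtensorE u) (gtensorE v) (morphD_sum _ _ _ (@BDl _)).
apply: (big_ind is_int) => // [|a _]; first by exists 0.
rewrite (morphD_sum _ _ _ (@BDr _)).
apply: (big_ind is_int) => // [|b _]; first by exists 0.
exact: form_int_gtensor.
Qed.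

End Form.

(** * Generation by exponentials *)

Section Generation.
Variables (C : numFieldType) (L : zmodType) (d : nat) (M1 : fock C d).
Variables (ip : L -> L -> int) (gam : 'I_d -> L) (eps : L -> L -> int).
Hypothesis hip : is_posdef_even_form ip.
Hypothesis hgam : is_lattice_basis gam.
Hypothesis heps : forall a b, eps a b = 1 \/ eps a b = -1.
Local Notation VL := {malg M1[L]}.
Implicit Types (a b : L) (p q : M1) (u v : VL).
Local Notation s := (gschur M1 ip gam).
Local Notation e := (@gexp_annih C L d M1 ip gam).
Local Notation Sc := (@schur_ring C L d M1 ip gam).
Local Notation sprod := (@schur_prod C L d M1 ip gam).

Definition word_weight (w : seq ('I_d * nat)) : nat := (\sum_(x <- w) x.2)%N.

(** By [annihM] and [annih_schur], each factor s_(gamma,n) turns into a multiple of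
some s_(gamma,n-j), and the indices j add up to m. *)
Lemma annih_schur_prod a m w :
  zspan [set sprod w' | w' in [set w' | (word_weight w' + m)%N = word_weight w]]
    (e a m (sprod w)).
Proof.
elim: w m => [|x w IHw] m.
  rewrite /schur_prod big_nil annih_1; case: eqP => [->|_]; last exact: zspan0.
  by apply: zspan_gen; exists [::]; rewrite /= ?addn0// /schur_prod big_nil.
rewrite /schur_prod big_cons annihM//.
rewrite /csum; apply: zspan_sum => i _; set j := (m - i)%N.
have ij : (i + j)%N = m by have := ltn_ord i; rewrite /j; lia.
rewrite annih_schur//; case: leqP => ix; last by rewrite mul0r; exact: zspan0.
have [z zE] := gbin_int C (ip a (gam x.1)) i.
have -> : (-1) ^+ i * gbin ((ip a (gam x.1))%:~R) i = ((-1) ^+ i * z)%:~R :> C.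
  by rewrite intrM rmorphXn /= rmorphN1 zE.
rewrite -scalerAl scaler_int; apply: zspanMz.
move: (e a j _) (IHw j); apply: zspan_ind => [|p q Sp Sq|_ [w' /= ww' <-]].
- by rewrite mulr0; exact: zspan0.
- by rewrite mulrBr; exact: zspanB.
apply: zspan_gen; exists ((x.1, (x.2 - i)%N) :: w'); last first.
  by rewrite /schur_prod big_cons.
rewrite /= /word_weight !big_cons /=.
by move: ww'; rewrite /word_weight; lia.
Qed.

Variable S : set VL.
Hypothesis S0 : S 0.
Hypothesis SB : forall u v, S u -> S v -> S (u - v).
Hypothesis Svac : S (gtensor 1 0).
Hypothesis SY : forall a k v, S (gtensor 1 a) -> S v -> S (gY_exp ip gam eps a k v).
Hypothesis Sgam : forall i, S (gtensor 1 (gam i)) /\ S (gtensor 1 (- gam i)).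

Let SN u : S u -> S (- u).
Proof. by move=> Su; rewrite -sub0r; exact: SB. Qed.

Let SD u v : S u -> S v -> S (u + v).
Proof. by move=> Su Sv; rewrite -[v]opprK; apply: SB => //; exact: SN. Qed.

Lemma zspan_gtensor (X : set M1) (f : M1 -> M1) b p :
  {morph f : p q / p - q} ->
  (forall q, X q -> S (gtensor (f q) b)) -> zspan X p -> S (gtensor (f p) b).
Proof.
move=> fB XS; move: p; apply: zspan_ind => // [|p q Sp Sq].
  by rewrite -(subrr 0) fB subrr (morphD0 (gtensorD b)).
by rewrite fB gtensorD gtensorN; exact: SB.
Qed.

Lemma gY_exp_gtensor a b t q :
  gY_exp ip gam eps a (- t - 1 - ip a b) (gtensor q b) =
  gtensor (kdiag (kexp ip gam eps a b) t q) (a + b).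
Proof.
apply/malgP => c; rewrite gY_exp_kfield mcoeff_kfield => [|b']; last first.
  exact: kexp_add.
rewrite !mcoeff_gtensor; have [<-|abc] := eqVneq (a + b) c.
  by rewrite {1 2 3}(addrC a) addrK eqxx; congr kdiag; lia.
rewrite ifF; first by rewrite kdiag0//; exact: kexp_add.
by apply: contraNF abc => /eqP ->; rewrite addrC subrK.
Qed.

Lemma gen_gY_exp a b (n : nat) q : S (gtensor 1 a) -> S (gtensor q b) ->
  exists N, (forall l, (N <= l)%N -> e a l q = 0) /\
  S (gtensor (\sum_(l < N) s a (n + l) * e a l q) (a + b)).
Proof.
move=> Sa Sq; have [N HN] := annih_small ip gam a q; exists N; split=> //.
have := SY (- n%:Z - 1 - ip a b) Sa Sq; rewrite gY_exp_gtensor.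
rewrite (@kdiagE _ _ _ _ N) => [|i l Nl]; last first.
  by rewrite /kexp HN// mulr0 scaler0.
have -> : \sum_(l < N) kext (kexp ip gam eps a b) (n%:Z + l%:Z) l q =
    (eps a b)%:~R *: \sum_(l < N) s a (n + l) * e a l q.
  by rewrite scaler_sumr; apply: eq_bigr.
case: (heps a b) => ->; first by rewrite scale1r.
by rewrite scaleN1r gtensorN => /SN; rewrite opprK.
Qed.

(** The leading coefficient of Y(e^a,z) e^b is e^(a+b) up to sign. *)
Lemma gen_exp a : S (gtensor 1 a).
Proof.
pose P a := S (gtensor 1 a).
have PD x y : P x -> P y -> P (x + y).
  move=> Px Py; have [N [HN]] := gen_gY_exp 0 Px Py.
  case: N HN => [HN|N HN].
    have := HN 0%N isT; rewrite annih0n => /esym/eqP.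
    by rewrite eq_sym oner_eq0.
  rewrite big_ord_recl schur0n annih0n mul1r big1 ?addr0// => i _.
  by rewrite lift0 annih_1 mulr0.
have PMn x k : P x -> P (x *+ k).
  by move=> Px; elim: k => [|k IHk]; rewrite ?mulr0n// mulrS; exact: PD.
rewrite (lcoordP hgam a) -/(P _); apply: (big_ind P) => // i _.
have [Pg PNg] := Sgam i.
case: (Defs.coord gam a i) => k; first exact: PMn.
by rewrite NegzE mulrNz -pmulrn -mulNrn; exact: PMn.
Qed.

(** The term l = 0 of the sum of [gen_gY_exp] is the wanted vector, and in the
others the weight of [w] has dropped. *)
Lemma gen_schur_prod n w i N b : word_weight w = n ->
  S (gtensor (s (gam i) N * sprod w) b).
Proof.
elim/ltn_ind: n w i N b => n IHn w i N b wn.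
have Sw c : S (gtensor (sprod w) c).
  have [/hasP[x xw x0]|/hasPn w0] := boolP (has (fun x => 0 < x.2)%N w).
    have -> : sprod w = s (gam x.1) x.2 * sprod (rem x w).
      by rewrite /schur_prod (big_rem _ xw).
    apply: (IHn (word_weight (rem x w))) => //.
    by move: wn; rewrite /word_weight (big_rem _ xw) /=; lia.
  have -> : sprod w = 1.
    rewrite /schur_prod big_seq big1// => x xw.
    have -> : x.2 = 0%N by have := w0 x xw; rewrite -leqNgt leqn0 => /eqP.
    exact: schur0n.
  exact: gen_exp.
have [M [HM]] := gen_gY_exp N (gen_exp (gam i)) (Sw (b - gam i)).
rewrite addrC subrK.
case: M HM => [HM|M HM].
  have := HM 0%N isT; rewrite annih0n => ->.
  by rewrite mulr0 (morphD0 (gtensorD b)).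
rewrite big_ord_recl /= annih0n addn0 gtensorD => SM.
suff Srest : S (gtensor (\sum_(l < M) s (gam i) (N + lift ord0 l) *
    e (gam i) (lift ord0 l) (sprod w)) b).
  by have := SB SM Srest; rewrite addrK.
rewrite (morphD_sum _ _ _ (gtensorD b)); apply: (big_ind S) => // l _.
apply: (zspan_gtensor (f := fun x => s (gam i) (N + lift ord0 l) * x)
  _ _ (annih_schur_prod _ _ _)) => [x y|_ [w' /= ww' <-]].
  by rewrite mulrBr.
by apply: (IHn (word_weight w')) => //; move: ww'; rewrite /bump; lia.
Qed.

Lemma gen_gVL_Z v : gVL_Z ip gam v -> S v.
Proof.
move=> /(gVL_ZP ip gam _) Sv; rewrite (gtensorE v).
apply: (big_ind S) => // a _.
apply: (zspan_gtensor (f := id) _ _ (Sv a)) => // _ [[|x w] _ <-].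
  by rewrite /schur_prod big_nil; exact: gen_exp.
have -> : sprod (x :: w) = s (gam x.1) x.2 * sprod w by rewrite /schur_prod big_cons.
exact: gen_schur_prod.
Qed.

End Generation.

(** * The Schur monomials form a basis *)

Section Newton.
Variables (A : pzRingType) (h : nat -> A).

(** The elements g_k with (n+1) h_(n+1) = sum_(k+m=n) g_k h_m: for h_n the complete
symmetric functions these are the power sums of degree k+1. *)
Fixpoint newton_seq (n : nat) : seq A :=
  if n is n'.+1 then
    rcons (newton_seq n') (h n *+ n - \sum_(k < n') (newton_seq n')`_k * h (n' - k))
  else [::].

Definition newton (n : nat) : A := (newton_seq n.+1)`_n.

Lemma size_newton_seq n : size (newton_seq n) = n.
Proof. by elim: n => //= n IHn; rewrite size_rcons IHn. Qed.

Lemma nth_newton_seq n k : (k < n)%N -> (newton_seq n)`_k = newton k.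
Proof.
elim: n => // n IHn; rewrite ltnS leq_eqVlt => /orP[/eqP->//|kn].
rewrite -[newton_seq n.+1]/(rcons _ _) nth_rcons size_newton_seq kn; exact: IHn.
Qed.

Lemma newton_rec n : h 0 = 1 ->
  h n.+1 *+ n.+1 = csum n (fun k m => newton k * h m).
Proof.
move=> h0; rewrite /csum big_ord_recr /= subnn h0 mulr1.
rewrite /newton -[newton_seq n.+1]/(rcons _ _) nth_rcons size_newton_seq.
rewrite ltnn eqxx addrC.
under [X in _ - X]eq_bigr => k _ do rewrite nth_newton_seq ?ltn_ord//.
by rewrite subrK.
Qed.

End Newton.

Section SchurAutomorphism.
Variables (C : numFieldType) (L : zmodType) (d : nat) (A : fock C d).
Variables (ip : L -> L -> int) (gam : 'I_d -> L).
Hypothesis hgam : is_lattice_basis gam.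
Local Notation s := (gschur A ip gam).
Implicit Types (p q : A).

(** The variables shifted by one, with 1 in front, in the role of the complete
symmetric functions. *)
Definition hvar1 (i : 'I_d) (n : nat) : A := if n is n'.+1 then ghvar A i n' else 1.

Section Substitutions.
Variables phi psi : A -> A.
Hypothesis phiD : {morph phi : p q / p + q}.
Hypothesis phiM : {morph phi : p q / p * q}.
Hypothesis phiZ : forall c p, phi (c *: p) = c *: phi p.
Hypothesis phi1 : phi 1 = 1.
Hypothesis phi_hvar : forall i n, phi (ghvar A i n) = s (gam i) n.+1.
Hypothesis psiD : {morph psi : p q / p + q}.
Hypothesis psiM : {morph psi : p q / p * q}.
Hypothesis psiZ : forall c p, psi (c *: p) = c *: psi p.
Hypothesis psi1 : psi 1 = 1.
Hypothesis psi_hvar : forall i n, psi (ghvar A i n) = newton (hvar1 i) n.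

Lemma psi_schur i n : psi (s (gam i) n) = hvar1 i n.
Proof.
apply: (csum_unique (C := C) (V := A) (X := fun n => psi (s (gam i) n))
  (Y := hvar1 i) (T := fun k x => newton (hvar1 i) k * x)) => [|{}n|{}n].
- by rewrite schur0n psi1.
- rewrite -(morphDMn _ _ psiD) schur_rec// (morphD_csum _ _ psiD).
  by apply: eq_csum => k m _; rewrite psiM acre_gam// psi_hvar.
exact: newton_rec.
Qed.

Lemma phi_hvar1 i n : phi (hvar1 i n) = s (gam i) n.
Proof. by case: n => [|n]; rewrite /hvar1 ?phi1 ?schur0n ?phi_hvar. Qed.

(** Newton's identities hold both for the variables and for the Schur
polynomials, and they determine the g_k. *)
Lemma phi_newton i n : phi (newton (hvar1 i) n) = ghvar A i n.
Proof.
elim/ltn_ind: n => n IHn.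
have := congr1 phi (@newton_rec A (hvar1 i) n erefl).
rewrite (morphDMn _ _ phiD) phi_hvar1 schur_rec// (morphD_csum _ _ phiD).
rewrite {1}/csum {1}/csum !big_ord_recr /= subnn schur0n mulr1 phiM phi1 mulr1.
rewrite acre_gam// (eq_bigr (fun k : 'I_n =>
  phi (newton (hvar1 i) k * hvar1 i (n - k)))) => [/addrI->//|k _].
by rewrite phiM phi_hvar1 IHn// acre_gam.
Qed.

Lemma phiK : cancel phi psi.
Proof.
apply: fock_ind => [c|i n|p q IHp IHq|p q IHp IHq].
- by rewrite fock_cstE phiZ psiZ phi1 psi1.
- by rewrite phi_hvar psi_schur.
- by rewrite phiD psiD IHp IHq.
by rewrite phiM psiM IHp IHq.
Qed.

Lemma psiK : cancel psi phi.
Proof.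
apply: fock_ind => [c|i n|p q IHp IHq|p q IHp IHq].
- by rewrite fock_cstE psiZ phiZ psi1 phi1.
- by rewrite psi_hvar phi_newton.
- by rewrite psiD phiD IHp IHq.
by rewrite psiM phiM IHp IHq.
Qed.

End Substitutions.

Variable homog : nat -> A -> Prop.
Hypothesis homog0 : forall n, homog n 0.
Hypothesis homogD : forall n p q, homog n p -> homog n q -> homog n (p + q).
Hypothesis homogZ : forall n c p, homog n p -> homog n (c *: p).
Hypothesis homogM : forall n m p q, homog n p -> homog m q -> homog (n + m) (p * q).
Hypothesis homog1 : homog 0 1.
Hypothesis homog_hvar : forall i n, homog n.+1 (ghvar A i n).

Let homog_sum n (T : Type) (r : seq T) (P : pred T) (F : T -> A) :
  (forall i, P i -> homog n (F i)) -> homog n (\sum_(i <- r | P i) F i).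
Proof. by move=> hF; apply: (big_ind (homog n)) => //; exact: homogD. Qed.

Let homogMn n p k : homog n p -> homog n (p *+ k).
Proof. by move=> hp; rewrite -scaler_nat; exact: homogZ. Qed.

Lemma homog_newton i n : homog n.+1 (newton (hvar1 i) n).
Proof.
have h1 k : homog k (hvar1 i k) by case: k => [|k]; [exact: homog1|exact: homog_hvar].
elim/ltn_ind: n => n IHn.
have := @newton_rec A (hvar1 i) n erefl.
rewrite /csum big_ord_recr /= subnn mulr1 addrC => /eqP.
rewrite -subr_eq => /eqP <-; apply: homogD; first exact/homogMn/homog_hvar.
rewrite -scaleN1r; apply: homogZ; apply: homog_sum => k _.
have -> : n.+1 = (k.+1 + (n - k))%N by have := ltn_ord k; lia.
by apply: homogM; [exact: IHn|exact: h1].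
Qed.

Lemma homog_schur i n : homog n (s (gam i) n).
Proof.
elim/ltn_ind: n => -[|n] IHn; first by rewrite schur0n.
have -> : s (gam i) n.+1 = (n.+1%:R^-1 : C) *: (s (gam i) n.+1 *+ n.+1).
  by rewrite -scaler_nat scalerA mulVf ?scale1r// pnatr_eq0.
apply: homogZ; rewrite schur_rec//; apply: homog_sum => k _.
have kn : (k.+1 + (n - k))%N = n.+1 by have := ltn_ord k; lia.
have := homogM (homog_hvar i k) (IHn (n - k)%N _).
by rewrite kn acre_gam//; apply; lia.
Qed.

End SchurAutomorphism.

Section SchurBasis.
Variables (C : numFieldType) (L : zmodType) (d : nat).
Variables (ip : L -> L -> int) (gam : 'I_d -> L).
Hypothesis hgam : is_lattice_basis gam.
Local Notation A := (mfock C d).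
Local Notation s := (gschur A ip gam).
Local Notation Sc := (@schur_ring C L d A ip gam).
Local Notation cmon := {cmonom ('I_d * nat)%type}.
Implicit Types (p q : A) (m : cmon).

Definition var_weight (x : 'I_d * nat) : nat := x.2.+1.

Local Notation homog := (@mhomog C _ var_weight).

Definition schur_subst : A -> A :=
  @msubst C _ A (fun x => s (gam x.1) x.2.+1).

Definition newton_subst : A -> A :=
  @msubst C _ A (fun x => newton (hvar1 A x.1) x.2).

Local Notation phi := schur_subst.
Local Notation psi := newton_subst.

Let phiD : {morph phi : p q / p + q}. Proof. exact: msubstD. Qed.
Let phiM : {morph phi : p q / p * q}. Proof. exact: msubstM. Qed.
Let phiZ c p : phi (c *: p) = c *: phi p. Proof. exact: msubstZ. Qed.
Let phi1 : phi 1 = 1. Proof. exact: msubst1. Qed.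
Let phi_var i n : phi (ghvar A i n) = s (gam i) n.+1.
Proof. exact: (msubst_var _ (i, n)). Qed.

Let psiD : {morph psi : p q / p + q}. Proof. exact: msubstD. Qed.
Let psiM : {morph psi : p q / p * q}. Proof. exact: msubstM. Qed.
Let psiZ c p : psi (c *: p) = c *: psi p. Proof. exact: msubstZ. Qed.
Let psi1 : psi 1 = 1. Proof. exact: msubst1. Qed.
Let psi_var i n : psi (ghvar A i n) = newton (hvar1 A i) n.
Proof. exact: (msubst_var _ (i, n)). Qed.

Lemma newton_substK : cancel psi phi.
Proof. exact: (psiK (L := L) (ip := ip) (gam := gam)). Qed.

Lemma schur_substK : cancel phi psi.
Proof. exact: (phiK (L := L) (ip := ip) (gam := gam)). Qed.

Lemma newton_subst_schur i n : psi (s (gam i) n) = hvar1 A i n.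
Proof. exact: (psi_schur ip hgam psiD psiM psi1 psi_var). Qed.

Lemma homog_hvar i n : homog n.+1 (ghvar A i n).
Proof. by apply: mhomogU; exact: wdegU. Qed.

Lemma homog_prod (S : 'I_d * nat -> A) m : (forall x, homog (var_weight x) (S x)) ->
  homog (wdeg var_weight m) (\prod_(x <- mlist m) S x).
Proof.
move=> hS; rewrite wdegE; elim: (mlist m) => [|x r IHr].
  by rewrite !big_nil; exact: mhomog1.
by rewrite !big_cons; exact: mhomogM.
Qed.

Lemma homog_subst (S : 'I_d * nat -> A) n p :
  (forall x, homog (var_weight x) (S x)) -> homog n p ->
  homog n (@msubst C _ A S p).
Proof.
move=> hS hp; rewrite /msubst /mlin big_seq; apply: mhomog_sum => m.
rewrite -mcoeff_neq0 => /hp <-; apply: mhomogZ; exact: homog_prod.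
Qed.

Lemma homog_newton_var x : homog (var_weight x) (newton (hvar1 A x.1) x.2).
Proof.
exact: (@homog_newton C d A homog (@mhomog0 _ _ _) (@mhomogD _ _ _)
  (@mhomogZ _ _ _) (@mhomogM _ _ _) (@mhomog1 _ _ _) homog_hvar x.1 x.2).
Qed.

Lemma homog_schur_var x : homog (var_weight x) (s (gam x.1) x.2.+1).
Proof.
exact: (@homog_schur C L d A ip gam hgam homog (@mhomog0 _ _ _) (@mhomogD _ _ _)
  (@mhomogZ _ _ _) (@mhomogM _ _ _) (@mhomog1 _ _ _) homog_hvar x.1 x.2.+1).
Qed.

(** The coordinate of [p] along the Schur monomial indexed by [m]. *)
Definition schur_coord m p : C := (psi p : {malg C[cmon]})@_m.

Definition schur_monom m : A := \prod_(x <- mlist m) s (gam x.1) x.2.+1.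

Lemma schur_coordD m : {morph schur_coord m : p q / p + q}.
Proof. by move=> p q; rewrite /schur_coord psiD mcoeffD. Qed.

Lemma schur_coordZ m c p : schur_coord m (c *: p) = c * schur_coord m p.
Proof. by rewrite /schur_coord psiZ mcoeffZ. Qed.

Lemma schur_coord_monom m m' : schur_coord m (schur_monom m') = (m' == m)%:R.
Proof.
have -> : schur_monom m' = phi (<< m' >> : {malg C[cmon]}).
  by apply/esym; exact: msubst_monom.
by rewrite /schur_coord schur_substK mcoeffU1.
Qed.

Lemma schur_coord_inj p q : (forall m, schur_coord m p = schur_coord m q) -> p = q.
Proof. by move=> H; apply: (can_inj newton_substK); apply/malgP. Qed.

Lemma schur_coord_homog n p m : homog n p -> schur_coord m p != 0 ->
  wdeg var_weight m = n.
Proof.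
move=> hp; apply: homog_subst hp m => x; exact: homog_newton_var.
Qed.

Lemma homog_schur_monom m : homog (wdeg var_weight m) (schur_monom m).
Proof. by apply: homog_prod => x; exact: homog_schur_var. Qed.

Lemma schur_ring_monom m : Sc (schur_monom m).
Proof.
apply: (big_ind Sc) => [|p q|x _]; first exact: schur_ring1.
  exact: schur_ringM.
exact: schur_ring_schur.
Qed.

(** The inverse automorphism maps each product of Schur polynomials s_(gamma_i,n)
to a monomial. *)
Lemma schur_coord_int p m : Sc p -> exists z : int, schur_coord m p = z%:~R.
Proof.
move=> Sp; pose X := [set p : A | exists m, p = (<< m >> : {malg C[cmon]})].
have : zspan X (psi p).
  move: p Sp; apply: schur_ring_ind.
  - exact: (eq_ind_r (zspan X) (zspan0 X) (morphD0 psiD)).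
  - move=> p q Xp Xq.
    have E : psi (p - q) = psi p - psi q by rewrite psiD (morphDN _ psiD).
    exact: (eq_ind_r (zspan X) (zspanB Xp Xq) E).
  - apply: (eq_ind_r (zspan X) _ psi1); apply: zspan_gen; exists mone; exact: erefl.
  move=> i n p _ Xp.
  have E : psi (s (gam i) n * p) = hvar1 A i n * psi p.
    exact: etrans (psiM _ _) (congr1 (fun x => x * _) (newton_subst_schur i n)).
  apply: (eq_ind_r (zspan X) _ E) => {E}; case: n => [|n].
    by rewrite mul1r.
  move: Xp; rewrite /hvar1; move: (psi p); apply: zspan_ind => [|u v Xu Xv|].
  - exact: (eq_ind_r (zspan X) (zspan0 X) (mulr0 _)).
  - exact: (eq_ind_r (zspan X) (zspanB Xu Xv) (mulrBr _ u v)).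
  move=> _ [m' ->]; apply: zspan_gen; exists (mmul (ucm (i, n)) m').
  apply: etrans (malgUM _ _ _ _) _.
  exact: (congr1 (mkmalgU _) (mulr1 1)).
rewrite /schur_coord; move: (psi p); apply: zspan_ind => [|u v|].
- by exists 0; exact: mcoeff0.
- move=> [z Ez] [z' Ez']; exists (z - z').
  by apply: etrans (mcoeffB _ _ _) _; rewrite Ez Ez' rmorphB.
move=> _ [m' ->]; exists (m' == m)%:R.
by rewrite mcoeffU1; case: (m' == m).
Qed.

End SchurBasis.

Arguments var_weight {d} x.

(** * Finiteness of the graded pieces *)

Lemma finite_set_inj (T : Type) (U : finType) (f : T -> U) (X : set T) :
  {in X &, injective f} -> finite_set X.
Proof.
move=> f_inj; rewrite -(eq_finite_set (inj_card_eq f_inj)); exact: finite_finset.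
Qed.

Section Finiteness.
Variables (L : zmodType) (d : nat) (ip : L -> L -> int) (gam : 'I_d -> L).
Hypothesis hip : is_posdef_even_form ip.
Hypothesis hgam : is_lattice_basis gam.
Implicit Types a b w : L.

Lemma ip_ge0 a : 0 <= ip a a.
Proof.
have [->|a0] := eqVneq a 0; first by rewrite ip0r.
by apply: ltW; case: hip => _ _ /(_ a a0).
Qed.

Lemma ip_CauchySchwarz w a : ip w a ^+ 2 <= ip w w * ip a a.
Proof.
have [->|a0] := eqVneq a 0; first by rewrite !(ip0r hip) mulr0 expr0n.
have aa : 0 < ip a a by case: hip => _ _ /(_ a a0).
(* The component of w orthogonal to a, cleared of denominators. *)
pose x := w *~ ip a a - a *~ ip w a.
have : 0 <= ip x x by exact: ip_ge0.
have -> : ip x x = ip a a * (ip w w * ip a a - ip w a ^+ 2).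
  have xl y : ip x y = ip w y * ip a a - ip a y * ip w a.
    by rewrite ipC // (ipDr hip) (ipNr hip) !(ipMzr hip) !(ipC hip y).
  rewrite xl (ipC hip w x) xl (ipC hip a x) xl (ipC hip a w); ring.
by rewrite pmulr_rge0// subr_ge0.
Qed.

Definition igram : 'M[int]_d := \matrix_(i, j) ip (gam i) (gam j).

(** An integral vector in the kernel of the Gram matrix has norm 0. *)
Lemma igram_det_neq0 : \det igram != 0.
Proof.
apply/negP => /det0P[v v0 vG]; case/negP: v0.
pose a := \sum_(i < d) gam i *~ v 0 i.
have aE : Defs.coord gam a = [ffun i => v 0 i].
  by apply: lcoord_uniq => //; apply: eq_bigr => i _; rewrite ffunE.
have a0 j : ip a (gam j) = 0.
  have /rowP/(_ j) := vG; rewrite !mxE => <-.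
  rewrite (ipC hip) (ip_sumr hip); apply: eq_bigr => i _.
  by rewrite (ipMzr hip) !mxE mulrC (ipC hip).
have aa : ip a a = 0.
  by rewrite (ip_coord hip hgam) big1// => i _; rewrite a0 mul0r.
have aN : a = 0.
  apply/eqP/negPn/negP => an0.
  by have := hip => -[_ _ /(_ a an0)]; rewrite aa ltxx.
apply/eqP/rowP => i; rewrite mxE.
by have := congr1 (fun f : {ffun 'I_d -> int} => f i) aE; rewrite aN lcoord0// ffunE.
Qed.

(** The adjugate of the Gram matrix provides lattice vectors w_i with
(w_i, a) = det * a_i, and the Cauchy-Schwarz inequality bounds (w_i, a). *)
Lemma coord_bound (T : int) : exists K : nat, forall a, ip a a <= T -> forall i,
  (absz (Defs.coord gam a i) <= K)%N.
Proof.
pose w i := \sum_(j < d) gam j *~ (\adj igram) i j.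
have wa i a : ip (w i) a = \det igram * Defs.coord gam a i.
  rewrite (ipC hip) (ip_sumr hip).
  transitivity ((\adj igram *m igram *m \col_k Defs.coord gam a k) i 0).
    rewrite -mulmxA mxE; apply: eq_bigr => j _.
    rewrite (ipMzr hip) mulrC; congr (_ * _); rewrite mxE (ipC hip).
    by rewrite (ip_coord hip hgam); apply: eq_bigr => k _; rewrite !mxE.
  by rewrite mul_adj_mx mul_scalar_mx !mxE.
exists (\sum_(i < d) absz (ip (w i) (w i) * T)%R)%N => a aT i.
have CS := ip_CauchySchwarz (w i) a.
have d0 : 1 <= \det igram ^+ 2.
  by have := igram_det_neq0; move: (\det igram) => x x0; nia.
rewrite wa exprMn in CS.
have c2 : Defs.coord gam a i ^+ 2 <= ip (w i) (w i) * T.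
  have := ip_ge0 (w i); have := ip_ge0 a.
  move: CS d0 aT; move: (\det _ ^+ 2) (ip _ _) (ip _ _) => x y z.
  move: (Defs.coord gam a i) => c; nia.
rewrite (bigD1 i)//=; apply: leq_trans (leq_addr _ _).
by move: c2; move: (Defs.coord gam a i) (_ * T) => c z; nia.
Qed.

Lemma finite_norm (T : int) : finite_set [set a | ip a a <= T].
Proof.
have [K HK] := coord_bound T.
apply: (@finite_set_inj _ {ffun 'I_d -> 'I_(K + K).+1}
  (fun a => [ffun i => inord (absz (Defs.coord gam a i + K%:Z))])).
move=> a b; rewrite !inE /= => aT bT /ffunP ab.
rewrite (lcoordP hgam a) (lcoordP hgam b); apply: eq_bigr => i _; congr (_ *~ _).
have := ab i; rewrite !ffunE => /(congr1 val) /=.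
have := HK a aT i; have := HK b bT i.
move: (Defs.coord gam a i) (Defs.coord gam b i) => x y xK yK.
by rewrite !inordK; lia.
Qed.

Lemma finite_weight (T : nat) :
  finite_set [set m : {cmonom ('I_d * nat)%type} | (wdeg var_weight m <= T)%N].
Proof.
apply: (@finite_set_inj {cmonom ('I_d * nat)%type} {ffun 'I_d * 'I_T -> 'I_T.+1}
  (fun m : {cmonom ('I_d * nat)%type} => [ffun x => inord (m (x.1, val x.2))])).
have bound (m : {cmonom ('I_d * nat)%type}) : (wdeg var_weight m <= T)%N ->
    forall x, (m x * x.2.+1 <= T)%N.
  move=> mT x; apply: leq_trans mT; rewrite /wdeg.
  have [xm|xm] := boolP (x \in finsupp m); first by rewrite (big_rem _ xm) leq_addr.
  have -> : m x = 0%N by apply/eqP; rewrite cmE_eq0.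
  by [].
move=> m m'; rewrite !inE /= => /bound mT /bound mT' /ffunP mm'.
apply/eqP/cmP => -[i n].
have := mT (i, n); have := mT' (i, n) => /=.
have [nT|Tn] := ltnP n T; last by nia.
have := mm' (i, Ordinal nT); rewrite !ffunE /= => /(congr1 val) /=.
move: (m (i, n)) (m' (i, n)) => x y xy yT xT; move: xy.
by rewrite !inordK// ltnS (leq_trans (leq_pmulr _ (ltn0Sn n))).
Qed.

Lemma finite_degree (n : int) :
  finite_set [set x : L * {cmonom ('I_d * nat)%type} |
    2 * n = 2 * (wdeg var_weight x.2)%:Z + ip x.1 x.1].
Proof.
apply: (@sub_finite_set _ _ ([set a | ip a a <= 2 * n] `*`
  [set m : {cmonom ('I_d * nat)%type} | (wdeg var_weight m <= absz n)%N])).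
  by move=> [a m] /= H; split=> /=; have := ip_ge0 a; lia.
by apply: finite_setX; [exact: finite_norm|exact: finite_weight].
Qed.

End Finiteness.

(** * Bases of the graded pieces *)

Section GradedBasis.
Variables (C : numFieldType) (L : zmodType) (d : nat).
Variables (ip : L -> L -> int) (gam : 'I_d -> L).
Hypothesis hip : is_posdef_even_form ip.
Hypothesis hgam : is_lattice_basis gam.
Local Notation A := (mfock C d).
Local Notation VL := {malg A[L]}.
Local Notation Sc := (@schur_ring C L d A ip gam).
Local Notation cmon := {cmonom ('I_d * nat)%type}.
Implicit Types (a b : L) (m : cmon) (u v : VL).

Definition mono_coeff m (p : A) : C := (p : {malg C[cmon]})@_m.

Lemma mono_coeff0 m : mono_coeff m 0 = 0. Proof. exact: mcoeff0. Qed.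

Lemma mono_coeffD m p q : mono_coeff m (p + q) = mono_coeff m p + mono_coeff m q.
Proof. exact: mcoeffD. Qed.

Lemma mono_coeffZ m c p : mono_coeff m (c *: p) = c * mono_coeff m p.
Proof. exact: mcoeffZ. Qed.

Definition ggrade (n : int) : set VL :=
  [set v | forall a m, mono_coeff m v@_a != 0 ->
     2 * n = 2 * (wdeg var_weight m)%:Z + ip a a].

Definition supported (P : L -> Prop) : set VL := [set v | forall a, ~ P a -> v@_a = 0].

Definition vbasis (x : L * cmon) : VL := gtensor (schur_monom C ip gam x.2) x.1.

Definition vcoord (x : L * cmon) v : C := schur_coord x.2 v@_x.1.

Lemma vcoord_inj u v : (forall x, vcoord x u = vcoord x v) -> u = v.
Proof.
move=> uv; apply/malgP => a; apply: (schur_coord_inj ip hgam) => m.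
exact: (uv (a, m)).
Qed.

Lemma vcoord_basis x y : vcoord x (vbasis y) = (y == x)%:R.
Proof.
case: x y => [a m] [b m']; rewrite /vcoord /vbasis mcoeff_gtensor xpair_eqE /=.
case: eqP => _ /=; first exact: schur_coord_monom.
by rewrite (morphD0 (@schur_coordD C d m)).
Qed.

Lemma vcoord_sum x n (c : 'I_n -> C) (y : 'I_n -> L * cmon) :
  vcoord x (\sum_(i < n) gscale (c i) (vbasis (y i))) =
  \sum_(i < n) c i * (y i == x)%:R.
Proof.
rewrite /vcoord raddf_sum (morphD_sum _ _ _ (@schur_coordD C d x.2)).
apply: eq_bigr => i _; rewrite -vcoord_basis /vcoord -schur_coordZ; congr schur_coord.
exact: mcoeff_gscale.
Qed.

Lemma vcoord_int x v : gVL_Z ip gam v -> exists z : int, vcoord x v = z%:~R.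
Proof.
move=> /gVL_ZP Sv; exact: (schur_coord_int hgam).
Qed.

Lemma vcoord_grade n a m v : ggrade n v -> vcoord (a, m) v != 0 ->
  2 * n = 2 * (wdeg var_weight m)%:Z + ip a a.
Proof.
move=> nv vam.
have [m0 vm0] : exists m0, mono_coeff m0 v@_a != 0.
  apply/not_existsP => H; case/negP: vam; apply/eqP.
  rewrite /vcoord /=; have -> : v@_a = 0.
    apply/malgP => m'; apply: etrans (esym (mono_coeff0 m')).
    by apply/eqP/negPn/negP => /H.
  exact: (morphD0 (@schur_coordD C d m)).
have n0 := nv a m0 vm0.
suff -> : wdeg var_weight m = wdeg var_weight m0 by [].
apply: schur_coord_homog vam => m' vm'.
by have := nv a m' vm'; move: n0; lia.
Qed.

Lemma gscale_int (z : int) v : gscale (z%:~R : C) v = v *~ z.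
Proof.
apply/malgP => a; apply: etrans (mcoeff_gscale _ _ _) _; rewrite scaler_int.
by rewrite (raddfMz (mcoeff a)).
Qed.

Lemma supported0_gtensor p : supported (fun a => a = 0) (gtensor p 0).
Proof. by move=> a a0; rewrite mcoeff_gtensor; case: eqP => // /esym. Qed.

Lemma supported0E v : supported (fun a => a = 0) v -> v = gtensor v@_0 0.
Proof.
move=> v0; apply/malgP => a; rewrite mcoeff_gtensor.
by case: eqP => [->//|a0]; apply: v0 => aE; apply: a0.
Qed.

Lemma gVL_Z_gtensor p a : Sc p -> gVL_Z ip gam (gtensor p a : VL).
Proof.
move=> Sp; apply/gVL_ZP => b; rewrite mcoeff_gtensor.
by case: eqP => _ //; exact: schur_ring0.
Qed.

Lemma gM1_Z_supported :
  gM1_Z ip gam = gVL_Z ip gam `&` supported (fun a => a = 0).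
Proof.
apply/seteqP; split=> [v /(gM1_ZP ip hgam)[p Sp ->]|v [/gVL_ZP Sv v0]].
  by split; [exact: gVL_Z_gtensor|exact: supported0_gtensor].
by apply/(gM1_ZP ip hgam); exists v@_0 => //; exact: supported0E.
Qed.

Lemma ggradeD n u v : ggrade n u -> ggrade n v -> ggrade n (u + v).
Proof.
move=> nu nv a m; rewrite mcoeffD mono_coeffD.
by have [->|/nu//] := eqVneq (mono_coeff m u@_a) 0; rewrite add0r => /nv.
Qed.

Lemma ggrade0 n : ggrade n 0.
Proof. by move=> a m; rewrite mcoeff0 mono_coeff0 eqxx. Qed.

Lemma ggradeZ n (c : C) v : ggrade n v -> ggrade n (gscale c v).
Proof.
move=> nv a m; rewrite mcoeff_gscale mono_coeffZ mulf_eq0 negb_or => /andP[_].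
exact: nv.
Qed.

Lemma ggrade_basis n x : 2 * n = 2 * (wdeg var_weight x.2)%:Z + ip x.1 x.1 ->
  ggrade n (vbasis x).
Proof.
move=> nx a m; rewrite mcoeff_gtensor; have [<-|_] := eqVneq x.1 a; last first.
  by rewrite mono_coeff0 eqxx.
by move=> H; have -> := homog_schur_monom hgam H.
Qed.

(** The tensors of Schur monomials with exponentials have the [vcoord] as dual
coordinates, and these are integral on the integral form.  [P] selects between
V_L and M(1). *)
Lemma graded_basis (P : L -> Prop) (n : int) : exists (k : nat) (b : 'I_k -> VL),
  [/\ forall c : 'I_k -> C, \sum_(i < k) gscale (c i) (b i) = 0 ->
        forall i, c i = 0,
      supported P `&` ggrade n =
        [set v | exists c : 'I_k -> C, v = \sum_(i < k) gscale (c i) (b i)]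
    & gVL_Z ip gam `&` supported P `&` ggrade n = zspan (range b)].
Proof.
pose X := [set x : L * cmon | P x.1 /\
  2 * n = 2 * (wdeg var_weight x.2)%:Z + ip x.1 x.1].
have finX : finite_set X.
  by apply: sub_finite_set (finite_degree hip hgam n) => x [].
have /finite_seqP[r0 r0X] := finX.
pose r := undup r0; pose x0 : L * cmon := (0, mone).
have rX x : x \in r <-> X x by rewrite mem_undup r0X.
pose y (i : 'I_(size r)) := nth x0 r i.
have yr i : y i \in r by rewrite mem_nth.
have y_inj i j : (y i == y j) = (i == j).
  by rewrite nth_uniq ?undup_uniq.
have yX i : X (y i) by apply/rX.
have sum_pick (c : 'I_(size r) -> C) j : \sum_i c i * (y i == y j)%:R = c j.
  rewrite (bigD1 j)//= eqxx mulr1 big1 ?addr0// => i ij.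
  by rewrite y_inj (negPf ij) mulr0.
have span v : supported P v -> ggrade n v ->
    v = \sum_i gscale (vcoord (y i) v) (vbasis (y i)).
  move=> Pv nv; apply: vcoord_inj => x; rewrite vcoord_sum.
  have [xr|xr] := boolP (x \in r).
    have ix : (index x r < size r)%N by rewrite index_mem.
    have -> : x = y (Ordinal ix) by rewrite /y nth_index.
    by rewrite sum_pick.
  rewrite big1 => [|i _]; last first.
    by case: eqP => [yx|]; [rewrite -yx yr in xr|rewrite mulr0].
  apply/eqP; apply: contraNT xr => vx; apply/rX; split.
    apply: contrapT => /Pv vx0; case/negP: vx; apply/eqP; rewrite /vcoord vx0.
    exact: (morphD0 (@schur_coordD C d x.2)).
  by apply: (vcoord_grade nv); case: (x) vx.
have sup_basis i a : ~ P a -> (vbasis (y i))@_a = 0.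
  rewrite /vbasis mcoeff_gtensor => Pa; case: eqP => // ya.
  by case: Pa; rewrite -ya; have [] := yX i.
exists (size r), (fun i => vbasis (y i)); split.
- move=> c c0 j; have := congr1 (vcoord (y j)) c0.
  rewrite vcoord_sum sum_pick => ->; rewrite /vcoord mcoeff0.
  exact: (morphD0 (@schur_coordD C d _)).
- apply/seteqP; split=> [v [Pv nv]|_ [c ->]].
    by exists (fun i => vcoord (y i) v); exact: span.
  split=> [a Pa|].
    rewrite raddf_sum big1// => i _; apply: etrans (mcoeff_gscale _ _ _) _.
    by rewrite sup_basis// scaler0.
  apply: (big_ind (ggrade n)) => [|u v|i _]; first exact: ggrade0.
    exact: ggradeD.
  by apply: ggradeZ; apply: ggrade_basis; have [] := yX i.
apply/seteqP; split=> [v [[Sv Pv] nv]|].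
  have [z zE] := choice (fun i => vcoord_int (y i) Sv).
  exists (size r), z, (fun i => vbasis (y i)); split; first by move=> i; exists i.
  rewrite [LHS](span v Pv nv); apply: eq_bigr => i _.
  by rewrite zE gscale_int.
apply: zspan_ind => [|u v [[Su Pu] nu] [[Sv Pv] nv]|_ [i _ <-]].
- split; last exact: ggrade0.
  by split=> [|a _]; [exact: zspan0|exact: mcoeff0].
- split; first split.
  + exact: zspanB.
  + by move=> a Pa; rewrite mcoeffB Pu// Pv// subr0.
  apply: ggradeD => //.
  have -> : - v = gscale (-1) v by rewrite -[-1]/((-1)%:~R) gscale_int mulrN1z.
  exact: ggradeZ.
split; first split.
- apply/gVL_ZP => a; rewrite /vbasis mcoeff_gtensor; case: eqP => _.
    exact: schur_ring_monom.
  exact: schur_ring0.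
- by move=> a Pa; exact: sup_basis.
by apply: ggrade_basis; have [] := yX i.
Qed.

End GradedBasis.

(** * Closure of the integral form under products *)

Section Products.
Variables (C : numFieldType) (L : zmodType) (d : nat).
Variables (ip : L -> L -> int) (gam : 'I_d -> L) (eps : L -> L -> int).
Hypothesis hip : is_posdef_even_form ip.
Hypothesis hgam : is_lattice_basis gam.
Local Notation A := (mfock C d).
Local Notation VL := {malg A[L]}.
Local Notation Sc := (@schur_ring C L d A ip gam).
Local Notation cmon := {cmonom ('I_d * nat)%type}.
Local Notation kernel := (nat -> nat -> A -> A).
Local Notation kword := (@kword C L d A ip gam eps).
Implicit Types (a b : L) (m : cmon) (u v : VL) (p q : A) (K : kernel).

Definition gnprod u (k : int) v : VL :=
  \sum_(a <- msupp u) \sum_(m <- msupp (u@_a : {malg C[cmon]}))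
    gscale (mono_coeff m u@_a) (gY_word ip gam eps a (mlist m) k v).

(** The kernel of the vertex operator of [p] (x) e^a on M(1) (x) e^b. *)
Definition kpoly a b : A -> kernel := @mlin C _ kernel (fun m => kword a b (mlist m)).

Lemma kpolyD a b : {morph kpoly a b : p q / p + q}.
Proof. exact: mlinD. Qed.

Lemma kpoly1 a b : kpoly a b 1 = kexp ip gam eps a b.
Proof.
apply: etrans (mlinU _ _ _) _; rewrite scale1r.
by rewrite mlist1.
Qed.

Lemma kaddD K K' : kadd K -> kadd K' -> kadd (K + K').
Proof.
move=> KD KD' i l p q; apply: etrans (congr2 +%R (KD i l p q) (KD' i l p q)) _.
exact: addrACA.
Qed.

Lemma kaddZ (c : C) K : kadd K -> kadd (c *: K).
Proof.
move=> KD i l p q; apply: etrans (congr1 ( *:%R c) (KD i l p q)) _.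
exact: scalerDr.
Qed.

Lemma kbndD K K' : kbnd K -> kbnd K' -> kbnd (K + K').
Proof.
move=> KB KB' q; have [N HN] := KB q; have [N' HN'] := KB' q.
exists (maxn N N') => i l; rewrite geq_max => /andP[Nl Nl'].
apply: etrans (congr2 +%R (HN i l Nl) (HN' i l Nl')) _; exact: addr0.
Qed.

Lemma kbndZ (c : C) K : kbnd K -> kbnd (c *: K).
Proof.
move=> KB q; have [N HN] := KB q; exists N => i l Nl.
apply: etrans (congr1 ( *:%R c) (HN i l Nl)) _; exact: scaler0.
Qed.

Lemma kpoly_add a b p : kadd (kpoly a b p).
Proof.
apply: (big_ind (@kadd C d A)) => [i l p' q'||m _].
- by rewrite [RHS](_ : _ = 0 + 0)// addr0.
- exact: kaddD.
by apply: kaddZ; exact: kword_add.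
Qed.

Lemma kpoly_bnd a b p : kbnd (kpoly a b p).
Proof.
apply: (big_ind (@kbnd C d A)) => [q'||m _].
- by exists 0%N.
- exact: kbndD.
by apply: kbndZ; exact: kword_bnd.
Qed.

Lemma kstepZ b x (c : C) K : kstep ip gam b x (c *: K) = c *: kstep ip gam b x K.
Proof.
apply: kernelP => i l q.
transitivity (c *: lconv (kcre A x) K i l q + c *: rconv (kann ip gam b x) K i l q).
  congr (_ + _); rewrite /lconv /rconv (morphD_csum _ _ (@scalerDr _ _ c)).
    by apply: eq_csum => i1 i2 _; rewrite scalerAr.
  by apply: eq_csum.
by rewrite -scalerDr.
Qed.

Lemma kpoly_hvar a b i n p :
  kpoly a b (ghvar A i n * p) = kstep ip gam b (i, n) (kpoly a b p).
Proof.
apply: etrans (mlin_varM _ (i, n) p) _.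
rewrite /kpoly /mlin (morphD_sum _ _ _ (@kstepD C L d A ip gam b (i, n))).
apply: eq_bigr => m _; rewrite kstepZ; congr (_ *: _).
have Ep : perm_eq (mlist (mmul (ucm (i, n)) m)) ((i, n) :: mlist m).
  apply: perm_trans (mlist_mmul _ _) _; rewrite -cat1s perm_cat2r.
  exact: mlistU.
exact: (@kword_perm C L d A ip gam eps a b _ _ Ep).
Qed.

Lemma kpoly_int a b p : Sc p -> kint ip gam (kpoly a b p).
Proof.
exact: (@kint_schur_ring C L d A ip gam eps hip hgam a b (kpoly a b)
  (kpolyD a b) (kpoly_add a b) (kpoly1 a b) (kpoly_hvar a b) p).
Qed.

Lemma kdiag_sum (T : eqType) (r : seq T) (c : T -> C) (K : T -> kernel) t q :
  (forall x, kbnd (K x)) ->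
  kdiag (\sum_(x <- r) c x *: K x) t q = \sum_(x <- r) c x *: kdiag (K x) t q.
Proof.
move=> KB; elim: r => [|x r IHr].
  by rewrite !big_nil (@kdiagE _ _ _ _ 0%N) ?big_ord0.
have sum_bnd : kbnd (\sum_(x <- r) c x *: K x).
  apply: (big_ind (@kbnd C d A)) => [q'||y _]; [by exists 0%N|exact: kbndD|].
  exact: kbndZ.
rewrite !big_cons -IHr.
have [N HN] := KB x q; have [N' HN'] := sum_bnd q.
move: (\sum_(x <- r) _) HN' => K' HN'.
rewrite (@kdiagE _ _ _ (K x) (N + N')%N) => [|i l Nl]; last by apply: HN; lia.
rewrite (@kdiagE _ _ _ K' (N + N')%N) => [|i l Nl]; last by apply: HN'; lia.
rewrite (@kdiagE _ _ _ _ (N + N')%N) => [|i l Nl]; last first.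
  apply: etrans (congr2 (fun y z => c x *: y + z) (HN i l _) (HN' i l _)) _; [lia|lia|].
  by rewrite scaler0 addr0.
rewrite scaler_sumr -big_split; apply: eq_bigr => l _ /=.
by case: (t + l%:Z) => n //=; rewrite scaler0 addr0.
Qed.

Lemma mcoeff_gnprod u k v c : (gnprod u k v)@_c =
  \sum_(a <- msupp u) kdiag (kpoly a (c - a) u@_a) (- k - 1 - ip a (c - a)) v@_(c - a).
Proof.
rewrite /gnprod (raddf_sum (mcoeff c)); apply: eq_bigr => a _.
rewrite (raddf_sum (mcoeff c)).
rewrite kdiag_sum; last by move=> m; exact: kword_bnd.
apply: eq_bigr => m _; apply: etrans (mcoeff_gscale _ _ _) _; congr (_ *: _).
rewrite gY_word_kfield// mcoeff_kfield// => b; exact: kword_add.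
Qed.

Lemma gVL_Z_nprod u k v : gVL_Z ip gam u -> gVL_Z ip gam v ->
  gVL_Z ip gam (gnprod u k v).
Proof.
move=> /gVL_ZP Su /gVL_ZP Sv; apply/gVL_ZP => c; rewrite mcoeff_gnprod.
apply: zspan_sum => a _; apply: kdiag_int => //; first exact: kpoly_int.
exact: kpoly_bnd.
Qed.

Lemma supported0_nprod u k v : supported (fun a => a = 0) u ->
  supported (fun a => a = 0) v -> supported (fun a => a = 0) (gnprod u k v).
Proof.
move=> u0 v0 c c0; rewrite mcoeff_gnprod big_seq big1// => a au.
have a0 : a = 0.
  by apply: contrapT => /u0/eqP; rewrite mcoeff_eq0 au.
by rewrite a0 subr0 v0// kdiag0//; exact: kpoly_add.
Qed.

Lemma gnprod_exp a k v : gnprod (gtensor 1 a) k v = gY_exp ip gam eps a k v.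
Proof.
apply/malgP => c; rewrite mcoeff_gnprod gY_exp_kfield mcoeff_kfield; last first.
  by move=> b; exact: kexp_add.
have -> : msupp (gtensor (1 : A) a) = [fset a]%fset.
  by rewrite /gtensor msuppU oner_eq0.
by rewrite big_seq_fset1 mcoeff_gtensor eqxx kpoly1.
Qed.

(** * The Virasoro element *)

Definition ggram : 'M[C]_d := \matrix_(i, j) (ip (gam i) (gam j))%:~R.

Definition gomega1 : A := (2^-1 : C) *:
    \sum_(i < d) \sum_(j < d) invmx ggram i j *: (ghvar A i 0 * ghvar A j 0).

Lemma schur1 i : gschur A ip gam (gam i) 1 = ghvar A i 0.
Proof.
have := schur_rec A ip gam (gam i) 0.
by rewrite csum0 schur0n mulr1 acre_gam.
Qed.

(** Multiply by twice the determinant of the Gram matrix, so that its inverse is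
replaced by the adjugate. *)
Lemma omega_multiple : exists2 n : nat, (0 < n)%N & Sc (gomega1 *+ n).
Proof.
have [D D0 HD] : exists2 D : nat, (0 < D)%N &
    forall i j, exists z : int, D%:R * invmx ggram i j = z%:~R.
  have gE : ggram = map_mx intr (igram ip gam).
    by apply/matrixP => i j; rewrite !mxE.
  have [gU|gU] := boolP (ggram \in unitmx); last first.
    (* The inverse of a singular matrix is the matrix itself, by convention. *)
    exists 1%N => // i j; exists (igram ip gam i j).
    by rewrite mul1r invmx_out ?inE// gE mxE.
  have det0 : \det (igram ip gam) != 0 by exact: igram_det_neq0.
  exists (absz (\det (igram ip gam))); first by rewrite absz_gt0.
  move=> i j; exists (sgz (\det (igram ip gam)) * (\adj (igram ip gam)) i j).
  rewrite /invmx gU mxE gE det_map_mx -map_mx_adj mxE rmorphM /=.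
  set D := \det _; rewrite mulrA; congr (_ * _).
  have -> : (absz D)%:R = (sgz D * D)%:~R :> C.
    by rewrite pmulrn abszEsg.
  by rewrite rmorphM /= mulfK// intr_eq0.
exists (2 * D)%N; first by rewrite muln_gt0.
rewrite /gomega1 -scaler_nat scalerA natrM mulrAC divff ?pnatr_eq0// mul1r.
rewrite scaler_sumr; apply: zspan_sum => i _.
rewrite scaler_sumr; apply: zspan_sum => j _.
rewrite scalerA; apply: schur_ringZ; first exact: HD.
by rewrite -!schur1; apply: schur_ringM; exact: schur_ring_schur.
Qed.

End Products.

Section Main.
Variables (R : realType) (L : zmodType) (d : nat).
Variables (ip : L -> L -> int) (gam : 'I_d -> L) (eps : L -> L -> int).
Hypothesis hip : is_posdef_even_form ip.
Hypothesis hgam : is_lattice_basis gam.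
Local Notation C := R[i].
Local Notation A := (mfock C d).
Local Notation VL := {malg A[L]}.
Local Notation V := (lattice_voa R ip gam eps).

Lemma lattice_nprodE (u : V) k (v : V) :
  nprod u k v = @gnprod C L d ip gam eps u k v.
Proof.
apply: eq_bigr => a _; apply: eq_bigr => m _; rewrite gY_monomE; exact: erefl.
Qed.

Lemma lattice_gradeE n : grade V n = @ggrade C L d ip n.
Proof. exact: erefl. Qed.

Lemma lattice_omegaE : omega V = @gtensor C L d A (@gomega1 C L d ip gam) 0.
Proof. exact: erefl. Qed.

Variable B : lattice_space R L d -> lattice_space R L d -> R[i].
Hypothesis hB : is_natural_form ip gam eps B.

Lemma natural_form_int (u v : VL) : @gVL_Z C L d A ip gam u -> @gVL_Z C L d A ip gam v ->
  exists z : int, B u v = z%:~R.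
Proof.
case: hB => -[[Bl Br] Bsym _ _] Bexp Bheis.
apply: (@form_int C L d A ip gam hip hgam B) => [w x y|x y|a b|a n x y].
- by have := Bl 1 x y w; rewrite scale1r mul1r.
- exact: Bsym.
- exact: Bexp.
exact: Bheis.
Qed.

Lemma gnprod_closed (P : L -> Prop) : P = (fun=> True) \/ P = (fun a => a = 0) ->
  forall (u v : VL) k, supported P u -> supported P v ->
  supported P (@gnprod C L d ip gam eps u k v).
Proof.
by move=> [] -> u v k Pu Pv; [move=> a []|exact: supported0_nprod].
Qed.

(** V_L and M(1) are treated at once, as the vectors supported on L and on 0. *)
Lemma supported_ivoa (P : L -> Prop) : P = (fun=> True) \/ P = (fun a => a = 0) ->
  is_IVOA (V := V) B (@supported C L d P)
    (@gVL_Z C L d A ip gam `&` @supported C L d P).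
Proof.
move=> PE; have P0 : P 0 by case: PE => ->.
have gtP (p : A) : supported P (gtensor p 0 : VL).
  by move=> a Pa; rewrite mcoeff_gtensor; case: eqP => // a0; rewrite -a0 in Pa.
have gtS (p : A) : @schur_ring C L d A ip gam p -> gVL_Z ip gam (gtensor p 0 : VL).
  exact: gVL_Z_gtensor.
split.
- by move=> v [].
- split.
  + split; first by split=> [|a _]; [exact: zspan0|exact: mcoeff0].
    move=> u v [Su Pu] [Sv Pv]; split; first exact: zspanB.
    by move=> a Pa; apply: etrans (mcoeffB _ _ _) _; rewrite Pu// Pv// subr0.
  + by split; [apply: gtS; exact: schur_ring1|exact: gtP].
  move=> u v n [Su Pu] [Sv Pv]; rewrite lattice_nprodE.
  by split; [exact: gVL_Z_nprod|exact: gnprod_closed].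
- have [n n0 Sn] := @omega_multiple C L d ip gam hip hgam.
  exists n => //; rewrite lattice_omegaE.
  have -> : gtensor (@gomega1 C L d ip gam) 0 *+ n =
      gtensor (@gomega1 C L d ip gam *+ n) 0 :> VL.
    by rewrite (morphDMn _ _ (gtensorD 0)).
  by split; [exact: gtS|exact: gtP].
- move=> n; rewrite lattice_gradeE.
  have [k [b [b1 b2 b3]]] := @graded_basis C L d ip gam hip hgam P n.
  by exists k, b; split.
move=> u v [Su _] [Sv _]; have [z ->] := natural_form_int Su Sv.
by exists z%:~R; rewrite ratr_int.
Qed.

End Main.

Theorem theorem3p3 (R : realType) (L : zmodType) (d : nat)
    (ip : L -> L -> int) (gam : 'I_d -> L) (eps : L -> L -> int)
    (hip : is_posdef_even_form ip)
    (hgam : is_lattice_basis gam)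
    (heps : is_cocycle ip eps)
    (B : lattice_space R L d -> lattice_space R L d -> R[i])
    (hB : is_natural_form ip gam eps B) :
  let V := lattice_voa R ip gam eps in
  let VLZ : set V := VL_Z ip gam in
  let M1 : set V := @heis_subVOA R L d in
  let M1Z : set V := M1_Z ip gam in
  [/\ is_IVOA (V := V) B setT VLZ,
      VLZ = Zva_generated (V := V)
              [set v : V | exists i : 'I_d,
                 v = lexp R d (gam i) \/ v = lexp R d (- gam i)],
      forall u v : V, VLZ u -> VLZ v -> exists z : int, B u v = z%:~R
    & is_IVOA (V := V) B M1 M1Z /\ M1Z `<=` VLZ].
Proof.
move=> V VLZ M1 M1Z.
pose A := mfock R[i] d; pose VL := {malg A[L]}.
have VLZE : VLZ = @gVL_Z R[i] L d A ip gam by exact: gVL_ZE.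
have VLZT : VLZ = @gVL_Z R[i] L d A ip gam `&` @supported R[i] L d (fun=> True).
  by rewrite VLZE; apply/seteqP; split=> [v Sv|v []//]; split=> // a [].
have setTE : setT = @supported R[i] L d (fun=> True).
  by apply/seteqP; split=> // v _ a [].
have M1E : M1 = @supported R[i] L d (fun a => a = 0).
  apply/seteqP; split=> [_ [p _ <-]|v v0]; first exact: supported0_gtensor.
  by exists (v@_0) => //; exact/esym/supported0E.
have M1ZE : M1Z = @gVL_Z R[i] L d A ip gam `&` @supported R[i] L d (fun a => a = 0).
  by rewrite /M1Z gM1_ZE; exact: gM1_Z_supported.
have ivoaV : is_IVOA (V := V) B setT VLZ.
  rewrite VLZT setTE; apply: (supported_ivoa hip hgam hB); by left.
split=> //.
- have [epsP _ _ _] := heps.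
  apply/seteqP; split=> [v|].
    rewrite VLZE => Sv S [[[S0 SB] Svac Snprod] Sgam].
    apply: (@gen_gVL_Z R[i] L d A ip gam eps hip hgam epsP S S0 SB Svac _ _ v Sv).
      move=> a k u Sa Su; rewrite -gnprod_exp//.
      have := Snprod _ u k Sa Su; rewrite lattice_nprodE; exact.
    by move=> i; split; apply: Sgam; exists i; [left|right].
  apply: smallest_sub; first by case: ivoaV.
  move=> v [i vE]; rewrite VLZE.
  case: vE => ->; apply: (@gVL_Z_gtensor R[i] L d ip gam); exact: schur_ring1.
- move=> u v; rewrite VLZE => Su Sv.
  exact: (@natural_form_int R L d ip gam eps hip hgam B hB u v Su Sv).
split; last by rewrite M1ZE VLZE => v [].
rewrite M1E M1ZE; apply: (supported_ivoa hip hgam hB); by right.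
Qed.
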